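(* Let $\sigma\in C^\infty(\mathbb{R}^N\setminus\{0\};(0,\infty))$ be a homogeneous function of degree $k>0$ satisfying $$\left|\frac{\partial^\gamma}{\partial\xi^\gamma}[\sigma(\xi)]\right|\leq A|\xi|^{k-|\gamma|},\qquad \xi\neq0,$$ for all multi-indices $\gamma\in(\mathbb{N}\cup\{0\})^N$ with $|\gamma|\leq[N/2]+1$. Then there exists a positive constant $C$ (independent of $\delta$ and $k$) such that $$\left|\frac{\partial^\gamma}{\partial\xi^\gamma}\left[|\xi|^\delta E_{\alpha,\beta}(-\sigma(\xi))\right]\right|\leq CA|\xi|^{-|\gamma|},\qquad \xi\neq0,$$ for all multi-indices $\gamma$ with $|\gamma|\leq[N/2]+1$, provided that $1<\alpha<2$ and $k\left(\frac{\beta}{\alpha}-\frac{1}{\alpha}\right)\leq\delta<k$.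
   Context: $E_{\alpha,\beta}(z)=\sum_{j=0}^\infty\frac{z^j}{\Gamma(\alpha j+\beta)}$, defined for all $\alpha,\beta>0$, is the two-parametric Mittag-Leffler function. $[N/2]$ is the integer part of $N/2$. Homogeneous of degree $k$ means $\sigma(\lambda\xi)=\lambda^k\sigma(\xi)$ for $\lambda>0$, $\xi\neq0$.
   Formalization: The hypothesis δ ≥ 0 is added: for 0 < β < 1 the printed range allows δ < 0, where the bound with γ = 0 always fails as ξ → 0, since |ξ|^δ → ∞ and E_{α,β}(−σ(ξ)) → 1/Γ(β) > 0. *)

(* Defs.v *)
From HB Require Import structures.
From mathcomp Require Export all_boot all_order all_algebra.
From mathcomp Require Export all_classical all_reals all_analysis.
Export Order.TTheory GRing.Theory Num.Theory.
Export numFieldNormedType.Exports.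

Set Implicit Arguments.
Unset Strict Implicit.
Unset Printing Implicit Defensive.

Local Open Scope classical_set_scope.
Local Open Scope ring_scope.

(* Euler's integral, meaningful for x > 0, which is the only range used. *)
Definition Gamma (R : realType) (x : R) : R :=
  Rintegral (@lebesgue_measure R) `]0, +oo[ (fun t => t `^ (x - 1) * expR (- t)).

Definition mittag_leffler (R : realType) (alpha beta z : R) : R :=
  limn (series (fun j => z ^+ j / Gamma (alpha * j%:R + beta))).

(* The library norm on row vectors is the sup norm; this is the Euclidean one. *)
Definition enorm (R : realType) (N : nat) (xi : 'rV[R]_N) : R :=
  Num.sqrt (\sum_(i < N) xi ord0 i ^+ 2).

Definition partial (R : realType) (N : nat) (i : 'I_N) (f : 'rV[R]_N -> R) :
  'rV[R]_N -> R := fun xi => 'D_(delta_mx ord0 i) f xi.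

Definition mlen (N : nat) (g : 'I_N -> nat) : nat := (\sum_(i < N) g i)%N.

(* d_0^(g 0) (d_1^(g 1) ( ... f)); the order is immaterial for smooth f. *)
Definition mpartial (R : realType) (N : nat) (g : 'I_N -> nat)
    (f : 'rV[R]_N -> R) : 'rV[R]_N -> R :=
  foldr (fun i h => iter (g i) (partial i) h) f (enum 'I_N).

(* Functions on R^N \ {0} are represented by total functions whose value at 0
   is irrelevant: partial derivatives at xi != 0 only depend on values near xi.
   The list s ranges over all iterated partials, in any order. *)
Definition smooth_off0 (R : realType) (N : nat) (f : 'rV[R]_N -> R) : Prop :=
  forall (s : seq 'I_N) (xi : 'rV[R]_N), xi != 0 ->
    {for xi, continuous (foldr (@partial R N) f s)} /\
    forall i : 'I_N, derivable (foldr (@partial R N) f s) xi (delta_mx ord0 i).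

Definition homogeneous_off0 (R : realType) (N : nat) (k : R)
    (f : 'rV[R]_N -> R) : Prop :=
  forall (lambda : R) (xi : 'rV[R]_N), 0 < lambda -> xi != 0 ->
    f (lambda *: xi) = lambda `^ k * f xi.

(* Main.v *)
Require Import Defs.
From mathcomp Require Import measurable_realfun complex ring lra.

(** The multiplier is [f = |x|^delta E_z(- sigma)] with [z = beta], where [E_z] is the Mittag-Leffler
    function with parameters [alpha] and [z].

    Analysis in one variable. Two facts about [E_z] carry the proof. The first is the identity
    [alpha s d/ds E_z(- s) = E_(z - 1)(- s) - (z - 1) E_z(- s)], valid for all real [z] once
    [1 / Gamma] is extended to the whole line ([is_derive_mlf]). The second is the decay
    [|E_z(- s)| <= C / (1 + s)] for [s >= 0] ([ml_bound]). Both come from Hankel's integral for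
    [1 / Gamma z], taken over a contour that goes to infinity along the rays of argument [theta] and
    [- theta] with [pi / 2 < theta < pi / alpha]; this is where [1 < alpha < 2] enters. Summing the
    power series under the integral sign ([cvg_ml]) gives
    [E_z(- s) = 1 / (2 i pi) \int exp (tau) tau^(alpha - z) / (tau^alpha + s) d tau] over a contour
    that surrounds a large disc. The integrand has no pole between that contour and the one through
    the unit circle, because [alpha theta < pi]. On the latter [|tau^alpha + s|] is at least a
    constant times [1 + s], and the decay follows.

    Hankel's formula itself ([rgammaE]) is obtained by multiplying the contour integral by
    Euler's integral [\int u^(z - 1) exp (- u) du], dilating the contour by [u] and exchanging the
    integrals. What is left is the integral of [tau^(- z) / (1 - tau)], whose value [2 i pi] is the
    residue at [tau = 1] ([pole_contour]). In place of complex function theory, everything rests on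
    Green's theorem for rectangles in the coordinate [zeta = ln tau] ([green_rectangle]), which
    expresses Cauchy's theorem as well as the translation of a ray.

    Analysis in several variables. By homogeneity, [sigma] is [|x|^(k - k0)] times a fixed function
    [sigma0] with the same values on the unit sphere. Hence [d_i sigma / sigma = k p_i + q_i], where
    [p_i] and [q_i] are homogeneous of degree -1 and depend on neither [k] nor [delta]. The identity
    for the derivative of [E_z] therefore shows by induction that [n] derivatives of [f] give a sum
    of terms [c phi |x|^delta E_w(- sigma)], where [phi] is fixed and homogeneous of degree [- n] and
    [|c| <= C (1 + k)^n] ([amplitude_derive]). The decay of [E_w] and [0 <= delta <= k] bound
    [|x|^delta E_w(- sigma)] by a constant ([amplitude_bound]).

    Finally the factor [(1 + k)^n] has to be absorbed into a single power of [A]. The hypothesis on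
    [sigma] at a basis vector, applied to the pure derivative of the highest order
    [m = N / 2 + 1], reads [|k (k - 1) ... (k - m + 1)| sigma <= A], and applied without
    differentiation it reads [sigma <= A]; together these give [(1 + k)^m <= L A]
    ([derivative_bound_lower]) with [L] depending only on the values on the sphere. *)

Set Implicit Arguments.
Unset Strict Implicit.
Unset Printing Implicit Defensive.

Local Open Scope classical_set_scope.
Local Open Scope ring_scope.
Local Open Scope complex_scope.
Import Normc.

(** * Integrals over segments and half-lines *)

Section RealIntegrals.
Variable R : realType.
Notation mu := (@lebesgue_measure R).
Implicit Types (f g F G : R -> R) (a b c x y : R).

Lemma is_derive_continuous f x d : is_derive x 1 f d -> {for x, continuous f}.
Proof. by move=> h; apply/differentiable_continuous/derivable1_diffP. Qed.

Lemma continuous_integrable f a b : (forall x, x \in `[a, b] -> {for x, continuous f}) ->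
  mu.-integrable `[a, b] (EFin \o f).
Proof.
move=> h; apply: continuous_compact_integrable; first exact: segment_compact.
apply/continuous_in_subspaceT => x /set_mem xab; exact: h.
Qed.

Lemma Rintegral_FTC2 f F a b : a <= b ->
  (forall x, x \in `[a, b] -> is_derive x 1 F (f x)) ->
  (forall x, x \in `[a, b] -> {for x, continuous f}) ->
  \int[mu]_(x in `[a, b]) f x = F b - F a.
Proof.
rewrite le_eqVlt => /predU1P[->|ab] dF cf.
  by rewrite set_itv1 Rintegral_set1 subrr.
rewrite /Rintegral (@continuous_FTC2 _ f F a b) //.
- apply/continuous_in_subspaceT => x /set_mem xab; exact: cf.
- have cF x : x \in `[a, b] -> {for x, continuous F}.
    by move=> /dF /is_derive_continuous.
  split.
  + move=> x xab; have := dF x (subset_itv_oo_cc xab); move=> h.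
    by exact: ex_derive.
  + apply: cvg_at_right_filter; apply: cF; by rewrite in_itv /= lexx ltW.
  + apply: cvg_at_left_filter; apply: cF; by rewrite in_itv /= lexx ltW.
- move=> x xab; have h := dF x (subset_itv_oo_cc xab).
  by rewrite derive1E; exact: derive_val.
Qed.

Lemma Rintegral_norm_le f a b K : a <= b ->
  (forall x, x \in `[a, b] -> {for x, continuous f}) ->
  (forall x, x \in `[a, b] -> `|f x| <= K) ->
  `|\int[mu]_(x in `[a, b]) f x| <= K * (b - a).
Proof.
move=> ab cf fK.
apply: (le_trans (le_normr_Rintegral _ (continuous_integrable cf))) => //.
have -> : K * (b - a) = \int[mu]_(x in `[a, b]) (cst K) x.
  rewrite Rintegral_cst //= lebesgue_measure_itv /= lte_fin.
  by case: ltgtP ab => // -> _; rewrite /= !subrr.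
apply: le_Rintegral => //.
  exact: (integrable_norm (continuous_integrable cf)).
by apply: continuous_integrable => x _; exact: cvg_cst.
Qed.

(** Differentiating [\int F(a, b) db] under the integral sign gives [\int h(a, b) db], and [h = dG/db]
    integrates to a boundary term. The margin 1 around [a1, a2] provides the open interval that differentiation
    under the integral sign asks for. *)
Lemma green_rectangle (F G h : R -> R -> R) a1 a2 b1 b2 K :
  a1 <= a2 -> b1 <= b2 ->
  (forall a b, a \in `[a1 - 1, a2 + 1] -> b \in `[b1, b2] -> is_derive a 1 (F ^~ b) (h a b)) ->
  (forall a b, a \in `[a1 - 1, a2 + 1] -> b \in `[b1, b2] -> is_derive b 1 (G a) (h a b)) ->
  (forall a b, a \in `[a1 - 1, a2 + 1] -> b \in `[b1, b2] -> {for b, continuous (F a)}) ->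
  (forall a b, a \in `[a1 - 1, a2 + 1] -> b \in `[b1, b2] -> {for b, continuous (h a)}) ->
  (forall a b, a \in `[a1 - 1, a2 + 1] -> b \in `[b1, b2] -> {for a, continuous (G ^~ b)}) ->
  (forall a b, a \in `[a1 - 1, a2 + 1] -> b \in `[b1, b2] -> `|h a b| <= K) ->
  \int[mu]_(b in `[b1, b2]) (F a2 b) - \int[mu]_(b in `[b1, b2]) (F a1 b) =
  \int[mu]_(a in `[a1, a2]) (G a b2 - G a b1).
Proof.
move=> a12 b12 dF dG cF ch cG hK.
have b1i : b1 \in `[b1, b2] by rewrite in_itv /= lexx.
have b2i : b2 \in `[b1, b2] by rewrite in_itv /= lexx andbT.
have wide a : a \in `[a1, a2] -> a \in `[a1 - 1, a2 + 1].
  rewrite !in_itv /= => /andP[? ?]; apply/andP; split; lra.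
pose I a := \int[mu]_(b in `[b1, b2]) (F a b).
have dI a : a \in `[a1, a2] -> is_derive a 1 I (G a b2 - G a b1).
  move=> ai.
  have mB : measurable (`[b1, b2] : set R) by exact: measurable_itv.
  have Ia : `]a1 - 1, a2 + 1[%classic a.
    move: ai; rewrite /= !in_itv /= => /andP[? ?]; apply/andP; split; lra.
  have intf x : `]a1 - 1, a2 + 1[%classic x -> mu.-integrable `[b1, b2] (EFin \o F x).
    by move=> /= xi; apply: continuous_integrable => b bi; apply: cF => //; exact: subset_itv_oo_cc.
  have der x y : `]a1 - 1, a2 + 1[%classic x -> `[b1, b2]%classic y -> derivable (F^~ y) x 1.
    move=> /= xi yi; have hd := dF x y (subset_itv_oo_cc xi) yi; exact: ex_derive.
  have K0 : 0 <= K by apply: le_trans (hK a b1 (wide a ai) b1i).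
  have intK : mu.-integrable `[b1, b2] (EFin \o (cst K : R -> R)).
    by apply: continuous_integrable => x _; exact: cvg_cst.
  have d1E x y : `]a1 - 1, a2 + 1[%classic x -> `[b1, b2]%classic y -> partial1of2 F x y = h x y.
    move=> /= xi yi; have hd := dF x y (subset_itv_oo_cc xi) yi.
    by rewrite partial1of2E; exact: derive_val.
  have ub x y : `]a1 - 1, a2 + 1[%classic x -> `[b1, b2]%classic y -> `|partial1of2 F x y| <= cst K y.
    by move=> xi yi; rewrite d1E //; apply: hK => //; exact: subset_itv_oo_cc.
  apply: DeriveDef.
    exact: (@derivable_under_integral R _ _ mu F _ mB _ _ _ Ia intf der _ (fun=> K0) intK ub).
  rewrite -derive1E (@differentiation_under_integral R _ _ mu F _ mB _ _ _ Ia intf der _ (fun=> K0) intK ub) //.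
  transitivity (\int[mu]_(b in `[b1, b2]) h a b).
    by apply: eq_Rintegral => y /set_mem yi; rewrite d1E.
  apply: (@Rintegral_FTC2 (h a)) => // x xi.
  - by apply: dG => //; exact: wide.
  - by apply: ch => //; exact: wide.
symmetry; apply: (@Rintegral_FTC2 (fun a => G a b2 - G a b1) I) => // x /wide xi.
by apply: cvgB; exact: cG.
Qed.

Lemma Rintegral_FTC2y_ge0 f F l : (forall x, 0 <= x -> 0 <= f x) ->
  (forall x, {for x, continuous f}) -> (forall x, is_derive x 1 F (f x)) ->
  F x @[x --> +oo] --> l ->
  mu.-integrable `[0, +oo[ (EFin \o f) /\ \int[mu]_(x in `[0, +oo[) f x = l - F 0.
Proof.
move=> f0 cf dF Fl.
have cF x : {for x, continuous F} by exact: is_derive_continuous (dF x).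
have E : (\int[mu]_(x in `[0%R, +oo[) (f x)%:E = l%:E - (F 0)%:E)%E.
  apply: (ge0_continuous_FTC2y f0 _ Fl).
  - by apply: continuous_subspaceT => x; exact: cf.
  - move=> x _; have h := dF x; exact: ex_derive.
  - by apply: cvg_at_right_filter; exact: cF.
  - by move=> x _; rewrite derive1E; have h := dF x; exact: derive_val.
have mf : measurable_fun (`[0, +oo[ : set R) f.
  by apply: measurable_funTS; apply: continuous_measurable_fun.
split.
  apply/integrableP; split; first exact/measurable_EFinP.
  rewrite [ltLHS](_ : _ = \int[mu]_(x in `[0%R, +oo[) (f x)%:E)%E; first by rewrite E -EFinD ltry.
  apply: eq_integral => x /set_mem /=; rewrite in_itv /= andbT => x0.
  by rewrite ger0_norm // f0.
by rewrite /Rintegral E -EFinD.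
Qed.

Lemma is_derive_expRN p x : p != 0 ->
  is_derive x 1 (fun x => - (expR (- (p * x)) / p)) (expR (- (p * x))).
Proof.
move=> p0.
have h1 : is_derive x 1 (fun x => - (p * x)) (- p).
  by apply: is_derive_eq; rewrite /GRing.scale /= mulr1.
have h2 := is_derive1_comp (g := fun x => - (p * x)) (is_derive_expR (- (p * x))) h1.
apply: (is_derive_eq (is_deriveN (is_deriveM h2 (is_derive_cst p^-1 x 1)))).
by rewrite /GRing.scale /= mulr0 add0r; field.
Qed.

Lemma expRN_cvg0 p : 0 < p -> expR (- (p * x)) @[x --> +oo] --> (0 : R).
Proof.
move=> p0; apply: (cvg_comp (fun x => p * x) (fun x => expR (- x))); last exact: cvgr_expR.
exact: gt0_cvgMry.
Qed.

Lemma ray_exp_integral p : 0 < p ->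
  mu.-integrable `[0, +oo[ (EFin \o (fun x => expR (- (p * x)))) /\
  \int[mu]_(x in `[0, +oo[) expR (- (p * x)) = p^-1.
Proof.
move=> p0.
have cf x : {for x, continuous (fun x : R => expR (- (p * x)))}.
  apply: (@continuous_comp _ _ _ (fun x : R => - (p * x)) expR); last exact: continuous_expR.
  by apply: continuousN; apply: mulrl_continuous.
have lF : (fun x : R => - (expR (- (p * x)) / p)) x @[x --> +oo] --> (0 : R).
  rewrite -oppr0; apply: cvgN; rewrite -(mul0r p^-1); apply: cvgMl.
  exact: expRN_cvg0.
have dF x := is_derive_expRN x (lt0r_neq0 p0).
have [i E] := Rintegral_FTC2y_ge0 (fun x _ => expR_ge0 (- (p * x))) cf dF lF.
by split => //; rewrite E mulr0 oppr0 expR0 mul1r sub0r opprK.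
Qed.

Lemma ray_integrable_exp f C p : 0 < p -> (forall x, {for x, continuous f}) ->
  (forall x, 0 <= x -> `|f x| <= C * expR (- (p * x))) ->
  mu.-integrable `[0, +oo[ (EFin \o f) /\ \int[mu]_(x in `[0, +oo[) `|f x| <= C / p.
Proof.
move=> p0 cf fC; have [ie E] := ray_exp_integral p0.
have mA : measurable (`[0, +oo[ : set (measurableTypeR R)) by exact: measurable_itv.
have mf : measurable_fun (`[0, +oo[ : set R) f.
  by apply: measurable_funTS; apply: continuous_measurable_fun.
have iC : mu.-integrable `[0, +oo[ (EFin \o (fun x => C * expR (- (p * x)))).
  by have := integrableZl mA C ie; apply: eq_integrable.
have fi : mu.-integrable `[0, +oo[ (EFin \o f).
  apply: le_integrable iC => //; first exact/measurable_EFinP.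
  move=> x /=; rewrite in_itv /= andbT => x0; rewrite lee_fin.
  by rewrite (le_trans (fC x x0)) // ler_norm.
split=> //.
have -> : C / p = \int[mu]_(x in `[0, +oo[) (C * expR (- (p * x))) by rewrite RintegralZl // E.
apply: le_Rintegral => //; first exact: integrable_norm.
by move=> x /=; rewrite in_itv /= andbT => x0; exact: fC.
Qed.

Lemma ray_integrable f C : (forall x, {for x, continuous f}) ->
  (forall x, 0 <= x -> `|f x| <= C * expR (- x)) ->
  mu.-integrable `[0, +oo[ (EFin \o f) /\ `|\int[mu]_(x in `[0, +oo[) f x| <= C.
Proof.
move=> cf fC; have fC' x : 0 <= x -> `|f x| <= C * expR (- (1 * x)) by rewrite mul1r; exact: fC.
have [fi h] := ray_integrable_exp ltr01 cf fC'; split=> //.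
rewrite divr1 in h; apply: le_trans h; apply: le_normr_Rintegral => //; exact: measurable_itv.
Qed.

Lemma ray_limit f : mu.-integrable `[0, +oo[ (EFin \o f) ->
  (\int[mu]_(x in `[0, n%:R]) f x) @[n --> \oo] --> \int[mu]_(x in `[0, +oo[) f x.
Proof.
move=> fi.
have mA : measurable (`[0, +oo[ : set (measurableTypeR R)) by exact: measurable_itv.
have mn (n : nat) : measurable (`[0, n%:R] : set (measurableTypeR R)) by exact: measurable_itv.
have sub (n : nat) : (`[0, n%:R] `<=` (`[0, +oo[ : set R)).
  by move=> x /=; rewrite !in_itv /= => /andP[-> _].
apply: fine_cvg; rewrite fineK; last exact: integrable_fin_num.
have -> : (fun n : nat => (\int[mu]_(x in `[0%R, n%:R]) (f x)%:E)%E) =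
          (fun n : nat => (\int[mu]_(x in `[0%R, +oo[) ((EFin \o f) \_ `[0%R, n%:R]) x)%E).
  apply/funext => n; rewrite -integral_mkcondr; congr integral.
  by rewrite setIidr.
apply: (@dominated_cvg _ _ _ mu _ mA (fun n => (EFin \o f) \_ `[0%R, n%:R]) (EFin \o f) (fun x => `|(f x)%:E|%E)) => //.
- move=> n; apply/(measurable_restrict (EFin \o f) (mn n) mA). 
  apply: (measurable_funS mA (@subIsetl _ _ _)); exact: (measurable_int mu fi).
- move=> x /=; rewrite in_itv /= andbT => x0.
  apply: cvg_near_cst; near=> n.
  rewrite patchE mem_set //= in_itv /= x0 /=.
  by near: n; exact: nbhs_infty_ger.
- exact: integrable_abse.
- move=> n x _; rewrite patchE; case: ifPn => // _; by rewrite abse0.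
Unshelve. all: by end_near. Qed.

End RealIntegrals.

(** * Holomorphic functions on a strip *)

Section ComplexFunctions.
Variable R : realType.
Notation mu := (@lebesgue_measure R).
Notation Re := (@complex.Re R).
Notation Im := (@complex.Im R).
Implicit Types (z w : R[i]) (a b c x y : R) (f g : R -> R -> R[i]).

Lemma complex_eqP z w : Re z = Re w -> Im z = Im w -> z = w.
Proof. by case: z w => [a b] [c d] /= -> ->. Qed.
Lemma ReD z w : Re (z + w) = Re z + Re w. Proof. by case: z w => [a b] [c d]. Qed.
Lemma ImD z w : Im (z + w) = Im z + Im w. Proof. by case: z w => [a b] [c d]. Qed.
Lemma ReM z w : Re (z * w) = Re z * Re w - Im z * Im w.
Proof. by case: z w => [a b] [c d]. Qed.
Lemma ImM z w : Im (z * w) = Re z * Im w + Im z * Re w.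
Proof. by case: z w => [a b] [c d]. Qed.
Lemma ReV z : Re z^-1 = Re z / (Re z ^+ 2 + Im z ^+ 2).
Proof. by case: z => [a b]. Qed.
Lemma ImV z : Im z^-1 = - Im z / (Re z ^+ 2 + Im z ^+ 2).
Proof. by case: z => [a b] /=; rewrite mulNr. Qed.
Lemma normcE2 z : normc z = Num.sqrt (Re z ^+ 2 + Im z ^+ 2).
Proof. by rewrite /normc; case: z => a b. Qed.
Lemma normc_ge0 z : 0 <= normc z.
Proof. by rewrite normcE2 sqrtr_ge0. Qed.
Lemma normc_eq0 z : (normc z == 0) = (z == 0).
Proof. by apply/eqP/eqP => [/eq0_normc //|->]; exact: normc0. Qed.
Lemma normcD z w : normc (z + w) <= normc z + normc w.
Proof. exact: le_normcD. Qed.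
Lemma sqr_normcE z : normc z ^+ 2 = Re z ^+ 2 + Im z ^+ 2.
Proof. by rewrite normcE2 sqr_sqrtr // addr_ge0 // sqr_ge0. Qed.
Lemma Re_le_normc z : `|Re z| <= normc z.
Proof. by rewrite normcE2 -sqrtr_sqr ler_wsqrtr // lerDl sqr_ge0. Qed.
Lemma Im_le_normc z : `|Im z| <= normc z.
Proof. by rewrite normcE2 -sqrtr_sqr ler_wsqrtr // lerDr sqr_ge0. Qed.

Definition cexp z : R[i] := (expR (Re z) * cos (Im z)) +i* (expR (Re z) * sin (Im z)).

Lemma cexpD z w : cexp (z + w) = cexp z * cexp w.
Proof.
by case: z w => [a b] [c d]; apply: complex_eqP => /=; rewrite expRD ?cosD ?sinD; ring.
Qed.
Lemma normc_cexp z : normc (cexp z) = expR (Re z).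
Proof.
rewrite normcE2 /= !exprMn -mulrDr cos2Dsin2 mulr1 sqrtr_sqr ger0_norm //; exact: expR_ge0.
Qed.
(** [d] is the complex derivative of [f] at [a + ib]. The definition lists real partial derivatives,
    Cauchy-Riemann equations included, because only real and imaginary parts get integrated. *)
Definition cderiv f a b (d : R[i]) :=
  [/\ is_derive a 1 (fun x => Re (f x b)) (Re d), is_derive a 1 (fun x => Im (f x b)) (Im d),
      is_derive b 1 (fun y => Re (f a y)) (- Im d) & is_derive b 1 (fun y => Im (f a y)) (Re d)].

Lemma cderiv_cst z a b : cderiv (fun _ _ => z) a b 0.
Proof. split => /=; rewrite ?oppr0; exact: is_derive_cst. Qed.

Lemma cderiv_id a b : cderiv (fun a b => a +i* b) a b 1.
Proof.
split => /=; rewrite ?oppr0; try exact: is_derive_cst; exact: is_derive_id.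
Qed.

Lemma cderivD f g a b df dg : cderiv f a b df -> cderiv g a b dg ->
  cderiv (fun a b => f a b + g a b) a b (df + dg).
Proof.
move=> [f1 f2 f3 f4] [g1 g2 g3 g4]; split.
- rewrite (_ : (fun x => _) = (fun x => Re (f x b)) + (fun x => Re (g x b))); last first.
    by apply/funext => x; rewrite raddfD.
  by apply: is_derive_eq; rewrite raddfD.
- rewrite (_ : (fun x => _) = (fun x => Im (f x b)) + (fun x => Im (g x b))); last first.
    by apply/funext => x; rewrite raddfD.
  by apply: is_derive_eq; rewrite raddfD.
- rewrite (_ : (fun x => _) = (fun x => Re (f a x)) + (fun x => Re (g a x))); last first.
    by apply/funext => x; rewrite raddfD.
  by apply: is_derive_eq; rewrite raddfD opprD.
- rewrite (_ : (fun x => _) = (fun x => Im (f a x)) + (fun x => Im (g a x))); last first.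
    by apply/funext => x; rewrite raddfD.
  by apply: is_derive_eq; rewrite raddfD.
Qed.

Lemma cderivM f g a b df dg : cderiv f a b df -> cderiv g a b dg ->
  cderiv (fun a b => f a b * g a b) a b (df * g a b + f a b * dg).
Proof.
move=> [f1 f2 f3 f4] [g1 g2 g3 g4].
split.
- under eq_fun do rewrite ReM.
  by apply: is_derive_eq; rewrite !raddfD /= !ReM /GRing.scale /=; ring.
- under eq_fun do rewrite ImM.
  by apply: is_derive_eq; rewrite !raddfD /= !ImM /GRing.scale /=; ring.
- under eq_fun do rewrite ReM.
  by apply: is_derive_eq; rewrite !raddfD /= !ImM /GRing.scale /=; ring.
- under eq_fun do rewrite ImM.
  by apply: is_derive_eq; rewrite !raddfD /= !ReM /GRing.scale /=; ring.
Qed.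

Lemma cderiv_cexp f a b df : cderiv f a b df ->
  cderiv (fun a b => cexp (f a b)) a b (df * cexp (f a b)).
Proof.
move=> [f1 f2 f3 f4].
have ec (u v : R -> R) x du dv : is_derive x 1 u du -> is_derive x 1 v dv ->
    is_derive x 1 (fun x => expR (u x) * cos (v x)) (du * (expR (u x) * cos (v x)) - dv * (expR (u x) * sin (v x))).
  move=> hu hv.
  have h1 := is_derive1_comp (is_derive_expR (u x)) hu.
  have h2 := is_derive1_comp (is_derive_cos (v x)) hv.
  apply: (is_derive_eq (is_deriveM h1 h2)); rewrite /GRing.scale /=; ring.
have es (u v : R -> R) x du dv : is_derive x 1 u du -> is_derive x 1 v dv ->
    is_derive x 1 (fun x => expR (u x) * sin (v x)) (du * (expR (u x) * sin (v x)) + dv * (expR (u x) * cos (v x))).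
  move=> hu hv.
  have h1 := is_derive1_comp (is_derive_expR (u x)) hu.
  have h2 := is_derive1_comp (is_derive_sin (v x)) hv.
  apply: (is_derive_eq (is_deriveM h1 h2)); rewrite /GRing.scale /=; ring.
split.
- by apply: (is_derive_eq (ec _ _ _ _ _ f1 f2)); rewrite ReM.
- by apply: (is_derive_eq (es _ _ _ _ _ f1 f2)); rewrite ImM.
- by apply: (is_derive_eq (ec _ _ _ _ _ f3 f4)); rewrite ImM /=; ring.
- by apply: (is_derive_eq (es _ _ _ _ _ f3 f4)); rewrite ReM /=; ring.
Qed.

Lemma cderivV f a b df : cderiv f a b df -> f a b != 0 ->
  cderiv (fun a b => (f a b)^-1) a b (- df * (f a b)^-1 * (f a b)^-1).
Proof.
move=> [f1 f2 f3 f4] f0.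
have n0 : Re (f a b) ^+ 2 + Im (f a b) ^+ 2 != 0.
  by rewrite -sqr_normcE sqrf_eq0 normc_eq0.
have dn (u v : R -> R) x du dv : is_derive x 1 u du -> is_derive x 1 v dv -> u x ^+ 2 + v x ^+ 2 != 0 ->
    is_derive x 1 (fun x => (u x ^+ 2 + v x ^+ 2)^-1)
      (- (2 * u x * du + 2 * v x * dv) / (u x ^+ 2 + v x ^+ 2) ^+ 2).
  move=> hu hv h0.
  have h1 : is_derive x 1 (fun x => u x ^+ 2 + v x ^+ 2) (2 * u x * du + 2 * v x * dv).
    apply: (is_derive_eq (is_deriveD (is_deriveX 2 hu) (is_deriveX 2 hv))).
    by rewrite /GRing.scale /= expr1.
  by apply: (is_derive_eq (is_deriveV (f := fun x => u x ^+ 2 + v x ^+ 2) h0 h1)); rewrite /GRing.scale /=; field.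
have dq (u v : R -> R) x du dv : is_derive x 1 u du -> is_derive x 1 v dv -> u x ^+ 2 + v x ^+ 2 != 0 ->
    is_derive x 1 (fun x => u x / (u x ^+ 2 + v x ^+ 2))
      (du / (u x ^+ 2 + v x ^+ 2) - u x * (2 * u x * du + 2 * v x * dv) / (u x ^+ 2 + v x ^+ 2) ^+ 2).
  move=> hu hv h0.
  by apply: (is_derive_eq (is_deriveM hu (dn _ _ _ _ _ hu hv h0))); rewrite /GRing.scale /=; field.
have dq' (u v : R -> R) x du dv : is_derive x 1 u du -> is_derive x 1 v dv -> u x ^+ 2 + v x ^+ 2 != 0 ->
    is_derive x 1 (fun x => - v x / (u x ^+ 2 + v x ^+ 2))
      (- dv / (u x ^+ 2 + v x ^+ 2) + v x * (2 * u x * du + 2 * v x * dv) / (u x ^+ 2 + v x ^+ 2) ^+ 2).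
  move=> hu hv h0; have hn := is_deriveN hv.
  by apply: (is_derive_eq (is_deriveM (hn : is_derive x 1 (fun x => - v x) (- dv)) (dn _ _ _ _ _ hu hv h0))); rewrite /GRing.scale /=; field.
split.
- under eq_fun do rewrite ReV.
  apply: (is_derive_eq (dq _ _ _ _ _ f1 f2 n0)).
  by rewrite !(ReM, ImM) ReV ImV !raddfN /=; field.
- under eq_fun do rewrite ImV.
  apply: (is_derive_eq (dq' _ _ _ _ _ f1 f2 n0)).
  by rewrite !(ReM, ImM) ReV ImV !raddfN /=; field.
- under eq_fun do rewrite ReV.
  apply: (is_derive_eq (dq _ _ _ _ _ f3 f4 n0)).
  by rewrite !(ReM, ImM) ReV ImV !raddfN /=; field.
- under eq_fun do rewrite ImV.
  apply: (is_derive_eq (dq' _ _ _ _ _ f3 f4 n0)).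
  by rewrite !(ReM, ImM) ReV ImV !raddfN /=; field.
Qed.

Lemma cderiv_cont f a b d : cderiv f a b d ->
  [/\ {for a, continuous (fun x => Re (f x b))}, {for a, continuous (fun x => Im (f x b))},
      {for b, continuous (fun y => Re (f a y))} & {for b, continuous (fun y => Im (f a y))}].
Proof. by move=> [h1 h2 h3 h4]; split; exact: is_derive_continuous. Qed.

Definition locally_bounded (S : R -> Prop) f :=
  forall A, exists K, forall a b, `|a| <= A -> S b -> normc (f a b) <= K.

Lemma locally_boundedD S f g : locally_bounded S f -> locally_bounded S g ->
  locally_bounded S (fun a b => f a b + g a b).
Proof.
move=> hf hg A; have [K1 h1] := hf A; have [K2 h2] := hg A; exists (K1 + K2) => a b aA Sb.
by rewrite (le_trans (normcD _ _)) // lerD // ?h1 ?h2.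
Qed.

Lemma locally_boundedM S f g : locally_bounded S f -> locally_bounded S g ->
  locally_bounded S (fun a b => f a b * g a b).
Proof.
move=> hf hg A; have [K1 h1] := hf A; have [K2 h2] := hg A; exists (K1 * K2) => a b aA Sb.
by rewrite normcM ler_pM ?normc_ge0 ?h1 ?h2.
Qed.

Lemma locally_bounded_cst S z : locally_bounded S (fun _ _ => z).
Proof. by move=> A; exists (normc z). Qed.

Lemma locally_boundedN S f : locally_bounded S f -> locally_bounded S (fun a b => - f a b).
Proof. by move=> hf A; have [K h] := hf A; exists K => a b aA Sb; rewrite normcN h. Qed.

Lemma locally_bounded_cexp S f : locally_bounded S f -> locally_bounded S (fun a b => cexp (f a b)).
Proof.
move=> hf A; have [K h] := hf A; exists (expR K) => a b aA Sb.
rewrite normc_cexp ler_expR (le_trans (ler_norm _)) // (le_trans (Re_le_normc _)) //; exact: h.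
Qed.

(** The second derivative is there to make the first one continuous, the bounds to dominate the
    first one under an integral sign. *)
Definition holo (S : R -> Prop) f := exists f1 f2,
  [/\ forall a b, S b -> cderiv f a b (f1 a b), forall a b, S b -> cderiv f1 a b (f2 a b),
      locally_bounded S f & locally_bounded S f1].

Lemma holo_cst S z : holo S (fun _ _ => z).
Proof.
exists (fun _ _ => 0), (fun _ _ => 0); split; try (move=> *; exact: cderiv_cst).
all: exact: locally_bounded_cst.
Qed.

Lemma holo_id S B : (forall b, S b -> `|b| <= B) -> holo S (fun a b => a +i* b).
Proof.
move=> SB; exists (fun _ _ => 1), (fun _ _ => 0); split.
- by move=> *; exact: cderiv_id.
- by move=> *; exact: cderiv_cst.
- move=> A; exists (Num.sqrt (A ^+ 2 + B ^+ 2)) => a b aA Sb /=.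
  rewrite ler_wsqrtr // lerD // -(real_normK (num_real _)) lerXn2r ?nnegrE //.
  + exact: le_trans aA.
  + exact: le_trans (SB b Sb).
  + exact: SB.
- exact: locally_bounded_cst.
Qed.

Lemma holoD S f g : holo S f -> holo S g -> holo S (fun a b => f a b + g a b).
Proof.
move=> [f1 [f2 [df df1 bf bf1]]] [g1 [g2 [dg dg1 bg bg1]]].
exists (fun a b => f1 a b + g1 a b), (fun a b => f2 a b + g2 a b); split.
- by move=> a b Sb; apply: cderivD; [exact: df|exact: dg].
- by move=> a b Sb; apply: cderivD; [exact: df1|exact: dg1].
- exact: locally_boundedD.
- exact: locally_boundedD.
Qed.

Lemma holoM S f g : holo S f -> holo S g -> holo S (fun a b => f a b * g a b).
Proof.
move=> [f1 [f2 [df df1 bf bf1]]] [g1 [g2 [dg dg1 bg bg1]]].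
exists (fun a b => f1 a b * g a b + f a b * g1 a b),
  (fun a b => (f2 a b * g a b + f1 a b * g1 a b) + (f1 a b * g1 a b + f a b * g2 a b)); split.
- by move=> a b Sb; apply: cderivM; [exact: df|exact: dg].
- by move=> a b Sb; apply: cderivD; apply: cderivM; [exact: df1|exact: dg|exact: df|exact: dg1].
- exact: locally_boundedM.
- by apply: locally_boundedD; exact: locally_boundedM.
Qed.

Lemma holo_cexp S f : holo S f -> holo S (fun a b => cexp (f a b)).
Proof.
move=> [f1 [f2 [df df1 bf bf1]]].
exists (fun a b => f1 a b * cexp (f a b)),
  (fun a b => f2 a b * cexp (f a b) + f1 a b * (f1 a b * cexp (f a b))); split.
- by move=> a b Sb; apply: cderiv_cexp; exact: df.
- by move=> a b Sb; apply: cderivM; [exact: df1|apply: cderiv_cexp; exact: df].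
- exact: locally_bounded_cexp.
- by apply: locally_boundedM => //; exact: locally_bounded_cexp.
Qed.

Lemma holoV S f k : 0 < k -> (forall a b, S b -> k <= normc (f a b)) -> holo S f ->
  holo S (fun a b => (f a b)^-1).
Proof.
move=> k0 fk [f1 [f2 [df df1 bf bf1]]].
have f0 a b : S b -> f a b != 0.
  by move=> Sb; rewrite -normc_eq0; apply: lt0r_neq0; exact: lt_le_trans (fk a b Sb).
have dV a b : S b -> cderiv (fun a b => (f a b)^-1) a b (- f1 a b * (f a b)^-1 * (f a b)^-1).
  by move=> Sb; apply: cderivV; [exact: df|exact: f0].
have bV : locally_bounded S (fun a b => (f a b)^-1).
  move=> A; exists k^-1 => a b _ Sb; rewrite normcV lef_pV2 ?posrE //; first exact: fk.
  exact: lt_le_trans (fk a b Sb).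
have dN a b : S b -> cderiv (fun a b => - f1 a b) a b (- f2 a b).
  move=> Sb; have := cderivM (cderiv_cst (-1) a b) (df1 a b Sb).
  by rewrite mul0r add0r mulN1r; congr cderiv; apply/funext => x; apply/funext => y; rewrite mulN1r.
exists (fun a b => - f1 a b * (f a b)^-1 * (f a b)^-1); eexists; split.
- exact: dV.
- by move=> a b Sb; exact: cderivM (cderivM (dN a b Sb) (dV a b Sb)) (dV a b Sb).
- exact: bV.
- by do 2! apply: locally_boundedM => //; exact: locally_boundedN.
Qed.

Lemma holo_cont S f a b : holo S f -> S b ->
  [/\ {for a, continuous (fun x => Re (f x b))}, {for a, continuous (fun x => Im (f x b))},
      {for b, continuous (fun y => Re (f a y))} & {for b, continuous (fun y => Im (f a y))}].
Proof. by move=> [f1 [f2 [df _ _ _]]] Sb; exact: cderiv_cont (df a b Sb). Qed.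

(** Cauchy's theorem for the rectangle, in imaginary part: Green's theorem applied to [Re f] and
    [Im f]. *)
Lemma cauchy_rectangle f a1 a2 b1 b2 : a1 <= a2 -> b1 <= b2 -> holo (fun b => b \in `[b1, b2]) f ->
  \int[mu]_(b in `[b1, b2]) Re (f a2 b) - \int[mu]_(b in `[b1, b2]) Re (f a1 b) =
  \int[mu]_(a in `[a1, a2]) (Im (f a b2) - Im (f a b1)).
Proof.
move=> a12 b12 hf; have [f1 [f2 [df df1 bf bf1]]] := hf.
have [K hK] := bf1 (`|a1| + `|a2| + 1).
apply: (@green_rectangle _ (fun a b => Re (f a b)) (fun a b => Im (f a b))
  (fun a b => Re (f1 a b)) _ _ _ _ K) => // a b ai bi.
- by case: (df a b bi).
- by case: (df a b bi).
- by case: (holo_cont a hf bi).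
- by case: (cderiv_cont (df1 a b bi)).
- by case: (holo_cont a hf bi).
- apply: le_trans (Re_le_normc _) (hK a b _ bi).
  move: ai; rewrite in_itv /= => /andP[h1 h2]; rewrite ler_norml.
  have := ler_norm a1; have := ler_norm (- a1); have := ler_norm a2; have := ler_norm (- a2).
  rewrite !normrN => *; apply/andP; split; lra.
Qed.

End ComplexFunctions.

(** * Contours made of an arc and a ray *)

Section Contour.
Variable R : realType.
Notation mu := (@lebesgue_measure R).
Notation Re := (@complex.Re R).
Notation Im := (@complex.Im R).
Variable theta : R.
Hypothesis theta0 : 0 <= theta.
Implicit Types (z w : R[i]) (a b c x y : R) (f g : R -> R -> R[i]).

Let S : R -> Prop := fun b => b \in `[0, theta].

(** In the coordinate [zeta = a + ib] with [tau = exp zeta], the upper half of a Hankel contour is a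
    vertical segment over [0, theta] at abscissa [c] (an arc of radius [exp c]) followed by a
    horizontal ray. The value is the imaginary part of the integral of [f d zeta] along it. If [f] is
    real on the real axis the lower half contributes minus the conjugate, so that the integral over
    the whole contour divided by [2 i pi] is [contour c f / pi]. *)
Definition contour c f : R :=
  \int[mu]_(b in `[0, theta]) Re (f c b) + \int[mu]_(x in `[0, +oo[) Im (f (c + x) theta).

Definition ray_decay f := forall c, exists C, forall a, c <= a -> normc (f a theta) <= C * expR (- a).

Definition admissible f := [/\ holo S f, forall a, Im (f a 0) = 0 & ray_decay f].

Let Stheta : S theta. Proof. by rewrite /S in_itv /= theta0 lexx. Qed.
Let S0 : S 0. Proof. by rewrite /S in_itv /= theta0 lexx. Qed.

Lemma is_derive_shift (g : R -> R) c x d : is_derive (c + x) 1 g d -> is_derive x 1 (fun x => g (c + x)) d.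
Proof.
move=> h; have h1 : is_derive x 1 (fun x => c + x) 1.
  by apply: (is_derive_eq (is_deriveD (is_derive_cst c x 1) (is_derive_id x 1))); rewrite add0r.
by apply: (is_derive_eq (is_derive1_comp h h1)); rewrite mulr1.
Qed.

Lemma is_derive_shiftr (g : R -> R) c x d : is_derive (x + c) 1 g d -> is_derive x 1 (fun x => g (x + c)) d.
Proof.
rewrite addrC => /is_derive_shift; congr (is_derive x 1 _ d).
by apply/funext => y; rewrite addrC.
Qed.

Lemma eq_limits (u v : nat -> R) (l l' : R) : (forall n, u n = v n) ->
  u n @[n --> \oo] --> l -> v n @[n --> \oo] --> l' -> l = l'.
Proof. by move=> /funext -> h h'; exact: (@cvg_unique _ (@Rhausdorff R) (v @ \oo)). Qed.

Lemma squeeze_exp (u : nat -> R) (l C p : R) : 0 < p -> (forall n, `|u n - l| <= C * expR (- (p * n%:R))) ->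
  u n @[n --> \oo] --> l.
Proof.
move=> p0 h.
have C0 : (fun n : nat => C * expR (- (p * n%:R : R))) @ \oo --> (0 : R).
  rewrite -(mulr0 C); apply: cvgMr.
  by apply: (cvg_comp (fun n => n%:R : R) (fun x => expR (- (p * x)))); [exact: cvgr_idn|exact: expRN_cvg0].
apply/subr_cvg0; apply: norm_cvg0.
apply: (@squeeze_cvgr _ _ _ _ (cst 0) _ _ _ _ _ C0); last exact: cvg_cst.
by apply: nearW => n; rewrite normr_ge0 h.
Qed.

Lemma squeeze_expR (u : nat -> R) (l C : R) : (forall n, `|u n - l| <= C * expR (- n%:R)) ->
  u n @[n --> \oo] --> l.
Proof. by move=> h; apply: (@squeeze_exp u l C 1) => // n; rewrite mul1r; exact: h. Qed.

Lemma contour_ray f c : holo S f -> ray_decay f ->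
  (forall x, {for x, continuous (fun x => Im (f (c + x) theta))}) /\
  exists C, forall x, 0 <= x -> `|Im (f (c + x) theta)| <= C * expR (- x).
Proof.
move=> hf df; split.
  move=> x; have [f1 [f2 [hd _ _ _]]] := hf.
  have [_ h _ _] := hd (c + x) theta Stheta.
  exact: is_derive_continuous (is_derive_shift h).
have [C h] := df c; exists (C * expR (- c)) => x x0.
rewrite (le_trans (Im_le_normc _)) // (le_trans (h _ _)) ?lerDl //.
by rewrite opprD expRD mulrA.
Qed.

Lemma contour_arc f c : holo S f -> forall b, b \in `[0, theta] -> {for b, continuous (fun b => Re (f c b))}.
Proof. by move=> hf b bi; case: (holo_cont c hf bi). Qed.

(** Moving the contour: the rectangle between two arcs contributes nothing, and translating the ray
    is itself an instance of Green's theorem. *)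
Lemma contour_shift_le c c' f : c <= c' -> admissible f -> contour c f = contour c' f.
Proof.
move=> cc [hf f0 df].
have arc := @cauchy_rectangle R f c c' 0 theta cc theta0 hf.
have [f1 [f2 [hd hd1 bf bf1]]] := hf.
have [Cd dC] := df c.
have V a : {for a, continuous (fun a => Im (f a theta))} by case: (holo_cont a hf Stheta).
have C0 : 0 <= Cd * expR (- c) by apply: le_trans (normc_ge0 _) (dC c (lexx _)).
have [ic [C hC]] := contour_ray c hf df.
have [ic' [C' hC']] := contour_ray c' hf df.
have trans (n : nat) :
    \int[mu]_(x in `[0, n%:R]) Im (f (c' + x) theta) - \int[mu]_(x in `[0, n%:R]) Im (f (c + x) theta) =
    \int[mu]_(a in `[c, c']) (Im (f (a + n%:R) theta) - Im (f (a + 0) theta)).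
  have [K hK] := bf1 (`|c| + `|c'| + 1 + n%:R).
  apply: (@green_rectangle _ (fun a x => Im (f (a + x) theta)) (fun a x => Im (f (a + x) theta))
    (fun a x => Im (f1 (a + x) theta)) _ _ _ _ K) => // a x ai xi.
  - by have [_ h _ _] := hd (a + x) theta Stheta; exact: is_derive_shiftr.
  - by have [_ h _ _] := hd (a + x) theta Stheta; exact: is_derive_shift.
  - have [_ h _ _] := hd (a + x) theta Stheta.
    exact: is_derive_continuous (is_derive_shift h).
  - have [_ h _ _] := hd1 (a + x) theta Stheta.
    exact: is_derive_continuous (is_derive_shift h).
  - have [_ h _ _] := hd (a + x) theta Stheta.
    exact: is_derive_continuous (is_derive_shiftr h).
  - apply: le_trans (Im_le_normc _) (hK _ _ _ Stheta).
    move: ai xi; rewrite !in_itv /= => /andP[h1 h2] /andP[h3 h4]; rewrite ler_norml.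
    have := ler_norm c; have := ler_norm (- c); have := ler_norm c'; have := ler_norm (- c').
    rewrite !normrN => *; apply/andP; split; lra.
have lim1 := ray_limit (ray_integrable ic hC).1.
have lim2 := ray_limit (ray_integrable ic' hC').1.
have lim3 : (\int[mu]_(x in `[0, n%:R]) Im (f (c' + x) theta) -
    \int[mu]_(x in `[0, n%:R]) Im (f (c + x) theta)) @[n --> \oo] -->
    \int[mu]_(x in `[0, +oo[) Im (f (c' + x) theta) - \int[mu]_(x in `[0, +oo[) Im (f (c + x) theta).
  exact: cvgB.
have lim4 : (\int[mu]_(a in `[c, c']) (Im (f (a + n%:R) theta) - Im (f (a + 0) theta))) @[n --> \oo] -->
    - \int[mu]_(a in `[c, c']) Im (f a theta).
  apply: (@squeeze_expR _ _ (Cd * expR (- c) * (c' - c))) => n.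
  have cn : forall a, a \in `[c, c'] -> {for a, continuous (fun a => Im (f (a + n%:R) theta))}.
    move=> a _; have [_ h _ _] := hd (a + n%:R) theta Stheta.
    exact: is_derive_continuous (is_derive_shiftr h).
  under eq_Rintegral do rewrite addr0.
  rewrite RintegralB //; [|exact: continuous_integrable|by apply: continuous_integrable => a _; exact: V].
  rewrite opprK subrK -mulrA [_ * expR (- n%:R)]mulrC mulrA.
  apply: Rintegral_norm_le => // a; rewrite in_itv /= => /andP[ca _].
  rewrite (le_trans (Im_le_normc _)) // (le_trans (dC _ _)) //.
    by rewrite (le_trans ca) // lerDl.
  have Cd0 : 0 <= Cd by rewrite -(pmulr_lge0 _ (expR_gt0 (- c))).
  by rewrite mulrAC -mulrA ler_wpM2l // -expRD ler_expR; lra.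
have E := eq_limits trans lim3 lim4.
have A0 : \int[mu]_(a in `[c, c']) (Im (f a theta) - Im (f a 0)) = \int[mu]_(a in `[c, c']) Im (f a theta).
  by apply: eq_Rintegral => a _; rewrite f0 subr0.
rewrite A0 in arc; rewrite /contour; lra.
Qed.

Lemma contour_shift c c' f : admissible f -> contour c f = contour c' f.
Proof.
move=> hf; have [cc|cc] := leP c c'; first exact: contour_shift_le.
by symmetry; apply: contour_shift_le => //; exact: ltW.
Qed.

Lemma contour_bound c f K1 K2 : holo S f -> ray_decay f ->
  (forall b, b \in `[0, theta] -> normc (f c b) <= K1) ->
  (forall x, 0 <= x -> normc (f (c + x) theta) <= K2 * expR (- x)) ->
  `|contour c f| <= K1 * theta + K2.
Proof.
move=> hf df h1 h2; rewrite (le_trans (ler_normD _ _)) // lerD //.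
- rewrite -[X in _ * X]subr0; apply: Rintegral_norm_le => //; first exact: contour_arc.
  by move=> b bi; rewrite (le_trans (Re_le_normc _)) // h1.
- have [ic _] := contour_ray c hf df.
  by apply: (ray_integrable ic _).2 => x x0; rewrite (le_trans (Im_le_normc _)) // h2.
Qed.

Lemma ray_decayD f g : ray_decay f -> ray_decay g -> ray_decay (fun a b => f a b + g a b).
Proof.
move=> hf hg c; have [C1 h1] := hf c; have [C2 h2] := hg c; exists (C1 + C2) => a ca.
by rewrite (le_trans (normcD _ _)) // mulrDl lerD ?h1 ?h2.
Qed.

Lemma ray_decayZ (r : R) f : ray_decay f -> ray_decay (fun a b => r%:C * f a b).
Proof.
move=> hf c; have [C h] := hf c; exists (`|r| * C) => a ca.
by rewrite normcM normcE2 /= expr0n /= addr0 sqrtr_sqr -mulrA ler_wpM2l // h.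
Qed.

Lemma contourD c f g : holo S f -> ray_decay f -> holo S g -> ray_decay g ->
  contour c (fun a b => f a b + g a b) = contour c f + contour c g.
Proof.
move=> hf df hg dg.
have [cf [Cf rf]] := contour_ray c hf df; have [cg [Cg rg]] := contour_ray c hg dg.
rewrite /contour; under eq_Rintegral do rewrite raddfD.
rewrite RintegralD //; [|exact: continuous_integrable (contour_arc hf)|exact: continuous_integrable (contour_arc hg)].
under [X in _ + X = _]eq_Rintegral do rewrite raddfD.
rewrite RintegralD //; [|exact: (ray_integrable cf rf).1|exact: (ray_integrable cg rg).1].
by rewrite addrACA.
Qed.

Lemma contourZ c (r : R) f : holo S f -> ray_decay f ->
  contour c (fun a b => r%:C * f a b) = r * contour c f.
Proof.
move=> hf df.
have [cf [Cf rf]] := contour_ray c hf df.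
have RE z : Re (r%:C * z) = r * Re z by rewrite ReM /= mul0r subr0.
have IE z : Im (r%:C * z) = r * Im z by rewrite ImM /= mul0r addr0.
rewrite /contour; under eq_Rintegral do rewrite RE.
rewrite RintegralZl //; last exact: continuous_integrable (contour_arc hf).
under [X in _ + X = _]eq_Rintegral do rewrite IE.
rewrite RintegralZl //; last exact: (ray_integrable cf rf).1.
by rewrite mulrDr.
Qed.

(** The boundary terms cancel at the corner, vanish at infinity by decay, and vanish on the real axis
    where [f] is real. *)
Lemma contour_derivative c f f1 : admissible f -> holo S f1 -> ray_decay f1 ->
  (forall a b, S b -> cderiv f a b (f1 a b)) -> contour c f1 = 0.
Proof.
move=> [hf f0 df] hf1 df1 hd.
have -> : contour c f1 = (Im (f c theta) - Im (f c 0)) + (0 - Im (f c theta)).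
  rewrite /contour; congr (_ + _).
    apply: (@Rintegral_FTC2 _ (fun b => Re (f1 c b)) (fun b => Im (f c b))) => //.
      by move=> b bi; case: (hd c b bi).
    exact: contour_arc.
  have [c1 [C1 r1]] := contour_ray c hf1 df1.
  have lim := ray_limit (ray_integrable c1 r1).1.
  have [_ [C r]] := contour_ray c hf df.
  apply: (eq_limits _ lim (v := fun n => Im (f (c + n%:R) theta) - Im (f (c + 0) theta))).
    move=> n; apply: (@Rintegral_FTC2 _ (fun x => Im (f1 (c + x) theta)) (fun x => Im (f (c + x) theta))) => //.
    by move=> x _; have [_ h _ _] := hd (c + x) theta Stheta; exact: is_derive_shift.
  rewrite addr0; apply: cvgB; last exact: cvg_cst.
  by apply: (@squeeze_expR _ _ C) => n; rewrite subr0; exact: r.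
by rewrite f0 subr0 sub0r subrr.
Qed.

End Contour.

(** * Hankel's integral *)

Section HankelKernel.
Variable R : realType.
Notation Re := (@complex.Re R).
Notation Im := (@complex.Im R).
Variable theta : R.
Hypothesis theta0 : 0 <= theta.
Hypothesis cos_theta : cos theta < 0.
Implicit Types (z a b c x y s : R).

Let S : R -> Prop := fun b => b \in `[0, theta].

Lemma strip_bound b : S b -> `|b| <= theta.
Proof. by rewrite /S in_itv /= => /andP[b0 bt]; rewrite ger0_norm. Qed.

Definition cscale (c a b : R) : R[i] := c%:C * (a +i* b).
(** With [tau = exp zeta], this is [exp (tau) tau^(- z) d tau / d zeta]. *)
Definition hankel z a b : R[i] := cexp (cexp (a +i* b) + cscale (1 - z) a b).

Lemma Re_cscale c a b : Re (cscale c a b) = c * a.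
Proof. by rewrite ReM /= mul0r subr0. Qed.
Lemma Im_cscale c a b : Im (cscale c a b) = c * b.
Proof. by rewrite ImM /= mul0r addr0. Qed.

Lemma holo_cscale c : holo S (cscale c).
Proof. by apply: holoM; [exact: holo_cst|apply: holo_id; exact: strip_bound]. Qed.

Lemma holo_hankel z : holo S (hankel z).
Proof.
apply: holo_cexp; apply: holoD; last exact: holo_cscale.
by apply: holo_cexp; apply: holo_id; exact: strip_bound.
Qed.

Lemma normc_hankel z a b : normc (hankel z a b) = expR (expR a * cos b + (1 - z) * a).
Proof. by rewrite normc_cexp ReD Re_cscale. Qed.

Lemma hankelD z c a b : hankel (z + c) a b = hankel z a b * cexp (cscale (- c) a b).
Proof.
rewrite /hankel -cexpD; congr cexp; rewrite -addrA; congr (_ + _).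
by rewrite /cscale -mulrDl; congr (_ * _); rewrite -raddfD /=; congr (_%:C); ring.
Qed.

(** From [exp a >= a^2 / 4] for [a >= 0], completing the square. *)
Lemma exp_beats_linear (k q c : R) : 0 < k ->
  forall a, c <= a -> - (k * expR a) + q * a <= (q + 1) ^+ 2 / k + `|q + 1| * `|c| - a.
Proof.
move=> k0 a ca.
suff : (q + 1) * a <= (q + 1) ^+ 2 / k + `|q + 1| * `|c| + k * expR a by lra.
have [a0|a0] := leP 0 a; last first.
  have h1 : (q + 1) * a <= `|q + 1| * `|c|.
    rewrite (le_trans (ler_norm _)) // normrM ler_wpM2l // ltr0_norm // ltr0_norm; lra.
  have h2 : 0 <= (q + 1) ^+ 2 / k by rewrite divr_ge0 ?sqr_ge0 // ltW.
  have h3 : 0 <= k * expR a by rewrite mulr_ge0 ?expR_ge0 // ltW.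
  lra.
have e : expR a >= a ^+ 2 / 4.
  have -> : a = a / 2 + a / 2 by lra.
  rewrite expRD -expr2 -(splitr a).
  have : 1 + a / 2 <= expR (a / 2) by exact: expR_ge1Dx.
  move=> h; apply: (@le_trans _ _ ((1 + a / 2) ^+ 2)); first nra.
  by rewrite lerXn2r // nnegrE; lra.
have h1 : (q + 1) * a <= (q + 1) ^+ 2 / k + k * (a ^+ 2 / 4).
  rewrite -subr_ge0.
  have -> : (q + 1) ^+ 2 / k + k * (a ^+ 2 / 4) - (q + 1) * a = ((q + 1) - k * a / 2) ^+ 2 / k.
    by field; rewrite gt_eqF.
  by rewrite divr_ge0 ?sqr_ge0 // ltW.
have h2 : k * (a ^+ 2 / 4) <= k * expR a by rewrite ler_pM2l.
have h3 : 0 <= `|q + 1| * `|c| by rewrite mulr_ge0.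
lra.
Qed.

(** Since [cos theta < 0], the factor [exp tau] makes the kernel decay doubly exponentially along the
    ray. *)
Lemma hankel_ray z c a : c <= a -> normc (hankel z a theta) <=
  expR ((2 - z) ^+ 2 / (- cos theta) + `|2 - z| * `|c|) * expR (- a).
Proof.
move=> ca; rewrite normc_hankel -expRD ler_expR.
have k0 : 0 < - cos theta by rewrite oppr_gt0.
have := exp_beats_linear (1 - z) k0 ca.
have -> : 1 - z + 1 = 2 - z by ring.
by have -> : - (- cos theta * expR a) = expR a * cos theta by ring.
Qed.

Lemma ray_decay_hankel z : ray_decay theta (hankel z).
Proof.
move=> c; exists (expR ((2 - z) ^+ 2 / (- cos theta) + `|2 - z| * `|c|)) => a ca.
exact: hankel_ray.
Qed.

Lemma Im_hankel0 z a : Im (hankel z a 0) = 0.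
Proof.
rewrite /hankel; set w := (_ + _).
have w0 : Im w = 0 by rewrite /w ImD Im_cscale /= sin0 !mulr0 addr0.
by rewrite -[LHS]/(expR (Re w) * sin (Im w)) w0 sin0 mulr0.
Qed.

Lemma admissible_hankel z : admissible theta (hankel z).
Proof. by split; [exact: holo_hankel|exact: Im_hankel0|exact: ray_decay_hankel]. Qed.

(** Equal to [1 / Gamma z] for [z > 0] (lemma [rgammaE]) and its continuation to all real [z]. The
    continuation is needed because differentiation lowers the second parameter of the
    Mittag-Leffler function, past 0 if repeated. *)
Definition rgamma z := contour theta 0 (hankel z) / pi.

(** The difference of the two kernels is the derivative of [exp (tau) tau^(- z)]. *)
Lemma rgamma_rec z : rgamma z = z * rgamma (z + 1).
Proof.
pose f1 a b := hankel z a b + (- z)%:C * hankel (z + 1) a b.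
have hf1 : holo S f1 by apply: holoD; [exact: holo_hankel|apply: holoM; [exact: holo_cst|exact: holo_hankel]].
have df1 : ray_decay theta f1 by apply: ray_decayD; [exact: ray_decay_hankel|apply: ray_decayZ; exact: ray_decay_hankel].
have hd a b : S b -> cderiv (hankel (z + 1)) a b (f1 a b).
  move=> Sb.
  have h1 := cderiv_cexp (cderiv_id a b).
  have h2 : cderiv (cscale (1 - (z + 1))) a b (0 * (a +i* b) + (1 - (z + 1))%:C * 1).
    exact: (cderivM (cderiv_cst _ a b) (cderiv_id a b)).
  have h3 := cderiv_cexp (cderivD h1 h2).
  move: h3; congr cderiv; rewrite /f1.
  have -> : hankel z a b = cexp (a +i* b) * hankel (z + 1) a b.
    rewrite /hankel -cexpD addrCA; congr (cexp (_ + _)).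
    rewrite /cscale -[X in _ = X + _]mul1r -mulrDl; congr (_ * _); apply: complex_eqP => /=; ring.
  rewrite -/(hankel (z + 1) a b) mul1r mul0r add0r mulr1 mulrDl; congr (_ + _ * _).
  by congr (_%:C); ring.
have := contour_derivative theta0 0 (admissible_hankel (z + 1)) hf1 df1 hd.
rewrite contourD //; [|exact: holo_hankel|exact: ray_decay_hankel
  |apply: holoM; [exact: holo_cst|exact: holo_hankel]|apply: ray_decayZ; exact: ray_decay_hankel].
rewrite contourZ //; [|exact: holo_hankel|exact: ray_decay_hankel] => h.
rewrite /rgamma mulrA; congr (_ / _); lra.
Qed.

End HankelKernel.

(** * The Mittag-Leffler function on the negative half-line *)

Section Resolvent.
Variable R : realType.
Notation Re := (@complex.Re R).
Notation Im := (@complex.Im R).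
Variables theta alpha : R.
Hypothesis theta0 : 0 <= theta.
Hypothesis cos_theta : cos theta < 0.
Hypothesis alpha0 : 0 < alpha.
Hypothesis alpha_theta : alpha * theta < pi.
Implicit Types (z a b c x y s : R).

Let S : R -> Prop := fun b => b \in `[0, theta].

(** With [tau = exp zeta], the kernel [resolvent s z] is
    [exp (tau) tau^(alpha - z) / (tau^alpha + s) d tau / d zeta]. *)
Definition denominator s a b : R[i] := 1 + s%:C * cexp (cscale (- alpha) a b).
Definition resolvent s z a b : R[i] := hankel z a b * (denominator s a b)^-1.

Let Stheta : S theta. Proof. by rewrite /S in_itv /= theta0 lexx. Qed.

Let gap := Num.sqrt ((1 + cos (alpha * theta)) / 2).

Let alpha_theta_itv : alpha * theta \in `[0, pi].
Proof. by rewrite in_itv /= mulr_ge0 ?(ltW alpha0) //= ltW. Qed.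

Lemma gap_gt0 : 0 < gap.
Proof.
rewrite sqrtr_gt0 divr_gt0 // -ltrBlDl sub0r -(@cospi R).
by rewrite ltr_cos ?alpha_theta // in_itv /= pi_ge0 lexx.
Qed.

(** On the contour the argument of [tau^alpha] lies between 0 and [alpha theta < pi], so that
    the distance from [tau^alpha] to [- s] is at least proportional to [|tau^alpha| + s]. *)
Lemma denominator_ge s a b : 0 <= s -> S b ->
  gap * (1 + s * expR (- alpha * a)) <= normc (denominator s a b).
Proof.
move=> s0 Sb; set y := s * expR (- alpha * a).
have y0 : 0 <= y by rewrite mulr_ge0 // expR_ge0.
have cb : cos (alpha * theta) <= cos (- alpha * b).
  have bt : alpha * b <= alpha * theta.
    by rewrite ler_pM2l //; move: Sb; rewrite /S in_itv /= => /andP[].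
  have bi : alpha * b \in `[0, pi].
    move: Sb; rewrite /S !in_itv /= => /andP[b0 _]; rewrite mulr_ge0 ?(ltW alpha0) //=.
    exact: le_trans bt (ltW alpha_theta).
  by rewrite mulNr cosN leNgt ltr_cos // -leNgt.
have e : normc (denominator s a b) ^+ 2 = 1 + 2 * y * cos (- alpha * b) + y ^+ 2.
  rewrite sqr_normcE /denominator ReD ImD ReM ImM.
  have -> : Re (cexp (cscale (- alpha) a b)) = expR (- alpha * a) * cos (- alpha * b).
    by rewrite -[LHS]/(expR (Re (cscale _ _ _)) * cos (Im (cscale _ _ _))) Re_cscale Im_cscale.
  have -> : Im (cexp (cscale (- alpha) a b)) = expR (- alpha * a) * sin (- alpha * b).
    by rewrite -[LHS]/(expR (Re (cscale _ _ _)) * sin (Im (cscale _ _ _))) Re_cscale Im_cscale.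
  rewrite /= /y; have := cos2Dsin2 (- alpha * b).
  set C := cos _; set T := sin _; set E := expR _ => h.
  have -> : 1 + 2 * (s * E) * C + (s * E) ^+ 2 = 1 + 2 * (s * E) * C + (s * E) ^+ 2 * (C ^+ 2 + T ^+ 2).
    by rewrite h mulr1.
  ring.
have p0 : 0 <= (1 + cos (alpha * theta)) / 2.
  by rewrite divr_ge0 // -lerBlDl sub0r cos_geN1.
have h0 : 0 <= gap * (1 + y) by rewrite mulr_ge0 ?sqrtr_ge0 // addr_ge0.
rewrite -(@ler_pXn2r _ 2) // ?nnegrE ?normc_ge0 // e exprMn sqr_sqrtr //.
have h1 : 2 * y * cos (alpha * theta) <= 2 * y * cos (- alpha * b).
  by rewrite ler_wpM2l // mulr_ge0.
have h2 : 0 <= (1 - cos (alpha * theta)) / 2 * (1 - y) ^+ 2.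
  by rewrite mulr_ge0 ?sqr_ge0 // divr_ge0 // subr_ge0 cos_le1.
move: h1 h2; set C := cos (alpha * theta); set D := cos _ => h1 h2; nra.
Qed.

Lemma gap_le_denominator s a b : 0 <= s -> S b -> gap <= normc (denominator s a b).
Proof.
move=> s0 Sb; apply: le_trans (denominator_ge a s0 Sb).
by rewrite ler_peMr ?(ltW gap_gt0) // lerDl mulr_ge0 // expR_ge0.
Qed.

Lemma holo_resolvent s z : 0 <= s -> holo S (resolvent s z).
Proof.
move=> s0; apply: holoM; first exact: holo_hankel.
apply: (holoV gap_gt0) => [a b Sb|]; first exact: gap_le_denominator.
apply: holoD; first exact: holo_cst.
apply: holoM; first exact: holo_cst.
by apply: holo_cexp; exact: holo_cscale.
Qed.

Lemma normc_resolvent_le s z a b : 0 <= s -> S b -> normc (resolvent s z a b) <= normc (hankel z a b) / gap.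
Proof.
move=> s0 Sb; rewrite normcM ler_wpM2l ?normc_ge0 // normcV lef_pV2 ?posrE ?gap_gt0 //.
  exact: gap_le_denominator.
exact: lt_le_trans gap_gt0 (gap_le_denominator a s0 Sb).
Qed.

Lemma ray_decay_resolvent s z : 0 <= s -> ray_decay theta (resolvent s z).
Proof.
move=> s0 c; have [C h] := ray_decay_hankel cos_theta z c; exists (C / gap) => a ca.
rewrite (le_trans (normc_resolvent_le z a s0 Stheta)) // mulrAC ler_pM2r ?invr_gt0 ?gap_gt0 //.
exact: h.
Qed.

Lemma admissible_resolvent s z : 0 <= s -> admissible theta (resolvent s z).
Proof.
move=> s0; split; [exact: holo_resolvent| |exact: ray_decay_resolvent] => a.
have d0 : Im (denominator s a 0) = 0.
  rewrite ImD ImM -[Im (cexp _)]/(expR (Re (cscale _ _ _)) * sin (Im (cscale _ _ _))) Im_cscale.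
  by rewrite mulr0 sin0 !mulr0 /= mul0r !addr0.
by rewrite ImM ImV d0 Im_hankel0 mul0r oppr0 mul0r mulr0 addr0.
Qed.

Lemma resolvent_expand s z a b : 0 <= s -> S b ->
  resolvent s z a b = hankel z a b + (- s)%:C * resolvent s (z + alpha) a b.
Proof.
move=> s0 Sb; rewrite /resolvent hankelD.
have d0 : denominator s a b != 0.
  by rewrite -normc_eq0; apply: lt0r_neq0; exact: lt_le_trans gap_gt0 (gap_le_denominator a s0 Sb).
apply: (mulIf d0); rewrite mulrVK ?unitfE // mulrDl -!mulrA mulVf // mulr1 /denominator.
by rewrite raddfN /=; ring.
Qed.

(** The value at [- s] of the Mittag-Leffler function with parameters [alpha] and [z], as a contour
    integral over the fixed arc of radius 1; [cvg_ml] relates it to the power series. *)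
Definition ml s z := contour theta 0 (resolvent s z) / pi.

(** The geometric expansion of the resolvent with its exact remainder, integrated. *)
Lemma ml_partial_sum c s z n : 0 <= s ->
  contour theta c (resolvent s z) = \sum_(j < n) (- s) ^+ j * contour theta c (hankel (alpha * j%:R + z))
    + (- s) ^+ n * contour theta c (resolvent s (alpha * n%:R + z)).
Proof.
move=> s0; elim: n => [|n ->]; first by rewrite big_ord0 add0r expr0 mul1r mulr0 add0r.
rewrite big_ord_recr /= -addrA; congr (_ + _).
have -> : contour theta c (resolvent s (alpha * n%:R + z)) =
    contour theta c (fun a b => hankel (alpha * n%:R + z) a b + (- s)%:C * resolvent s (alpha * n.+1%:R + z) a b).
  have e : alpha * n.+1%:R + z = alpha * n%:R + z + alpha by rewrite -natr1; ring.
  rewrite e /contour; congr (_ + _); apply: eq_Rintegral => b bi.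
    by rewrite resolvent_expand //; exact/set_mem.
  by rewrite resolvent_expand.
rewrite contourD //; [|exact: holo_hankel|exact: ray_decay_hankel
  |apply: holoM; [exact: holo_cst|exact: holo_resolvent]|apply: ray_decayZ; exact: ray_decay_resolvent].
rewrite contourZ //; [|exact: holo_resolvent|exact: ray_decay_resolvent].
by rewrite exprSr; ring.
Qed.

(** Far enough to the right the contour lies where [|tau^alpha| > s], so that the remainder of the
    geometric expansion tends to 0. *)
Lemma cvg_ml s z : 0 <= s ->
  series (fun j => (- s) ^+ j * rgamma theta (alpha * j%:R + z)) @ \oo --> ml s z.
Proof.
move=> s0.
(* This choice gives [alpha c = s + 1], hence [s exp (- alpha c) <= exp (- 1)]. *)
pose c := s / alpha + alpha^-1.
have c0 : 0 <= c by rewrite addr_ge0 ?divr_ge0 ?invr_ge0 // ltW.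
have sc : s * expR (- (alpha * c)) <= expR (- 1).
  have -> : alpha * c = s + 1 by rewrite /c; field; rewrite gt_eqF.
  rewrite opprD expRD mulrA ler_piMl ?expR_ge0 // expRN ler_pdivrMr ?expR_gt0 // mul1r.
  by apply: le_trans (expR_ge1Dx s); rewrite lerDr.
pose K1 := expR (expR c + `|1 - z| * c) / gap.
have [C hC] := ray_decay_hankel cos_theta z c.
have C0 : 0 <= C.
  by rewrite -(pmulr_lge0 _ (expR_gt0 (- c))); apply: le_trans (normc_ge0 _) (hC c (lexx _)).
pose K := K1 * theta + C / gap.
have hn n a b : c <= a -> normc (hankel (alpha * n%:R + z) a b) <= normc (hankel z a b) * expR (- (alpha * c)) ^+ n.
  move=> ca; rewrite addrC hankelD normcM normc_cexp Re_cscale ler_wpM2l ?normc_ge0 //.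
  rewrite -expRM_natl ler_expR mulrN mulNr lerN2 mulrA [_%:R * _]mulrC ler_wpM2l //.
  by rewrite mulr_ge0 // ltW.
have bound n : `|contour theta c (resolvent s (alpha * n%:R + z))| <= K * expR (- (alpha * c)) ^+ n.
  have -> : K * expR (- (alpha * c)) ^+ n = (K1 * expR (- (alpha * c)) ^+ n) * theta + C / gap * expR (- (alpha * c)) ^+ n.
    by rewrite /K; ring.
  apply: contour_bound => //; [exact: holo_resolvent|exact: ray_decay_resolvent| |].
  - move=> b bi; rewrite (le_trans (normc_resolvent_le _ _ s0 bi)) // /K1.
    rewrite [leRHS]mulrAC ler_pM2r ?invr_gt0 ?gap_gt0 // (le_trans (hn n c b (lexx _))) //.
    rewrite ler_wpM2r ?exprn_ge0 ?expR_ge0 // normc_hankel ler_expR lerD //.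
      by rewrite -[leRHS]mulr1 ler_wpM2l ?expR_ge0 ?cos_le1.
    by rewrite ler_wpM2r // ler_norm.
  - move=> x x0; rewrite (le_trans (normc_resolvent_le _ _ s0 Stheta)) //.
    rewrite -!mulrA [gap^-1 * _]mulrC !mulrA ler_pM2r ?invr_gt0 ?gap_gt0 //.
    have cx : c <= c + x by rewrite lerDl.
    rewrite (le_trans (hn n _ _ cx)) // mulrAC ler_wpM2r ?exprn_ge0 ?expR_ge0 //.
    rewrite (le_trans (hC _ cx)) // ler_wpM2l // ler_expR; lra.
apply: (@squeeze_expR _ _ _ (K / pi)) => n.
rewrite /ml (contour_shift theta0 0 c (admissible_resolvent z s0)) (ml_partial_sum c z n s0).
have -> : \sum_(0 <= k < n) (- s) ^+ k * rgamma theta (alpha * k%:R + z) =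
    (\sum_(j < n) (- s) ^+ j * contour theta c (hankel (alpha * j%:R + z))) / pi.
  rewrite big_mkord mulr_suml; apply: eq_bigr => j _.
  by rewrite /rgamma (contour_shift theta0 0 c (admissible_hankel cos_theta _)) mulrA.
rewrite -mulrBl opprD addNKr mulNr normrN normrM normfV (ger0_norm (pi_ge0 R)) mulrAC.
rewrite ler_pM2r ?invr_gt0 ?pi_gt0 // normrM normrX normrN (ger0_norm s0).
rewrite (@le_trans _ _ (s ^+ n * (K * expR (- (alpha * c)) ^+ n))) // ?ler_wpM2l ?exprn_ge0 //.
rewrite mulrCA -exprMn ler_wpM2l //.
  by rewrite /K addr_ge0 // ?divr_ge0 ?(ltW gap_gt0) // mulr_ge0 // divr_ge0 ?expR_ge0 // ltW // gap_gt0.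
have -> : - n%:R = n%:R * (-1) :> R by rewrite mulrN1.
by rewrite expRM_natl lerXn2r ?nnegrE ?mulr_ge0 ?expR_ge0.
Qed.

(** As [s] grows the contour stays where it is, at [|tau| >= 1], and there the resolvent is at most a
    constant times [|tau^alpha| / (1 + s)] times the Hankel kernel. *)
Lemma ml_bound z : exists C, forall s, 0 <= s -> `|ml s z| <= C / (1 + s).
Proof.
have [C hC] := ray_decay_hankel cos_theta (z - alpha) 0.
have hr s a b : 0 <= s -> 0 <= a -> S b ->
    normc (resolvent s z a b) <= normc (hankel (z - alpha) a b) / gap / (1 + s).
  move=> s0 a0 Sb.
  have d0 : 0 < 1 + s * expR (- alpha * a) by rewrite ltr_pwDl // mulr_ge0 // expR_ge0.
  have s1 : 0 < 1 + s by rewrite ltr_pwDl.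
  have -> : normc (hankel (z - alpha) a b) = normc (hankel z a b) * expR (alpha * a).
    by rewrite hankelD normcM normc_cexp Re_cscale opprK.
  rewrite normcM normcV -!mulrA ler_wpM2l ?normc_ge0 //.
  have h := denominator_ge a s0 Sb.
  have hp := mulr_gt0 gap_gt0 d0.
  rewrite -[leLHS]mul1r ler_pdivrMr; last exact: lt_le_trans h.
  apply: (@le_trans _ _ (expR (alpha * a) * (gap^-1 / (1 + s)) * (gap * (1 + s * expR (- alpha * a))))); last first.
    by rewrite ler_wpM2l // mulr_ge0 ?expR_ge0 // divr_ge0 ?invr_ge0 ?(ltW gap_gt0) // ltW.
  have -> : expR (alpha * a) * (gap^-1 / (1 + s)) * (gap * (1 + s * expR (- alpha * a))) =
    (expR (alpha * a) + s * (expR (- alpha * a) * expR (alpha * a))) / (1 + s).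
    by field; rewrite !gt_eqF ?gap_gt0.
  rewrite -expRD mulNr addNr expR0 mulr1 ler_pdivlMr // mul1r lerD2r.
  by rewrite -expR0 ler_expR mulr_ge0 // ltW.
pose K1 : R := expR 1.
exists ((K1 / gap * theta + C / gap) / pi) => s s0.
rewrite /ml normrM normfV (ger0_norm (pi_ge0 R)) mulrAC ler_pM2r ?invr_gt0 ?pi_gt0 //.
have -> : (K1 / gap * theta + C / gap) / (1 + s) = (K1 / gap / (1 + s)) * theta + C / gap / (1 + s) by ring.
have s1 : 0 < (1 + s)^-1 by rewrite invr_gt0 ltr_pwDl.
apply: contour_bound => //; [exact: holo_resolvent|exact: ray_decay_resolvent| |].
- move=> b bi; rewrite (le_trans (hr _ _ _ s0 (lexx _) bi)) // ler_pM2r // ler_pM2r ?invr_gt0 ?gap_gt0 //.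
  by rewrite normc_hankel mulr0 addr0 expR0 mul1r ler_expR cos_le1.
- move=> x x0; rewrite add0r (le_trans (hr _ _ _ s0 x0 Stheta)) //.
  have -> : C / gap / (1 + s) * expR (- x) = C * expR (- x) / gap / (1 + s) by ring.
  by rewrite ler_pM2r // ler_pM2r ?invr_gt0 ?gap_gt0 // hC.
Qed.

End Resolvent.

(** * The residue at [tau = 1] *)

Section Pole.
Variable R : realType.
Notation mu := (@lebesgue_measure R).
Notation Re := (@complex.Re R).
Notation Im := (@complex.Im R).
Implicit Types (a b c x y p q : R).

Lemma mvt_le (f df : R -> R) (K : R) x y : x <= y -> (forall t : R, is_derive t 1 f (df t)) ->
  (forall t : R, x <= t <= y -> `|df t| <= K) -> `|f y - f x| <= K * (y - x).
Proof.
move=> xy dF dK.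
have cf : {within `[x, y], continuous f}.
  by apply: continuous_subspaceT => t; exact: is_derive_continuous (dF t).
have [t tI ->] := MVT_segment xy (fun t _ => dF t) cf.
have yx : 0 <= y - x by rewrite subr_ge0.
by rewrite normrM (ger0_norm yx) ler_wpM2r // dK //; move: tI; rewrite in_itv.
Qed.

Lemma norm_sin_le q : `|sin q| <= `|q|.
Proof.
have h (t : R) : is_derive t 1 (@sin R) (cos t) by exact: is_derive_sin.
have [q0|q0] := leP 0 q.
  have := mvt_le q0 h (fun t _ => cos_max t); rewrite sin0 !subr0 mul1r => h1.
  by rewrite (ger0_norm q0).
have := mvt_le (ltW q0) h (fun t _ => cos_max t); rewrite sin0 !sub0r mul1r normrN => h1.
by rewrite (ltr0_norm q0).
Qed.

Lemma norm_cosB1_le q : `|cos q - 1| <= `|q|.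
Proof.
have h (t : R) : is_derive t 1 (@cos R) (- sin t) by exact: is_derive_cos.
have m (t : R) : `|- sin t| <= 1 by rewrite normrN sin_max.
have [q0|q0] := leP 0 q.
  have := mvt_le q0 h (fun t _ => m t); rewrite cos0 subr0 mul1r => h1.
  by rewrite (ger0_norm q0).
have := mvt_le (ltW q0) h (fun t _ => m t); rewrite cos0 sub0r mul1r distrC => h1.
by rewrite (ltr0_norm q0).
Qed.

Lemma norm_expRB1_le p : `|expR p - 1| <= expR `|p| * `|p|.
Proof.
have h (t : R) : is_derive t 1 (@expR R) (expR t) by exact: is_derive_expR.
have [q0|q0] := leP 0 p.
  have := @mvt_le expR expR (expR p) _ _ q0 h; rewrite expR0 subr0 (ger0_norm q0); apply.
  by move=> t /andP[_ tp]; rewrite ger0_norm ?expR_ge0 // ler_expR.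
rewrite (ltr0_norm q0) distrC.
have := @mvt_le expR expR 1 _ _ (ltW q0) h; rewrite expR0 sub0r mul1r => h1.
rewrite (le_trans (h1 _)) //.
  by move=> t /andP[_ tp]; rewrite ger0_norm ?expR_ge0 // -expR0 ler_expR.
by rewrite ler_peMl ?oppr_ge0 ?(ltW q0) // -expR0 ler_expR oppr_ge0 ltW.
Qed.

Lemma sin_ge_linear q : 0 <= q <= 1 -> cos 1 * q <= sin q.
Proof.
move=> /andP[q0 q1].
have h (t : R) : is_derive t 1 (@sin R) (cos t) by exact: is_derive_sin.
have cf : {within `[0, q], continuous (@sin R)}.
  by apply: continuous_subspaceT => t; exact: is_derive_continuous (h t).
have [t tI] := MVT_segment q0 (fun t _ => h t) cf.
rewrite sin0 !subr0 => ->; rewrite ler_wpM2r //.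
move: tI; rewrite in_itv /= => /andP[t0 tq].
have p1 : 1 <= pi :> R by have := pi_ge2 R; lra.
by rewrite leNgt ltr_cos ?in_itv /= ?ler01 ?p1 ?t0 //= -?leNgt; lra.
Qed.

Lemma normc_cexpB1_le c a b : normc (cexp (cscale c a b) - 1) <=
  2 * `|c| * expR (`|c| * `|a|) * (`|a| + `|b|).
Proof.
have e : cexp (cscale c a b) = (expR (c * a) * cos (c * b)) +i* (expR (c * a) * sin (c * b)).
  by rewrite -[LHS]/((expR (Re (cscale c a b)) * cos (Im (cscale c a b))) +i*
       (expR (Re (cscale c a b)) * sin (Im (cscale c a b)))) Re_cscale Im_cscale.
have tri (u v : R) : normc (u +i* v) <= `|u| + `|v|.
  have h : normc (u +i* v) ^+ 2 <= (`|u| + `|v|) ^+ 2.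
    rewrite sqr_normcE /= -(real_normK (num_real u)) -(real_normK (num_real v)).
    have := normr_ge0 u; have := normr_ge0 v; nra.
  by move: h; rewrite ler_pXn2r // nnegrE ?normc_ge0 // addr_ge0.
rewrite e -[X in normc X]/((expR (c * a) * cos (c * b) - 1) +i* (expR (c * a) * sin (c * b) - 0)) subr0.
apply: le_trans (tri _ _) _.
have -> : expR (c * a) * cos (c * b) - 1 = expR (c * a) * (cos (c * b) - 1) + (expR (c * a) - 1) by ring.
have eM : expR (c * a) <= expR (`|c| * `|a|) by rewrite ler_expR -normrM ler_norm.
have h1 : `|expR (c * a) * (cos (c * b) - 1)| <= expR (`|c| * `|a|) * (`|c| * `|b|).
  rewrite normrM (ger0_norm (expR_ge0 _)); apply: ler_pM; rewrite ?expR_ge0 ?normr_ge0 //.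
  rewrite -normrM; exact: norm_cosB1_le.
have h2 : `|expR (c * a) * sin (c * b)| <= expR (`|c| * `|a|) * (`|c| * `|b|).
  rewrite normrM (ger0_norm (expR_ge0 _)); apply: ler_pM; rewrite ?expR_ge0 ?normr_ge0 //.
  rewrite -normrM; exact: norm_sin_le.
have h3 := norm_expRB1_le (c * a); rewrite normrM in h3.
have h4 := ler_normD (expR (c * a) * (cos (c * b) - 1)) (expR (c * a) - 1).
have h5 : 0 <= expR (`|c| * `|a|) * (`|c| * `|a|) by rewrite mulr_ge0 ?expR_ge0 // mulr_ge0.
have -> : 2 * `|c| * expR (`|c| * `|a|) * (`|a| + `|b|) =
  2 * (expR (`|c| * `|a|) * (`|c| * `|a|)) + 2 * (expR (`|c| * `|a|) * (`|c| * `|b|)) by ring.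
lra.
Qed.

Definition pole_denom a b : R[i] := 1 - cexp (a +i* b).

Lemma sqr_normc_pole_denom a b : normc (pole_denom a b) ^+ 2 = 1 - 2 * expR a * cos b + expR a ^+ 2.
Proof.
rewrite sqr_normcE /pole_denom ReD ImD /=.
have := cos2Dsin2 b; set C := cos b; set T := sin b; set E := expR a => h.
have -> : 1 - 2 * E * C + E ^+ 2 = 1 - 2 * E * C + E ^+ 2 * (C ^+ 2 + T ^+ 2) by rewrite h mulr1.
ring.
Qed.

Lemma expRB1_le_pole_denom a b : `|1 - expR a| <= normc (pole_denom a b).
Proof.
rewrite -(@ler_pXn2r _ 2) ?nnegrE ?normc_ge0 // sqr_normc_pole_denom real_normK ?num_real //.
have := cos_le1 b; have := expR_ge0 a; set C := cos b; set E := expR a; nra.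
Qed.

(** A point of argument at least [d] is at distance at least [sin d] from 1. *)
Lemma sin_le_pole_denom a b d : 0 <= sin d -> cos b <= cos d -> sin d <= normc (pole_denom a b).
Proof.
move=> d0 bd; rewrite -(@ler_pXn2r _ 2) ?nnegrE ?normc_ge0 // sqr_normc_pole_denom.
have := cos2Dsin2 d; have := expR_ge0 a.
move: d0 bd; set C := cos b; set E := expR a; set D := cos d; set T := sin d => d0 bd E0 h.
have -> : T ^+ 2 = 1 - D ^+ 2 by rewrite -h; ring.
have h1 := sqr_ge0 (E - D); have h2 : E * C <= E * D by rewrite ler_wpM2l.
nra.
Qed.

Lemma pole_denom_neq0 a b : a != 0 -> pole_denom a b != 0.
Proof.
move=> a0; rewrite -normc_eq0; apply: lt0r_neq0; apply: lt_le_trans (expRB1_le_pole_denom a b).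
rewrite normr_gt0 subr_eq0 eq_sym; apply: contra a0 => /eqP h.
by rewrite -(@expR_inj R a 0) // h expR0.
Qed.

(** With [tau = exp zeta], this is [tau^(- z) / (1 - tau) d tau / d zeta]. *)
Definition pole z a b : R[i] := cexp (cscale (1 - z) a b) * (pole_denom a b)^-1.

End Pole.

Section PoleContour.
Variable R : realType.
Notation mu := (@lebesgue_measure R).
Notation Re := (@complex.Re R).
Notation Im := (@complex.Im R).
Implicit Types (a b c x y p q : R).
Variable theta : R.
Hypothesis theta0 : 0 < theta.
Hypothesis theta_pi : theta < pi.
Hypothesis cos_theta : cos theta < 0.

Lemma seq_cvgB (u v : nat -> R) (l l' : R) : u n @[n --> \oo] --> l -> v n @[n --> \oo] --> l' ->
  (u n - v n) @[n --> \oo] --> l - l'.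
Proof. by move=> h h'; exact: cvgB. Qed.

Lemma seq_cvg_cst (l : R) : (fun _ : nat => l) n @[n --> \oo] --> l.
Proof. exact: cvg_cst. Qed.

Lemma ImN (w : R[i]) : Im (- w) = - Im w. Proof. by case: w. Qed.

Lemma cderiv_shift (f : R -> R -> R[i]) c a b d : cderiv f (c + a) b d -> cderiv (fun a b => f (c + a) b) a b d.
Proof. by move=> [h1 h2 h3 h4]; split => //; exact: is_derive_shift. Qed.

Lemma holo_shift S f c : holo S f -> holo S (fun a b => f (c + a) b : R[i]).
Proof.
move=> [f1 [f2 [df df1 bf bf1]]]; exists (fun a b => f1 (c + a) b), (fun a b => f2 (c + a) b); split.
- by move=> a b Sb; apply: cderiv_shift; exact: df.
- by move=> a b Sb; apply: cderiv_shift; exact: df1.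
- move=> A; have [K h] := bf (`|c| + A); exists K => a b aA Sb; apply: h => //.
  by rewrite (le_trans (ler_normD _ _)) // lerD2l.
- move=> A; have [K h] := bf1 (`|c| + A); exists K => a b aA Sb; apply: h => //.
  by rewrite (le_trans (ler_normD _ _)) // lerD2l.
Qed.

Lemma cderiv_pole_denom a b : exists d, cderiv (@pole_denom R) a b d.
Proof.
have h2 := cderivM (cderiv_cst (-1) a b) (cderiv_cexp (cderiv_id a b)).
have h3 := cderivD (cderiv_cst 1 a b) h2.
have e : (fun a b => 1 + -1 * cexp (a +i* b)) = @pole_denom R.
  by apply/funext => x; apply/funext => y; rewrite mulN1r.
by rewrite e in h3; eexists; exact: h3.
Qed.

Lemma cderiv_pole z a b : pole_denom a b != 0 -> exists d, cderiv (pole z) a b d.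
Proof.
move=> P0; have [d h3] := cderiv_pole_denom a b.
have h1 : cderiv (cscale (1 - z)) a b (0 * (a +i* b) + (1 - z)%:C * 1).
  exact: (cderivM (cderiv_cst _ a b) (cderiv_id a b)).
by eexists; exact: (cderivM (cderiv_cexp h1) (cderivV h3 P0)).
Qed.

Lemma sin_theta_gt0 e : 0 < e <= theta -> 0 < sin e.
Proof. by move=> /andP[e0 et]; rewrite sin_gt0_pi // e0 (le_lt_trans et). Qed.

Lemma pole_denom_ge e a b : 0 < e <= theta -> b \in `[e, theta] -> sin e <= normc (pole_denom a b).
Proof.
move=> et bi; have /andP[e0 e1] := et; apply: sin_le_pole_denom; first exact: ltW (sin_theta_gt0 et).
move: bi; rewrite in_itv /= => /andP[eb bt].
rewrite leNgt ltr_cos -?leNgt // in_itv /= ?(le_trans (ltW e0)) //= ?(le_trans _ (ltW theta_pi)) //.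
Qed.

Lemma holo_pole z e : 0 < e <= theta -> holo (fun b => b \in `[e, theta]) (pole z).
Proof.
move=> et.
have sb b : b \in `[e, theta] -> `|b| <= theta.
  move: et => /andP[e0 _]; rewrite in_itv /= => /andP[eb bt].
  by rewrite ger0_norm // (le_trans (ltW e0)).
have hid : holo (fun b => b \in `[e, theta]) (fun a b => a +i* b) by apply: holo_id; exact: sb.
apply: holoM; first by apply: holo_cexp; apply: holoM => //; exact: holo_cst.
apply: (holoV (sin_theta_gt0 et)) => [a b|]; first exact: pole_denom_ge.
have -> : @pole_denom R = (fun a b => 1 + -1 * cexp (a +i* b)).
  by apply/funext => x; apply/funext => y; rewrite mulN1r.
apply: holoD; first exact: holo_cst.
by apply: holoM; [exact: holo_cst|exact: holo_cexp].
Qed.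

Lemma normc_pole z a b : normc (pole z a b) = expR ((1 - z) * a) / normc (pole_denom a b).
Proof. by rewrite normcM normc_cexp Re_cscale normcV. Qed.

Lemma normc_pole_le z a b : a != 0 -> normc (pole z a b) <= expR ((1 - z) * a) / `|1 - expR a|.
Proof.
move=> a0; rewrite normc_pole ler_wpM2l ?expR_ge0 //.
have h : 0 < `|1 - expR a|.
  by rewrite normr_gt0 subr_eq0 eq_sym -expR0 (inj_eq (@expR_inj R)).
rewrite lef_pV2 ?posrE //; first exact: expRB1_le_pole_denom.
exact: lt_le_trans h (expRB1_le_pole_denom a b).
Qed.

Lemma pole_ray z a : normc (pole z a theta) <= expR (- (z * a)).
Proof.
rewrite normc_pole.
have -> : expR (- (z * a)) = expR ((1 - z) * a) / expR a by rewrite -expRB; congr expR; ring.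
rewrite ler_wpM2l ?expR_ge0 //.
have h : expR a <= normc (pole_denom a theta).
  rewrite -(@ler_pXn2r _ 2) ?nnegrE ?normc_ge0 ?expR_ge0 // sqr_normc_pole_denom.
  have := mulr_ge0_le0 (expR_ge0 a) (ltW cos_theta); lra.
by rewrite lef_pV2 ?posrE ?expR_gt0 // (lt_le_trans (expR_gt0 _) h).
Qed.

Lemma trimmed_integral (g : R -> R) t : 0 < t -> t <= theta ->
  (forall b, b \in `[0, theta] -> {for b, continuous g}) ->
  (exists K, forall b, b \in `[0, theta] -> `|g b| <= K) ->
  (\int[mu]_(b in `[(t * expR (- n%:R)), theta]) g b) @[n --> \oo] --> \int[mu]_(b in `[0, theta]) g b.
Proof.
move=> t0 tt cg [K gK].
apply: (@squeeze_expR _ _ _ (K * t)) => n.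
set e := t * expR _.
have e0 : 0 < e by rewrite mulr_gt0 // expR_gt0.
have et : e <= theta.
  by apply: le_trans tt; rewrite /e ler_piMr ?(ltW t0) // -expR0 ler_expR oppr_le0.
have ig := continuous_integrable cg.
have E : \int[mu]_(b in `[0, theta]) g b - \int[mu]_(b in `[0, e]) g b = \int[mu]_(b in `]e, theta]) g b.
  by apply: Rintegral_itvB => //; rewrite bnd_simp // ltW.
have sub b : b \in `[0, e] -> b \in `[0, theta].
  by rewrite !in_itv /= => /andP[-> be]; exact: le_trans be et.
rewrite -Rintegral_itv_obnd_cbnd; last first.
  apply: integrableS ig => // b; rewrite /= !in_itv /= => /andP[eb ->]; rewrite andbT.
  exact: ltW (lt_trans e0 eb).
rewrite -E addrAC subrr sub0r normrN -mulrA -/e -[X in _ * X]subr0.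
apply: Rintegral_norm_le => [|b /sub|b /sub]; [exact: ltW|exact: cg|exact: gK].
Qed.

Lemma pole1 a b : pole 1 a b = (pole_denom a b)^-1.
Proof.
rewrite /pole subrr; have -> : cscale 0 a b = 0 by rewrite /cscale mul0r.
by have -> : cexp 0 = 1 :> R[i]; [rewrite /cexp /= expR0 cos0 sin0 !mul1r|rewrite mul1r].
Qed.

Lemma Im_pole1 a b : Im (pole 1 a b) = expR a * sin b / (1 - 2 * expR a * cos b + expR a ^+ 2).
Proof.
rewrite pole1 ImV -sqr_normcE sqr_normc_pole_denom; congr (_ / _).
by rewrite /pole_denom ImD /= sub0r opprK.
Qed.

(** For [z = 1] the antiderivative is, up to sign and an additive constant, the argument of
    [tau - 1], written as an arctangent. *)
Lemma pole1_integral N e : 0 <= N -> 0 < e <= theta ->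
  \int[mu]_(x in `[0, N]) Im (pole 1 (-1 + x) e) =
  atan ((expR (-1 + N) - cos e) / sin e) - atan ((expR (-1 + 0) - cos e) / sin e).
Proof.
move=> N0 et; have s0 := sin_theta_gt0 et.
have ei : e \in `[e, theta] by move: et => /andP[_ h]; rewrite in_itv /= lexx.
apply: (@Rintegral_FTC2 _ _ (fun x => atan ((expR (-1 + x) - cos e) / sin e))) => // x _; last first.
  by case: (holo_cont x (holo_shift (-1) (holo_pole 1 et)) ei).
have h1 : is_derive x 1 (fun x : R => (expR (-1 + x) - cos e) / sin e) (expR (-1 + x) / sin e).
  have h0 := is_derive_shift (is_derive_expR (-1 + x)).
  apply: (is_derive_eq (is_deriveM (is_deriveB h0 (is_derive_cst (cos e) x 1)) (is_derive_cst (sin e)^-1 x 1))).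
  by rewrite /GRing.scale /= mulr0 add0r subr0 mulrC.
apply: (is_derive_eq (is_derive1_comp (g := fun x : R => (expR (-1 + x) - cos e) / sin e) (is_derive1_atan _) h1)).
rewrite Im_pole1.
have := cos2Dsin2 e; set C := cos e; set E := expR _ => h.
have -> : 1 - 2 * E * C + E ^+ 2 = (E - C) ^+ 2 + sin e ^+ 2.
  by rewrite -[X in X - _ + _]h; ring.
have p0 : 0 < (E - C) ^+ 2 + sin e ^+ 2 by rewrite ltr_wpDl ?sqr_ge0 // exprn_gt0.
by field; rewrite !gt_eqF //= addrC.
Qed.

Lemma cvg_atan_y (u : nat -> R) : u n @[n --> \oo] --> +oo -> atan (u n) @[n --> \oo] --> (pi / 2 : R).
Proof. by move=> h; exact: (cvg_comp u (@atan R) h (@cvgy_atan R)). Qed.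

Section ShrinkingAngle.
Variable t : R.
Hypothesis t0 : 0 < t.
Hypothesis t1 : t <= 1.
Hypothesis t_theta : t <= theta.
Let e (n : nat) : R := t * expR (- n%:R).

Let e_itv n : 0 < e n <= theta.
Proof.
rewrite mulr_gt0 ?expR_gt0 //=.
by apply: le_trans t_theta; rewrite ler_piMr ?(ltW t0) // -expR0 ler_expR oppr_le0.
Qed.

Let e_le n : 0 <= e n <= 1.
Proof.
rewrite mulr_ge0 ?expR_ge0 ?(ltW t0) //=.
by apply: le_trans t1; rewrite ler_piMr ?(ltW t0) // -expR0 ler_expR oppr_le0.
Qed.

Let e_cvg0 : e n @[n --> \oo] --> (0 : R).
Proof. by apply: (@squeeze_expR _ _ _ t) => n; rewrite subr0 /e normrM (ger0_norm (ltW t0)) ger0_norm // expR_ge0. Qed.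

Lemma inv_sin_diverges k : 0 < k -> k / sin (e n) @[n --> \oo] --> +oo.
Proof.
move=> k0; apply/cvgryPge => A.
have se n : sin (e n) <= e n.
  have /andP[e0 _] := e_itv n.
  by have := norm_sin_le (e n); rewrite (ger0_norm (ltW (sin_theta_gt0 (e_itv n)))) (ger0_norm (ltW e0)).
have [A0|A0] := leP A 0.
  apply: nearW => n; rewrite (le_trans A0) // divr_ge0 ?(ltW k0) //; exact: ltW (sin_theta_gt0 (e_itv n)).
have kA : 0 < k / A by rewrite divr_gt0.
near=> n.
have /andP[e0 e1] := e_itv n.
have s0 := sin_theta_gt0 (e_itv n).
apply: (@le_trans _ _ (k / e n)); last by rewrite ler_pM2l // lef_pV2 ?posrE.
rewrite ler_pdivlMr //.
have : e n < k / A by near: n; exact: (cvgr_lt _ e_cvg0).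
by rewrite ltr_pdivlMr // mulrC => /ltW.
Unshelve. all: by end_near. Qed.

(** Seen from 1, the point [tau] turns by a half-circle as it runs along a ray at a vanishing angle,
    from inside the unit circle to outside of it. *)
Lemma pole1_limit N : 1 < N -> (\int[mu]_(x in `[0, N]) Im (pole 1 (-1 + x) (e n))) @[n --> \oo] --> (pi : R).
Proof.
move=> N1.
have -> : (fun n => \int[mu]_(x in `[0, N]) Im (pole 1 (-1 + x) (e n))) =
   (fun n => atan ((expR (-1 + N) - cos (e n)) / sin (e n)) - atan ((expR (-1 + 0) - cos (e n)) / sin (e n))).
  by apply/funext => n; apply: pole1_integral => //; lra.
have -> : pi = pi / 2 - - (pi / 2) :> R by lra.
apply: cvgB.
  apply: cvg_atan_y.
  have k0 : 0 < expR (-1 + N) - 1 by rewrite subr_gt0 -[ltLHS]expR0 ltr_expR; lra.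
  apply: ger_cvgy (inv_sin_diverges k0); apply: nearW => n.
  by rewrite ler_pM2r ?invr_gt0 ?(sin_theta_gt0 (e_itv n)) // lerD2l lerN2 cos_le1.
have -> : (fun n => atan ((expR (-1 + 0) - cos (e n)) / sin (e n))) =
  (fun n => - atan ((cos (e n) - expR (-1 + 0)) / sin (e n))).
  by apply/funext => n; rewrite -atanN -mulNr opprB.
apply: cvgN; apply: cvg_atan_y.
pose k : R := (1 - expR (-1 + 0)) / 2.
have k0 : 0 < k by rewrite divr_gt0 // subr_gt0 -[ltRHS]expR0 ltr_expR; lra.
apply: ger_cvgy (inv_sin_diverges k0); near=> n.
rewrite ler_pM2r ?invr_gt0 ?(sin_theta_gt0 (e_itv n)) //.
have h : e n < k by near: n; exact: (cvgr_lt _ e_cvg0).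
have := norm_cosB1_le (e n); rewrite (ger0_norm (_ : 0 <= e n)); last by case/andP: (e_le n).
rewrite ler_norml => /andP[h1 _].
have kk : expR (-1 + 0) = 1 - 2 * k by rewrite /k; lra.
rewrite kk; lra.
Unshelve. all: by end_near. Qed.

(** Subtracting the kernel for [z = 1] leaves a removable singularity at [tau = 1], so that the
    difference stays bounded as the angle tends to 0. *)
Let diff z x y : R := Im ((cexp (cscale (1 - z) (-1 + x) y) - 1) * (pole_denom (-1 + x) y)^-1).

Lemma diffE z x y : diff z x y = Im (pole z (-1 + x) y) - Im (pole 1 (-1 + x) y).
Proof. by rewrite /diff pole1 /pole mulrBl mul1r ImD ImN. Qed.

Lemma diff_bounded z N : 0 <= N -> exists K, forall n x, x \in `[0, N] -> `|diff z x (e n)| <= K.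
Proof.
move=> N0.
have c1 := cos1_gt0 R.
have E1 : 0 < expR (-1) :> R by exact: expR_gt0.
pose k : R := Num.min (expR (-1)) (cos 1) / 2.
have k0 : 0 < k by rewrite divr_gt0 // lt_min E1.
exists (2 * `|1 - z| * expR (`|1 - z| * (1 + N)) / k) => n x.
rewrite in_itv /= => /andP[x0 xN]; have /andP[en0 en1] := e_le n.
apply: le_trans (Im_le_normc _) _; rewrite normcM normcV.
set a := -1 + x.
have aN : `|a| <= 1 + N by rewrite ler_norml /a; apply/andP; split; lra.
have h1 : expR (-1) * `|a| <= normc (pole_denom a (e n)).
  apply: le_trans (expRB1_le_pole_denom a (e n)).
  have [a0|a0] := leP 0 a.
    rewrite (ger0_norm a0) distrC ger0_norm; last by rewrite subr_ge0 -[leLHS]expR0 ler_expR.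
    have := expR_ge1Dx a.
    have : expR (-1) * a <= 1 * a by rewrite ler_wpM2r // -[leRHS]expR0 ler_expR; lra.
    lra.
  rewrite (ltr0_norm a0) ger0_norm; last by rewrite subr_ge0 -[leRHS]expR0 ler_expR ltW.
  have h : expR a * (- a) <= 1 - expR a.
    have := expR_ge1Dx (- a) => g.
    have : expR a * (1 + - a) <= expR a * expR (- a) by rewrite ler_wpM2l // expR_ge0.
    by rewrite -expRD subrr expR0; lra.
  apply: le_trans h; rewrite ler_wpM2r ?oppr_ge0 ?(ltW a0) // ler_expR /a; lra.
have h2 : cos 1 * e n <= normc (pole_denom a (e n)).
  apply: le_trans (sin_ge_linear (e_le n)) _.
  by apply: sin_le_pole_denom => //; exact: ltW (sin_theta_gt0 (e_itv n)).
have h3 : k * (`|a| + `|e n|) <= normc (pole_denom a (e n)).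
  rewrite (ger0_norm en0).
  have g1 : 2 * k <= expR (-1) by rewrite /k mulrCA divff // mulr1 ge_min lexx.
  have g2 : 2 * k <= cos 1 by rewrite /k mulrCA divff // mulr1 ge_min lexx orbT.
  have g3 : 2 * k * `|a| <= expR (-1) * `|a| by rewrite ler_wpM2r.
  have g4 : 2 * k * e n <= cos 1 * e n by rewrite ler_wpM2r.
  lra.
have s0 := sin_theta_gt0 (e_itv n).
have P0 : 0 < normc (pole_denom a (e n)).
  exact: lt_le_trans s0 (sin_le_pole_denom _ (ltW s0) (lexx _)).
rewrite ler_pdivrMr //; apply: le_trans (normc_cexpB1_le _ _ _) _.
have -> : 2 * `|1 - z| * expR (`|1 - z| * (1 + N)) / k * normc (pole_denom a (e n)) =
  2 * `|1 - z| * expR (`|1 - z| * (1 + N)) * (normc (pole_denom a (e n)) / k) by ring.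
apply: ler_pM.
- by rewrite mulr_ge0 ?expR_ge0 // mulr_ge0.
- by rewrite addr_ge0.
- by rewrite ler_wpM2l ?mulr_ge0 // ler_expR ler_wpM2l.
- by rewrite ler_pdivlMr // mulrC.
Qed.

Lemma diff_cvg0 z x : x != 1 -> diff z x (e n) @[n --> \oo] --> (0 : R).
Proof.
move=> x1.
have a0 : -1 + x != 0 by rewrite addrC subr_eq0.
have P0 := pole_denom_neq0 0 a0.
have [d1 h1] := cderiv_pole z P0.
have [d2 h2] := cderiv_pole 1 P0.
have d0 : diff z x 0 = 0.
  have I0 w : Im (pole w (-1 + x) 0) = 0.
    have p0 : Im (pole_denom (-1 + x) 0) = 0 by rewrite /pole_denom ImD /= sin0 mulr0 subr0.
    rewrite ImM ImV p0 oppr0 mul0r mulr0 add0r.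
    by rewrite -[X in X * _]/(expR (Re (cscale _ _ _)) * sin (Im (cscale _ _ _))) Im_cscale mulr0 sin0 mulr0 mul0r.
  by rewrite diffE !I0 subrr.
have cd : {for 0, continuous (diff z x)}.
  have -> : diff z x = (fun y => Im (pole z (-1 + x) y) - Im (pole 1 (-1 + x) y)).
    by apply/funext => y; exact: diffE.
  by apply: cvgB; [case: (cderiv_cont h1)|case: (cderiv_cont h2)].
rewrite -d0; exact: (cvg_comp e (diff z x) e_cvg0 cd).
Qed.

Lemma diff_integral z N : 0 <= N -> (\int[mu]_(x in `[0, N]) diff z x (e n)) @[n --> \oo] --> (0 : R).
Proof.
move=> N0; have [K hK] := diff_bounded z N0.
have mA : measurable (`[0, N] : set (measurableTypeR R)) by exact: measurable_itv.
have m1 : measurable ([set 1] : set (measurableTypeR R)) by exact: measurable_set1.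
have cd n x : {for x, continuous (fun x => diff z x (e n))}.
  have ei : e n \in `[e n, theta] by case/andP: (e_itv n) => _ h; rewrite in_itv /= lexx.
  have h1 := holo_shift (-1) (holo_pole z (e_itv n)).
  have h2 := holo_shift (-1) (holo_pole 1 (e_itv n)).
  have -> : (fun x => diff z x (e n)) = (fun x => Im (pole z (-1 + x) (e n)) - Im (pole 1 (-1 + x) (e n))).
    by apply/funext => y; exact: diffE.
  by apply: cvgB; [case: (holo_cont x h1 ei)|case: (holo_cont x h2 ei)].
have id n : mu.-integrable `[0, N] (EFin \o (fun x => diff z x (e n))).
  by apply: continuous_integrable => x _; exact: cd.
have ae1 : {ae mu, forall x, `[0, N]%classic x -> (diff z x (e n))%:E @[n --> \oo] --> (0 : \bar R)}.
  exists [set 1]; split => //; first exact: lebesgue_measure_set1.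
  move=> x /= nh; apply: contrapT => x1; apply: nh => _.
  apply: cvg_EFin; first exact: nearW.
  by apply: diff_cvg0; apply/eqP.
have iK : mu.-integrable `[0, N] (EFin \o (cst K : R -> R)).
  by apply: continuous_integrable => x _; exact: cvg_cst.
have bd : {ae mu, forall x, forall n, `[0, N]%classic x -> (`|(diff z x (e n))%:E| <= (EFin \o (cst K : R -> R)) x)%E}.
  by apply: aeW => x n xi; rewrite lee_fin; exact: hK.
have [_ _ lim] := @dominated_convergence _ _ _ mu _ mA (fun n => EFin \o (fun x => diff z x (e n))) (cst 0%E)
   (EFin \o (cst K : R -> R)) (fun n => measurable_int mu (id n)) (measurable_cst _) ae1 iK bd.
rewrite integral0 in lim.
exact: (fine_cvg lim).
Qed.

Lemma pole_limit z N : 1 < N ->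
  (\int[mu]_(x in `[0, N]) Im (pole z (-1 + x) (e n))) @[n --> \oo] --> (pi : R).
Proof.
move=> N1; have N0 : 0 <= N by lra.
have -> : (fun n => \int[mu]_(x in `[0, N]) Im (pole z (-1 + x) (e n))) =
    (fun n => \int[mu]_(x in `[0, N]) Im (pole 1 (-1 + x) (e n)) + \int[mu]_(x in `[0, N]) diff z x (e n)).
  apply/funext => n.
  have ei : e n \in `[e n, theta] by case/andP: (e_itv n) => _ h; rewrite in_itv /= lexx.
  have h1 := holo_shift (-1) (holo_pole z (e_itv n)).
  have h2 := holo_shift (-1) (holo_pole 1 (e_itv n)).
  have c1 x : {for x, continuous (fun x => Im (pole z (-1 + x) (e n)))} by case: (holo_cont x h1 ei).
  have c2 x : {for x, continuous (fun x => Im (pole 1 (-1 + x) (e n)))} by case: (holo_cont x h2 ei).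
  under [X in _ = _ + X]eq_Rintegral do rewrite diffE.
  rewrite RintegralB //; [|by apply: continuous_integrable => x _; exact: c1|by apply: continuous_integrable => x _; exact: c2].
  by rewrite addrC subrK.
by rewrite -[pi]addr0; apply: cvgD; [exact: pole1_limit|exact: diff_integral].
Qed.

End ShrinkingAngle.

(** Cauchy's theorem on a rectangle whose lower side slides down to the real axis: in the limit that
    side passes the pole and contributes [pi]. *)
Lemma pole_finite_contour z N : 1 < N ->
  \int[mu]_(b in `[0, theta]) Re (pole z (-1 + 0) b) + \int[mu]_(x in `[0, N]) Im (pole z (-1 + x) theta) =
  pi + \int[mu]_(b in `[0, theta]) Re (pole z (-1 + N) b).
Proof.
move=> N1; have N0 : 0 <= N by lra.
pose t := Num.min theta 1.
have t0 : 0 < t by rewrite lt_min theta0 ltr01.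
have t1 : t <= 1 by rewrite ge_min lexx orbT.
have tt : t <= theta by rewrite ge_min lexx.
pose e (n : nat) : R := t * expR (- n%:R).
have e_itv n : 0 < e n <= theta.
  rewrite mulr_gt0 ?expR_gt0 //=.
  by apply: le_trans tt; rewrite ler_piMr ?(ltW t0) // -expR0 ler_expR oppr_le0.
have trim x : -1 + x != 0 -> (\int[mu]_(b in `[e n, theta]) Re (pole z (-1 + x) b)) @[n --> \oo] -->
    \int[mu]_(b in `[0, theta]) Re (pole z (-1 + x) b).
  move=> a0; apply: trimmed_integral => // [b _|].
    by have [d hd] := cderiv_pole z (pole_denom_neq0 b a0); case: (cderiv_cont hd).
  exists (expR ((1 - z) * (-1 + x)) / `|1 - expR (-1 + x)|) => b _.
  by apply: le_trans (Re_le_normc _) _; exact: normc_pole_le.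
have l1 : (\int[mu]_(b in `[e n, theta]) Re (pole z (-1 + 0) b)) @[n --> \oo] -->
    \int[mu]_(b in `[0, theta]) Re (pole z (-1 + 0) b) by apply: trim; rewrite addr0 oppr_eq0 oner_eq0.
have l2 : (\int[mu]_(b in `[e n, theta]) Re (pole z (-1 + N) b)) @[n --> \oo] -->
    \int[mu]_(b in `[0, theta]) Re (pole z (-1 + N) b) by apply: trim; rewrite addrC subr_eq0 gt_eqF.
have l3 := pole_limit t0 t1 tt z N1.
have rect n : \int[mu]_(b in `[e n, theta]) Re (pole z (-1 + N) b) - \int[mu]_(b in `[e n, theta]) Re (pole z (-1 + 0) b) =
    \int[mu]_(x in `[0, N]) Im (pole z (-1 + x) theta) - \int[mu]_(x in `[0, N]) Im (pole z (-1 + x) (e n)).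
  have /andP[_ et] := e_itv n.
  have h1 := holo_shift (-1) (holo_pole z (e_itv n)).
  rewrite (cauchy_rectangle N0 et h1) RintegralB //; apply: continuous_integrable => x _.
    by have [|_ + _ _] := holo_cont x h1 (b := theta); rewrite //= in_itv /= lexx et.
  by have [|_ + _ _] := holo_cont x h1 (b := e n); rewrite //= in_itv /= lexx et.
have l4 := seq_cvgB l2 l1.
have l5 := seq_cvgB (@seq_cvg_cst (\int[mu]_(x in `[0, N]) Im (pole z (-1 + x) theta))) l3.
have rearrange (p q r s : R) : q - p = r - s -> p + r = s + q by lra.
exact: rearrange (eq_limits rect l4 l5).
Qed.

(** Because [z > 0], the far side of the rectangle becomes negligible as it moves to infinity. *)
Lemma pole_contour z : 0 < z -> contour theta (-1) (pole z) = pi.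
Proof.
move=> z0; rewrite /contour.
have thetai : theta \in `[theta, theta] by rewrite in_itv /= lexx.
have tt : 0 < theta <= theta by rewrite theta0 lexx.
have cray x : {for x, continuous (fun x => Im (pole z (-1 + x) theta))}.
  by case: (holo_cont x (holo_shift (-1) (holo_pole z tt)) thetai).
have bray x : 0 <= x -> `|Im (pole z (-1 + x) theta)| <= expR z * expR (- (z * x)).
  move=> _; apply: le_trans (Im_le_normc _) _; apply: le_trans (pole_ray _ _) _.
  by rewrite -expRD ler_expR; lra.
have [iray _] := ray_integrable_exp z0 cray bray.
have lray := ray_limit iray.
have lray2 : (\int[mu]_(x in `[0, (n + 2)%:R]) Im (pole z (-1 + x) theta)) @[n --> \oo] -->
    \int[mu]_(x in `[0, +oo[) Im (pole z (-1 + x) theta).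
  by move: lray; rewrite -(cvg_shiftn 2).
pose K : R := expR z / (1 - expR (-1)) * theta.
have lend : (\int[mu]_(b in `[0, theta]) Re (pole z (-1 + (n + 2)%:R) b)) @[n --> \oo] --> (0 : R).
  apply: (@squeeze_exp _ _ _ K z) => // n; rewrite subr0.
  set a := -1 + (n + 2)%:R.
  have a1 : 1 <= a by rewrite /a natrD; have := ler0n R n; lra.
  have a0 : a != 0 by rewrite gt_eqF //; lra.
  have -> : K * expR (- (z * n%:R)) = expR z / (1 - expR (-1)) * expR (- (z * n%:R)) * (theta - 0) by rewrite /K subr0; ring.
  apply: Rintegral_norm_le => [|b _|b _]; first exact: ltW.
    by have [d hd] := cderiv_pole z (pole_denom_neq0 b a0); case: (cderiv_cont hd).
  apply: le_trans (Re_le_normc _) _; apply: le_trans (normc_pole_le _ _ a0) _.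
  have q0 : 0 < 1 - expR (-1) :> R by rewrite subr_gt0 -[ltRHS]expR0 ltr_expR; lra.
  have q1 : expR a * (1 - expR (-1)) <= `|1 - expR a|.
    rewrite ler0_norm; last by rewrite subr_le0 -[leLHS]expR0 ler_expR; lra.
    have : expR 0 <= expR a * expR (-1) :> R by rewrite -expRD ler_expR; lra.
    rewrite expR0; lra.
  apply: (@le_trans _ _ (expR ((1 - z) * a) / (expR a * (1 - expR (-1))))).
    rewrite ler_wpM2l ?expR_ge0 // lef_pV2 ?posrE ?mulr_gt0 ?expR_gt0 //.
    by apply: lt_le_trans q1; rewrite mulr_gt0 ?expR_gt0.
  rewrite invfM mulrA -expRB [leRHS]mulrAC -expRD ler_pM2r ?invr_gt0 // ler_expR.
  by rewrite /a natrD; have := ler0n R n; nra.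
have fin n : \int[mu]_(x in `[0, (n + 2)%:R]) Im (pole z (-1 + x) theta) =
    (pi - \int[mu]_(b in `[0, theta]) Re (pole z (-1 + 0) b)) - (0 - \int[mu]_(b in `[0, theta]) Re (pole z (-1 + (n + 2)%:R) b)).
  have N1 : 1 < (n + 2)%:R :> R by rewrite ltr1n addn2.
  have rearrange (p q r s : R) : p + r = s + q -> r = s - p - (0 - q) by lra.
  exact: rearrange (pole_finite_contour z N1).
have := eq_limits fin lray2 (seq_cvgB (@seq_cvg_cst _) (seq_cvgB (@seq_cvg_cst 0) lend)).
rewrite addr0; lra.
Qed.

End PoleContour.

(** * The Hankel integral is the reciprocal of the Gamma function *)

Section FubiniRect.
Variable R : realType.
Notation mu := (@lebesgue_measure R).
Notation T := (measurableTypeR R).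

Lemma Rintegral_Fubini (U B : set T) (f : T -> T -> R) (h : T -> R) :
  measurable U -> measurable B ->
  measurable_fun [set: T * T] (fun p => f p.1 p.2) ->
  (forall u, U u -> mu.-integrable B (EFin \o f u)) ->
  (forall y, B y -> mu.-integrable U (EFin \o f^~ y)) ->
  (forall y, B y -> \int[mu]_(u in U) `|f u y| <= h y) ->
  mu.-integrable B (EFin \o h) ->
  mu.-integrable U (EFin \o (fun u => \int[mu]_(y in B) f u y)) /\
  \int[mu]_(u in U) \int[mu]_(y in B) f u y = \int[mu]_(y in B) \int[mu]_(u in U) f u y.
Proof.
move=> mU mB mf fB fU fh ih.
pose F : T * T -> \bar R := (fun p => (f p.1 p.2)%:E) \_ (U `*` B).
have mF : measurable_fun setT F.
  have mX : measurable (U `*` B) by exact: measurableX.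
  apply/(measurable_restrictT _ mX).
  by apply: measurable_funTS; apply/measurable_EFinP.
have F1 u : (\int[mu]_y F (u, y) = ((fun u => (\int[mu]_(y in B) f u y)%:E) \_ U) u)%E.
  rewrite patchE; case: ifPn => uU.
    rewrite /Rintegral fineK; last exact: (@integrable_fin_num _ _ _ mu _ mB _ (fB _ (set_mem uU))).
    rewrite [RHS]integral_mkcond; apply: eq_integral => y _.
    by rewrite /F !patchE in_setX /= uU.
  by apply: integral0_eq => y _; rewrite /F patchE in_setX /= (negbTE uU).
have F2 y : (\int[mu]_u F (u, y) = ((fun y => (\int[mu]_(u in U) f u y)%:E) \_ B) y)%E.
  rewrite patchE; case: ifPn => yB.
    rewrite /Rintegral fineK; last exact: (@integrable_fin_num _ _ _ mu _ mU _ (fU _ (set_mem yB))).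
    rewrite [RHS]integral_mkcond; apply: eq_integral => u _.
    by rewrite /F !patchE in_setX /= yB andbT.
  by apply: integral0_eq => u _; rewrite /F patchE in_setX /= (negbTE yB) andbF.
have Fabs y : (\int[mu]_u `|F (u, y)| = ((fun y => (\int[mu]_(u in U) `|f u y|)%:E) \_ B) y)%E.
  rewrite patchE; case: ifPn => yB.
    rewrite /Rintegral fineK; last first.
      by apply: (@integrable_fin_num _ _ _ mu _ mU _ (integrable_norm (fU y (set_mem yB)))).
    rewrite [RHS]integral_mkcond; apply: eq_integral => u _.
    rewrite /F !patchE in_setX /= yB andbT; case: ifPn => // _; by rewrite abse0.
  by apply: integral0_eq => u _; rewrite /F patchE in_setX /= (negbTE yB) andbF abse0.
have iF : ((mu : {sigma_finite_measure set T -> \bar R}) \x (mu : {sigma_finite_measure set T -> \bar R}))%E.-integrable setT F.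
  apply/(integrable21ltyP _ _ mF).
  have [mh hfin] := integrableP _ _ _ ih.
  apply: le_lt_trans hfin; rewrite [leRHS]integral_mkcond.
  apply: ge0_le_integral => //.
  - by move=> y _; apply: integral_ge0.
  - apply: (measurable_fun_fubini_tonelli_G (abse \o F)); first exact: measurableT_comp.
    by move=> p; rewrite /= abse_ge0.
  - have mabs : measurable_fun B (fun y => `|(EFin \o h) y|%E) by exact: measurableT_comp.
    exact: (measurable_restrictT _ mB).1 mabs.
  - move=> y _; rewrite Fabs !patchE; case: ifPn => // yB.
    by rewrite lee_fin (le_trans (fh y (set_mem yB))) // ler_norm.
split.
  have := integrable_fubini_F iF.
  have -> : fubini_F mu F = ((EFin \o (fun u => \int[mu]_(y in B) f u y)) \_ U).
    by apply/funext => u; rewrite /fubini_F F1.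
  by move/(integrable_restrict mu mU measurableT); rewrite setTI.
have := Fubini iF.
under eq_integral do rewrite F1.
under [RHS]eq_integral do rewrite F2.
rewrite -!integral_mkcond => E.
by rewrite /Rintegral; congr fine.
Qed.

End FubiniRect.

Section GammaReciprocal.
Variable R : realType.
Notation mu := (@lebesgue_measure R).
Notation T := (measurableTypeR R).
Notation Re := (@complex.Re R).
Notation Im := (@complex.Im R).
Implicit Types (a b c x y u z : R) (w P : R[i]).

Definition expseg w P u : R[i] := w * cexp ((- u)%:C * P).

Lemma normc_expseg w P u : normc (expseg w P u) = normc w * expR (- (Re P * u)).
Proof. by rewrite normcM normc_cexp ReM /= mul0r subr0; congr (_ * expR _); ring. Qed.

Lemma expseg_derive w P u :
  is_derive u 1 (fun u => Re (expseg w P u)) (Re (expseg (- (w * P)) P u)) /\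
  is_derive u 1 (fun u => Im (expseg w P u)) (Im (expseg (- (w * P)) P u)).
Proof.
have h1 := cderivM (cderiv_cst (- P) u 0) (cderiv_id u 0).
have h2 := cderivM (cderiv_cst w u 0) (cderiv_cexp h1).
have e w' x : w' * cexp (- P * (x +i* 0)) = expseg w' P x.
  rewrite /expseg; congr (_ * cexp _).
  by rewrite raddfN !mulNr; congr (- _); exact: mulrC.
have d : 0 * cexp (- P * (u +i* 0)) + w * ((0 * (u +i* 0) + - P * 1) * cexp (- P * (u +i* 0))) = expseg (- (w * P)) P u.
  by rewrite -e; ring.
rewrite d in h2; case: h2 => [h3 h4 _ _].
by split; [move: h3|move: h4]; congr (is_derive u 1 _ _); apply/funext => x; rewrite e.
Qed.

Lemma expseg_integral w P : 0 < Re P ->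
  \int[mu]_(u in `[0, +oo[) Re (expseg w P u) = Re (w / P) /\
  \int[mu]_(u in `[0, +oo[) Im (expseg w P u) = Im (w / P).
Proof.
move=> P0.
have Pn0 : P != 0 by apply: contraTneq P0 => ->; rewrite ltxx.
have dd u := expseg_derive (- (w / P)) P u.
have e : - (- (w / P) * P) = w by rewrite mulNr opprK divfK.
have cR w' x : {for x, continuous (fun u => Re (expseg w' P u))}.
  exact: is_derive_continuous (expseg_derive w' P x).1.
have cI w' x : {for x, continuous (fun u => Im (expseg w' P u))}.
  exact: is_derive_continuous (expseg_derive w' P x).2.
have nR w' x : `|Re (expseg w' P x)| <= normc w' * expR (- (Re P * x)).
  by rewrite -normc_expseg; exact: Re_le_normc.
have nI w' x : `|Im (expseg w' P x)| <= normc w' * expR (- (Re P * x)).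
  by rewrite -normc_expseg; exact: Im_le_normc.
have v0 w' : expseg w' P 0 = w'.
  by rewrite /expseg oppr0 raddf0 mul0r /cexp /= expR0 cos0 sin0 mulr1 mulr0 mulr1.
split.
- have lim := ray_limit (ray_integrable_exp P0 (cR w) (fun x _ => nR w x)).1.
  have fin n : \int[mu]_(u in `[0, n%:R]) Re (expseg w P u) =
      Re (expseg (- (w / P)) P n%:R) - Re (expseg (- (w / P)) P 0).
    apply: (@Rintegral_FTC2 _ _ (fun u => Re (expseg (- (w / P)) P u))) => // x _.
    by have [h _] := dd x; rewrite e in h.
  have l2 : Re (expseg (- (w / P)) P n%:R) @[n --> \oo] --> (0 : R).
    by apply: (squeeze_exp P0) => n; rewrite subr0; exact: nR.
  rewrite (eq_limits fin lim (seq_cvgB l2 (@seq_cvg_cst R _))) v0 sub0r.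
  by case: (w / P) => ? ? /=; rewrite opprK.
- have lim := ray_limit (ray_integrable_exp P0 (cI w) (fun x _ => nI w x)).1.
  have fin n : \int[mu]_(u in `[0, n%:R]) Im (expseg w P u) =
      Im (expseg (- (w / P)) P n%:R) - Im (expseg (- (w / P)) P 0).
    apply: (@Rintegral_FTC2 _ _ (fun u => Im (expseg (- (w / P)) P u))) => // x _.
    by have [_ h] := dd x; rewrite e in h.
  have l2 : Im (expseg (- (w / P)) P n%:R) @[n --> \oo] --> (0 : R).
    by apply: (squeeze_exp P0) => n; rewrite subr0; exact: nI.
  rewrite (eq_limits fin lim (seq_cvgB l2 (@seq_cvg_cst R _))) v0 sub0r.
  by rewrite -ImN opprK.
Qed.

Lemma expseg_bound w P : 0 < Re P ->
  [/\ mu.-integrable `]0, +oo[ (EFin \o (fun u => Re (expseg w P u))),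
      mu.-integrable `]0, +oo[ (EFin \o (fun u => Im (expseg w P u))),
      \int[mu]_(u in `]0, +oo[) `|Re (expseg w P u)| <= normc w / Re P &
      \int[mu]_(u in `]0, +oo[) `|Im (expseg w P u)| <= normc w / Re P].
Proof.
move=> P0.
have cR x : {for x, continuous (fun u => Re (expseg w P u))}.
  exact: is_derive_continuous (expseg_derive w P x).1.
have cI x : {for x, continuous (fun u => Im (expseg w P u))}.
  exact: is_derive_continuous (expseg_derive w P x).2.
have nR x : 0 <= x -> `|Re (expseg w P x)| <= normc w * expR (- (Re P * x)).
  by move=> _; rewrite -normc_expseg; exact: Re_le_normc.
have nI x : 0 <= x -> `|Im (expseg w P x)| <= normc w * expR (- (Re P * x)).
  by move=> _; rewrite -normc_expseg; exact: Im_le_normc.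
have [iR bR] := ray_integrable_exp P0 cR nR.
have [iI bI] := ray_integrable_exp P0 cI nI.
have sub : (`]0, +oo[ : set R) `<=` `[0, +oo[.
  by move=> x /=; rewrite !in_itv /= !andbT => /ltW.
have m1 : measurable (`]0, +oo[ : set T) by exact: measurable_itv.
have m2 : measurable (`[0, +oo[ : set T) by exact: measurable_itv.
have iR' := integrableS m2 m1 sub iR.
have iI' := integrableS m2 m1 sub iI.
split => //.
- by rewrite Rintegral_itv_obnd_cbnd //; exact: (integrable_norm iR').
- by rewrite Rintegral_itv_obnd_cbnd //; exact: (integrable_norm iI').
Qed.

End GammaReciprocal.

Section RGamma.
Variable R : realType.
Notation mu := (@lebesgue_measure R).
Notation T := (measurableTypeR R).
Notation Re := (@complex.Re R).
Notation Im := (@complex.Im R).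
Implicit Types (a b c x y u : R) (w P : R[i]).
Variable theta : R.
Hypothesis theta0 : 0 < theta.
Hypothesis theta_pi : theta < pi.
Hypothesis cos_theta : cos theta < 0.
Variable z : R.
Hypothesis z0 : 0 < z.

(** The kernel of Hankel's integral on the contour dilated by [u], times the integrand of Euler's
    integral at [u]: the dependence on [u] becomes a plain exponential. *)
Let scaled u a b : R[i] := expseg (cexp (cscale (1 - z) a b)) (pole_denom a b) u.

Lemma Re_pole_denom a b : Re (pole_denom a b) = 1 - expR a * cos b.
Proof. by rewrite /pole_denom ReD /=. Qed.

Lemma Im_pole_denom a b : Im (pole_denom a b) = - (expR a * sin b).
Proof. by rewrite /pole_denom ImD /= sub0r. Qed.

Lemma scaled_hankel u a b : 0 < u ->
  (u `^ (z - 1) * expR (- u))%:C * hankel z (ln u + a) b = scaled u a b.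
Proof.
move=> u0.
have -> : (u `^ (z - 1) * expR (- u))%:C = cexp (((z - 1) * ln u - u)%:C).
  by rewrite /powR gt_eqF // -expRD; apply: complex_eqP => /=; rewrite ?cos0 ?sin0 ?mulr1 ?mulr0.
rewrite /hankel /scaled /expseg -!cexpD; congr cexp.
have -> : cexp ((ln u + a) +i* b) = u%:C * cexp (a +i* b).
  by apply: complex_eqP => /=; rewrite expRD lnK ?posrE //; ring.
by apply: complex_eqP; rewrite !(ReD, ImD, ReM, ImM, Re_cscale, Im_cscale, Re_pole_denom, Im_pole_denom) /=; ring.
Qed.

Lemma Re_scaled u a b : Re (scaled u a b) =
  expR ((1 - z) * a - u * (1 - expR a * cos b)) * cos ((1 - z) * b + u * (expR a * sin b)).
Proof.
rewrite /scaled /expseg -cexpD -[LHS]/(expR (Re (_ + _)) * cos (Im (_ + _))).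
rewrite !(ReD, ImD, ReM, ImM, Re_cscale, Im_cscale, Re_pole_denom, Im_pole_denom) /=.
by congr (expR _ * cos _); ring.
Qed.

Lemma Im_scaled u a b : Im (scaled u a b) =
  expR ((1 - z) * a - u * (1 - expR a * cos b)) * sin ((1 - z) * b + u * (expR a * sin b)).
Proof.
rewrite /scaled /expseg -cexpD -[LHS]/(expR (Re (_ + _)) * sin (Im (_ + _))).
rewrite !(ReD, ImD, ReM, ImM, Re_cscale, Im_cscale, Re_pole_denom, Im_pole_denom) /=.
by congr (expR _ * sin _); ring.
Qed.

Let arc u := \int[mu]_(b in `[0, theta]) Re (scaled u (-1) b).
Let ray u := \int[mu]_(x in `[0, +oo[) Im (scaled u (-1 + x) theta).

Let mpos : measurable (`]0, +oo[ : set T). Proof. exact: measurable_itv. Qed.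
Let marc : measurable (`[0, theta] : set T). Proof. exact: measurable_itv. Qed.
Let mray : measurable (`[0, +oo[ : set T). Proof. exact: measurable_itv. Qed.

(** For each [u] the contour may be moved to radius [u / e], where it is the dilation by [u] of the
    contour of radius [1 / e]. *)
Lemma gamma_integrand u : 0 < u ->
  (u `^ (z - 1) * expR (- u)) * (pi * rgamma theta z) = arc u + ray u.
Proof.
move=> u0.
have -> : pi * rgamma theta z = contour theta 0 (hankel z) by rewrite /rgamma mulrCA mulfV ?mulr1 // gt_eqF ?pi_gt0.
rewrite (contour_shift (ltW theta0) 0 (ln u + -1) (admissible_hankel cos_theta z)).
rewrite -(contourZ (ltW theta0) _ _ (holo_hankel theta z) (ray_decay_hankel cos_theta z)).
rewrite /contour; congr (_ + _); apply: eq_Rintegral => x _; first by rewrite scaled_hankel.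
by rewrite -addrA scaled_hankel.
Qed.

Let q : R := 1 - expR (-1).

Let pd_arc b : 0 < q <= Re (pole_denom (-1) b).
Proof.
apply/andP; split; first by rewrite /q subr_gt0 -[ltRHS]expR0 ltr_expR oppr_lt0.
by rewrite Re_pole_denom /q lerD2l lerN2 -[leRHS]mulr1 ler_wpM2l ?expR_ge0 ?cos_le1.
Qed.

Let pd_ray x : 0 < expR (-1 + x) * - cos theta <= Re (pole_denom (-1 + x) theta).
Proof.
by rewrite mulr_gt0 ?expR_gt0 ?oppr_gt0 // Re_pole_denom mulrN lerDr ler01.
Qed.

Let meas_fst : measurable_fun [set: T * T] (fun p : T * T => (p.1 : R)).
Proof. exact: measurable_fst. Qed.
Let meas_snd : measurable_fun [set: T * T] (fun p : T * T => (p.2 : R)).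
Proof. exact: measurable_snd. Qed.
Let mcos : measurable_fun setT (@cos R).
Proof. by apply: continuous_measurable_fun; exact: continuous_cos. Qed.
Let msin : measurable_fun setT (@sin R).
Proof. by apply: continuous_measurable_fun; exact: continuous_sin. Qed.

Lemma measurable_arc : measurable_fun [set: T * T] (fun p : T * T => Re (scaled p.1 (-1) p.2)).
Proof.
under eq_fun do rewrite Re_scaled.
apply: measurable_funM.
  apply: (measurableT_comp (@measurable_expR R)); apply: measurable_funB => //.
  apply: measurable_funM => //; apply: measurable_funB => //; apply: measurable_funM => //.
  exact: (measurableT_comp mcos).
apply: (measurableT_comp mcos); apply: measurable_funD; first exact: measurable_funM.
apply: measurable_funM => //; apply: measurable_funM => //.
exact: (measurableT_comp msin).
Qed.

Lemma measurable_ray : measurable_fun [set: T * T] (fun p : T * T => Im (scaled p.1 (-1 + p.2) theta)).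
Proof.
have m1 : measurable_fun [set: T * T] (fun p : T * T => -1 + (p.2 : R)) by exact: measurable_funD.
have mE : measurable_fun [set: T * T] (fun p : T * T => expR (-1 + (p.2 : R))).
  exact: (measurableT_comp (@measurable_expR R)).
under eq_fun do rewrite Im_scaled.
apply: measurable_funM.
  apply: (measurableT_comp (@measurable_expR R)); apply: measurable_funB; first exact: measurable_funM.
  by apply: measurable_funM => //; apply: measurable_funB => //; exact: measurable_funM.
apply: (measurableT_comp msin); apply: measurable_funD => //.
by apply: measurable_funM => //; exact: measurable_funM.
Qed.

Lemma integrable_ray_section u : 0 < u ->
  mu.-integrable `[0, +oo[ (EFin \o (fun x => Im (scaled u (-1 + x) theta))).
Proof.
move=> u0.
have hh := holoM (holo_cst _ (u `^ (z - 1) * expR (- u))%:C) (holo_hankel theta z).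
have dh := @ray_decayZ _ theta (u `^ (z - 1) * expR (- u)) _ (ray_decay_hankel cos_theta z).
have [ch [C hC]] := contour_ray (ltW theta0) (ln u + -1) hh dh.
have := (ray_integrable ch hC).1; congr (_.-integrable _ (EFin \o _)).
by apply/funext => x; rewrite -addrA scaled_hankel.
Qed.

Lemma arc_Fubini : mu.-integrable `]0, +oo[ (EFin \o arc) /\
  \int[mu]_(u in `]0, +oo[) arc u = \int[mu]_(b in `[0, theta]) Re (pole z (-1) b).
Proof.
pose K : R := expR ((1 - z) * -1) / q.
have bd b := expseg_bound (cexp (cscale (1 - z) (-1) b)) (lt_le_trans (andP (pd_arc b)).1 (andP (pd_arc b)).2).
have sec u : `]0, +oo[%classic u -> mu.-integrable `[0, theta] (EFin \o (fun b => Re (scaled u (-1) b))).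
  move=> _; apply: continuous_integrable => b _.
  have h := cderivM (cderiv_cst (1 - z)%:C (-1) b) (cderiv_id (-1) b).
  have h1 := cderiv_cexp h.
  have [d h2] := cderiv_pole_denom (-1) b.
  have h3 := cderivM (cderiv_cst (- u)%:C (-1) b) h2.
  by have [_ _ h4 _] := cderiv_cont (cderivM h1 (cderiv_cexp h3)).
have sec' b : `[0, theta]%classic b -> mu.-integrable `]0, +oo[ (EFin \o (fun u => Re (scaled u (-1) b))).
  by move=> _; case: (bd b).
have dom b : `[0, theta]%classic b -> \int[mu]_(u in `]0, +oo[) `|Re (scaled u (-1) b)| <= cst K b.
  move=> _; have [_ _ h _] := bd b; apply: le_trans h _.
  have /andP[p0 p1] := pd_arc b.
  rewrite normc_cexp Re_cscale /K ler_wpM2l ?expR_ge0 // lef_pV2 ?posrE //.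
  exact: lt_le_trans p0 p1.
have iK : mu.-integrable `[0, theta] (EFin \o (cst K : R -> R)).
  by apply: continuous_integrable => x _; exact: cvg_cst.
have [i e] := Rintegral_Fubini mpos marc measurable_arc sec sec' dom iK.
split; [exact: i|rewrite e]; apply: eq_Rintegral => b _.
  have /andP[p0 p1] := pd_arc b.
  have [h _] := expseg_integral (cexp (cscale (1 - z) (-1) b)) (lt_le_trans p0 p1).
  by rewrite -h; apply: Rintegral_itv_obnd_cbnd; case: (bd b).
Qed.

Lemma ray_Fubini : mu.-integrable `]0, +oo[ (EFin \o ray) /\
  \int[mu]_(u in `]0, +oo[) ray u = \int[mu]_(x in `[0, +oo[) Im (pole z (-1 + x) theta).
Proof.
pose K : R := expR z / (- cos theta).
have bd x := expseg_bound (cexp (cscale (1 - z) (-1 + x) theta)) (lt_le_trans (andP (pd_ray x)).1 (andP (pd_ray x)).2).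
have sec u : `]0, +oo[%classic u -> mu.-integrable `[0, +oo[ (EFin \o (fun x => Im (scaled u (-1 + x) theta))).
  by rewrite /= in_itv /= andbT; exact: integrable_ray_section.
have sec' x : `[0, +oo[%classic x -> mu.-integrable `]0, +oo[ (EFin \o (fun u => Im (scaled u (-1 + x) theta))).
  by move=> _; case: (bd x).
have dom x : `[0, +oo[%classic x -> \int[mu]_(u in `]0, +oo[) `|Im (scaled u (-1 + x) theta)| <= K * expR (- (z * x)).
  move=> _; have [_ _ _ h] := bd x; apply: le_trans h _.
  have /andP[p0 p1] := pd_ray x.
  have k0 : 0 < - cos theta by rewrite oppr_gt0.
  have -> : K * expR (- (z * x)) = expR ((1 - z) * (-1 + x)) / (expR (-1 + x) * - cos theta).
    by rewrite invfM mulrA -expRB /K mulrAC -expRD; congr (expR _ / _); ring.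
  rewrite normc_cexp Re_cscale ler_wpM2l ?expR_ge0 // lef_pV2 ?posrE //.
  exact: lt_le_trans p0 p1.
have iK : mu.-integrable `[0, +oo[ (EFin \o (fun x => K * expR (- (z * x)))).
  by have := integrableZl mray K (ray_exp_integral z0).1; apply: eq_integrable.
have [i e] := Rintegral_Fubini mpos mray measurable_ray sec sec' dom iK.
split; [exact: i|rewrite e]; apply: eq_Rintegral => x _.
  have /andP[p0 p1] := pd_ray x.
  have [_ h] := expseg_integral (cexp (cscale (1 - z) (-1 + x) theta)) (lt_le_trans p0 p1).
  by rewrite -h; apply: Rintegral_itv_obnd_cbnd; case: (bd x).
Qed.

(** Multiply Hankel's integral by Euler's and integrate in [u] first. The radius [exp (- 1) < 1] and
    the angle [theta > pi / 2] keep the real part of [1 - tau] positive on the contour, so that the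
    integral in [u] is [1 / (1 - tau)], and the kernel with residue 1 remains. *)
Lemma rgammaE : rgamma theta z = (Gamma z)^-1.
Proof.
have [iA eA] := arc_Fubini; have [iR eR] := ray_Fubini.
have total : \int[mu]_(u in `]0, +oo[) (arc u + ray u) = pi.
  rewrite RintegralD // eA eR -(pole_contour theta0 theta_pi cos_theta z0) /contour.
  by [].
pose g u : R := u `^ (z - 1) * expR (- u).
have J u : `]0, +oo[%classic u -> arc u + ray u = g u * (pi * rgamma theta z).
  by move=> /=; rewrite in_itv /= andbT => u0; rewrite -gamma_integrand.
have total' : \int[mu]_(u in `]0, +oo[) (g u * (pi * rgamma theta z)) = pi.
  by rewrite -[RHS]total; apply: eq_Rintegral => u /set_mem /J.
have r0 : pi * rgamma theta z != 0.
  apply/eqP => r0; have := total'; under eq_Rintegral do rewrite r0 mulr0.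
  rewrite Rintegral_cst // mul0r => /esym/eqP; by rewrite gt_eqF ?pi_gt0.
have ig : mu.-integrable `]0, +oo[ (EFin \o g).
  have := integrableZl mpos (pi * rgamma theta z)^-1 (integrableD mpos iA iR).
  apply: eq_integrable => // u /set_mem /J h /=.
  by rewrite -EFinD -EFinM h mulrC mulfK.
have G : Gamma z * (pi * rgamma theta z) = pi by rewrite -[RHS]total' -RintegralZr.
have p0 : pi != 0 :> R by rewrite gt_eqF ?pi_gt0.
have G1 : rgamma theta z * Gamma z = 1 by apply: (mulfI p0); rewrite mulr1 -[RHS]G; ring.
have G0 : Gamma z != 0.
  by apply/eqP => g0; move: G1; rewrite g0 mulr0 => /esym/eqP; rewrite oner_eq0.
by apply: (mulIf G0); rewrite G1 mulVf.
Qed.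

End RGamma.

(** * Differentiation of the Mittag-Leffler function *)

Section MittagLeffler.
Variable R : realType.
Variable alpha : R.
Hypothesis alpha12 : 1 < alpha < 2.
Implicit Types (s z x : R).

Let pi0 : 0 < pi :> R := pi_gt0 R.
Let alpha0 : 0 < alpha. Proof. by case/andP: alpha12 => h _; lra. Qed.

(** The midpoint of [pi / 2] and [pi / alpha]: beyond [pi / 2] the exponential decays along the ray,
    below [pi / alpha] the resolvent has no pole to the right of the contour. *)
Definition angle : R := (pi / 2 + pi / alpha) / 2.

Lemma angle_facts : [/\ 0 < angle, angle < pi, cos angle < 0 & alpha * angle < pi].
Proof.
have /andP[a1 a2] := alpha12.
have q1 : pi / 2 < pi / alpha by rewrite ltr_pM2l // ltf_pV2 ?posrE.
have q2 : pi / alpha < pi by rewrite ltr_pdivrMr // ltr_pMr.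
have e : alpha * angle = (alpha * (pi / 2) + pi) / 2.
  by rewrite /angle; field; rewrite gt_eqF.
have q3 : alpha * (pi / 2) < pi by nra.
rewrite e /angle; split; [lra|lra| |lra].
by rewrite -(@cos_pihalf R) ltr_cos ?in_itv /=; [lra|apply/andP; split; lra|apply/andP; split; lra].
Qed.

Let t0 : 0 < angle. Proof. by case: angle_facts. Qed.
Let t1 : angle < pi. Proof. by case: angle_facts. Qed.
Let t2 : cos angle < 0. Proof. by case: angle_facts. Qed.
Let t3 : alpha * angle < pi. Proof. by case: angle_facts. Qed.

Definition mlf s z := ml angle alpha s z.

Lemma mlf_bound z : exists C, forall s, 0 <= s -> `|mlf s z| <= C / (1 + s).
Proof. exact: ml_bound (ltW t0) t2 alpha0 t3 z. Qed.

Lemma mlf_cvg s z : 0 <= s ->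
  series (fun j => (- s) ^+ j * rgamma angle (alpha * j%:R + z)) @ \oo --> mlf s z.
Proof. move=> s0; exact: (@cvg_ml R angle alpha (ltW t0) t2 alpha0 t3 s z s0). Qed.

Lemma eq_series_cvg (u v : nat -> R) (l : R) : (forall n, u n = v n) ->
  series u @ \oo --> l -> series v @ \oo --> l.
Proof. by move=> /funext ->. Qed.

Lemma mittag_leffler_mlf s z : 0 <= s -> 0 < z -> mittag_leffler alpha z (- s) = mlf s z.
Proof.
move=> s0 z0; rewrite /mittag_leffler; apply: cvg_lim => //.
apply: eq_series_cvg (@mlf_cvg s z s0) => j.
by rewrite (rgammaE t0 t1 t2) // ltr_wpDl // mulr_ge0 // ltW.
Qed.

Lemma mlf_step s z : 0 <= s -> mlf s z = rgamma angle z - s * mlf s (z + alpha).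
Proof.
move=> s0; rewrite /mlf /ml /rgamma.
rewrite (ml_partial_sum (ltW t0) t2 alpha0 t3 0 z 1 s0) big_ord1 expr0 mul1r expr1 mulr0 add0r mulr1.
rewrite [alpha + z]addrC; ring.
Qed.

Let coef z (j : nat) : R := (-1) ^+ j * rgamma angle (alpha * j%:R + z).

Lemma pseries_coef z x : 0 <= x -> pseries (coef z) x @ \oo --> mlf x z.
Proof.
move=> x0; apply: eq_series_cvg (@mlf_cvg x z x0) => j.
by rewrite /coef exprNn mulrAC.
Qed.

Lemma pseries_comb p q z z' x : 0 <= x ->
  pseries (fun j => p * coef z j + q * coef z' j) x @ \oo --> p * mlf x z + q * mlf x z'.
Proof.
move=> x0.
have -> : pseries (fun j => p * coef z j + q * coef z' j) x =
   (fun n => p * pseries (coef z) x n + q * pseries (coef z') x n).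
  apply/funext => n; rewrite /pseries /series /= !mulr_sumr -big_split /=.
  by apply: eq_bigr => i _; ring.
apply: cvgD; apply: cvgMr; exact: pseries_coef.
Qed.

(** The recurrence of [rgamma] expresses the coefficients of the derivative by those of two other
    members of the family, so that all derivatives converge at once. *)
Lemma pseries_diffs_coef z :
  pseries_diffs (coef z) = (fun j => - alpha^-1 * coef (z + alpha - 1) j + (z - 1) / alpha * coef (z + alpha) j).
Proof.
apply/funext => j; rewrite /pseries_diffs /coef.
have e1 : alpha * j.+1%:R + z = alpha * j%:R + (z + alpha) by rewrite -natr1; ring.
have e2 : alpha * j%:R + (z + alpha - 1) = alpha * j.+1%:R + z - 1 by rewrite -natr1; ring.
rewrite e2 -e1 (rgamma_rec (ltW t0) t2 (alpha * j.+1%:R + z - 1)) subrK exprS.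
by rewrite -natr1; field; rewrite gt_eqF.
Qed.

Lemma is_derive_mlf s z : 0 < s ->
  is_derive s 1 (mlf^~ z) ((mlf s (z - 1) - (z - 1) * mlf s z) / (alpha * s)).
Proof.
move=> s0; have s1 : 0 <= s + 1 by lra.
have d1 := @pseries_snd_diffs R (coef z) (s + 1) s.
have c1 : cvgn (pseries (coef z) (s + 1)) by apply/cvg_ex; eexists; exact: pseries_coef.
have c2 : cvgn (pseries (pseries_diffs (coef z)) (s + 1)).
  by rewrite pseries_diffs_coef; apply/cvg_ex; eexists; exact: pseries_comb.
have c3 : cvgn (pseries (pseries_diffs (pseries_diffs (coef z))) (s + 1)).
  have -> : pseries_diffs (pseries_diffs (coef z)) = (fun j =>
    (fun j => (- alpha^-1 * - alpha^-1) * coef (z + alpha - 1 + alpha - 1) j + (- alpha^-1 * ((z + alpha - 1 - 1) / alpha)) * coef (z + alpha - 1 + alpha) j) j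
   + (fun j => ((z - 1) / alpha * - alpha^-1) * coef (z + alpha + alpha - 1) j + ((z - 1) / alpha * ((z + alpha - 1) / alpha)) * coef (z + alpha + alpha) j) j).
    rewrite {1}pseries_diffs_coef; apply/funext => j.
    have h1 := congr1 (fun f => f j) (pseries_diffs_coef (z + alpha - 1)).
    have h2 := congr1 (fun f => f j) (pseries_diffs_coef (z + alpha)).
    rewrite /pseries_diffs /= in h1 h2 *.
    transitivity (- alpha^-1 * (j.+1%:R * coef (z + alpha - 1) j.+1) + (z - 1) / alpha * (j.+1%:R * coef (z + alpha) j.+1)).
      by ring.
    by rewrite h1 h2; ring.
  have l1 := @pseries_comb (- alpha^-1 * - alpha^-1) (- alpha^-1 * ((z + alpha - 1 - 1) / alpha))
    (z + alpha - 1 + alpha - 1) (z + alpha - 1 + alpha) _ s1.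
  have l2 := @pseries_comb ((z - 1) / alpha * - alpha^-1) ((z - 1) / alpha * ((z + alpha - 1) / alpha))
    (z + alpha + alpha - 1) (z + alpha + alpha) _ s1.
  apply/cvg_ex; eexists.
  have -> : forall f g : nat -> R, pseries (fun j => f j + g j) (s + 1) = pseries f (s + 1) \+ pseries g (s + 1).
    move=> f g; apply/funext => n; rewrite /pseries /series /= -big_split /=.
    by apply: eq_bigr => i _; rewrite mulrDl.
  exact: (cvgD l1 l2).
have ss : `|s| < `|s + 1| by rewrite !ger0_norm //; lra.
have {}d1 := d1 c1 c2 c3 ss.
have v : limn (pseries (pseries_diffs (coef z)) s) = (mlf s (z - 1) - (z - 1) * mlf s z) / (alpha * s).
  rewrite pseries_diffs_coef (cvg_lim (@Rhausdorff R) (@pseries_comb _ _ _ _ _ (ltW s0))).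
  have h1 := mlf_step z (ltW s0); have h2 := mlf_step (z - 1) (ltW s0).
  rewrite (rgamma_rec (ltW t0) t2 (z - 1)) subrK in h2.
  have -> : z + alpha - 1 = z - 1 + alpha by ring.
  have -> : mlf s (z - 1) - (z - 1) * mlf s z = s * ((z - 1) * mlf s (z + alpha) - mlf s (z - 1 + alpha)).
    by rewrite h2 h1; ring.
  by field; rewrite !gt_eqF.
rewrite v in d1.
have near_s : \forall y \near s, limn (pseries (coef z) y) = mlf y z.
  near=> y; apply: (cvg_lim (@Rhausdorff R)); apply: pseries_coef.
  by apply: ltW; near: y; exact: lt_nbhsr.
exact: near_eq_is_derive near_s d1.
Unshelve. all: by end_near. Qed.

End MittagLeffler.

(** * Directional derivatives away from the origin *)

Section Space.
Variable R : realType.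
Variable N : nat.
Notation V := 'rV[R]_N.
Implicit Types (x v : V) (f g : V -> R) (d r : R) (i j : 'I_N).

Definition sqnorm x : R := \sum_(i < N) x ord0 i ^+ 2.
Definition basis i : V := delta_mx ord0 i.

Lemma sqnorm_ge0 x : 0 <= sqnorm x.
Proof. by apply: sumr_ge0 => i _; exact: sqr_ge0. Qed.

Lemma sqnorm_gt0 x : x != 0 -> 0 < sqnorm x.
Proof.
move=> x0; rewrite lt_neqAle sqnorm_ge0 andbT eq_sym.
apply: contra x0; rewrite psumr_eq0; last by move=> i _; exact: sqr_ge0.
move=> /allP h; apply/eqP/rowP => i; rewrite mxE.
by have := h i (mem_index_enum i); rewrite /= sqrf_eq0 => /eqP.
Qed.

Lemma enorm_gt0 x : x != 0 -> 0 < enorm x.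
Proof. by move=> x0; rewrite sqrtr_gt0 sqnorm_gt0. Qed.

Lemma enorm_neq0 x : enorm x = 1 -> x != 0.
Proof.
move=> h; apply/eqP => x0; move: h; rewrite x0 /enorm big1; last by move=> i _; rewrite mxE expr0n.
by rewrite sqrtr0 => /esym/eqP; rewrite oner_eq0.
Qed.

Lemma enormZ r x : enorm (r *: x) = `|r| * enorm x.
Proof.
rewrite /enorm -sqrtr_sqr -sqrtrM ?sqr_ge0 // mulr_sumr; congr Num.sqrt.
by apply: eq_bigr => i _; rewrite mxE exprMn.
Qed.

Lemma enorm_normalize x : x != 0 -> enorm ((enorm x)^-1 *: x) = 1.
Proof.
move=> x0; have h := enorm_gt0 x0.
by rewrite enormZ ger0_norm ?invr_ge0 ?ltW // mulVf ?gt_eqF.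
Qed.

Lemma enorm_powR x r : x != 0 -> enorm x `^ r = sqnorm x `^ (r / 2).
Proof. by move=> x0; rewrite /enorm -powR12_sqrt ?sqnorm_ge0 // -powRrM; congr (_ `^ _); ring. Qed.

Lemma coord_le_enorm x i : `|x ord0 i| <= enorm x.
Proof.
rewrite -sqrtr_sqr ler_wsqrtr // (bigD1 i) //= lerDl.
by apply: sumr_ge0 => j _; exact: sqr_ge0.
Qed.

Lemma near_neq0 x : x != 0 -> \forall y \near x, y != 0.
Proof.
move=> x0; have : open [set y : V | y != 0].
  have -> : [set y : V | y != 0] = ~` [set 0].
    by apply/seteqP; split=> y /= /eqP.
  by rewrite openC; apply: accessible_closed_set1; apply: hausdorff_accessible; exact: norm_hausdorff.
by rewrite openE => /(_ x x0).
Qed.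

Lemma is_derive_line f x v d : is_derive x v f d <-> is_derive (0 : R) 1 (fun t : R => f (t *: v + x)) d.
Proof.
have E : (fun h : R => h^-1 *: ((f \o shift x) (h *: v) - f x)) =
    (fun h : R => h^-1 *: (((fun t : R => f (t *: v + x)) \o shift 0) (h *: 1) - f (0 *: v + x))).
  by apply/funext => h /=; rewrite scale0r add0r addr0 [h *: 1]mulr1.
split=> -[h1 h2]; apply: DeriveDef.
- by rewrite /derivable /= -E.
- by rewrite -h2 /derive -E.
- by rewrite /derivable E.
- by rewrite -h2 /derive E.
Qed.

Lemma is_derive_comp_R f (h : R -> R) x v d e : is_derive x v f d -> is_derive (f x) 1 h e ->
  is_derive x v (fun x => h (f x)) (e * d).
Proof.
move=> /is_derive_line hf hh; apply/is_derive_line.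
by apply: (is_derive1_comp (g := fun t => f (t *: v + x))) => //; rewrite scale0r add0r.
Qed.

Lemma partial_is_derive f x i d : is_derive x (basis i) f d -> partial i f x = d.
Proof. by move=> h; rewrite /partial; exact: derive_val. Qed.

Lemma eq_partial f g x i : (forall y, y != 0 -> f y = g y) -> x != 0 -> partial i f x = partial i g x.
Proof.
move=> fg x0; apply: near_eq_derive; near=> y; apply: fg; near: y; exact: near_neq0.
Unshelve. all: by end_near. Qed.

Lemma eq_is_derive f g x v d : (forall y, y != 0 -> f y = g y) -> x != 0 ->
  is_derive x v f d -> is_derive x v g d.
Proof.
move=> fg x0; apply: near_eq_is_derive; near=> y; apply: fg; near: y; exact: near_neq0.
Unshelve. all: by end_near. Qed.

Lemma is_derive_coord x i j : is_derive x (basis i) (fun x : V => x ord0 j) (i == j)%:R.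
Proof.
apply/is_derive_line.
pose c : R := (i == j)%:R; pose e : R := x ord0 j.
have -> : (fun t : R => (t *: basis i + x) ord0 j) = (fun t : R => t * c + e).
  by apply/funext => t; rewrite !mxE eqxx /= eq_sym.
have h := is_deriveD (is_deriveM (is_derive_id (0:R) 1) (is_derive_cst c (0:R) 1)) (is_derive_cst e (0:R) 1).
by apply: (is_derive_eq h); rewrite /GRing.scale /= mul0r add0r addr0 mulr1.
Qed.

Lemma is_derive_sqnorm x i : is_derive x (basis i) sqnorm (2 * x ord0 i).
Proof.
have -> : sqnorm = \sum_(j < N) (fun x : V => x ord0 j ^+ 2).
  by apply/funext => y; rewrite fct_sumE.
have h j : is_derive x (basis i) (fun x : V => x ord0 j ^+ 2) (2 * x ord0 j * (i == j)%:R).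
  by have := is_deriveX 2 (is_derive_coord x i j); rewrite /GRing.scale /= expr1; exact.
apply: (is_derive_eq (is_derive_sum h)).
rewrite (bigD1 i) //= eqxx mulr1 big1 ?addr0 // => j ji.
by rewrite eq_sym (negbTE ji) mulr0.
Qed.

Lemma continuous_sqnorm : continuous sqnorm.
Proof.
have -> : sqnorm = \sum_(j < N) (fun x : V => x ord0 j ^+ 2).
  by apply/funext => y; rewrite fct_sumE.
apply: (big_ind (fun f : V -> R => continuous f)).
- by move=> x; apply: cst_continuous.
- by move=> f g cf cg x; exact: (continuousD (cf x) (cg x)).
- move=> i _ x; apply: (@continuous_comp _ _ _ (fun x : V => x ord0 i) (fun r : R => r ^+ 2)).
    exact: coord_continuous.
  exact: exprn_continuous.
Qed.

Lemma compact_sphere : compact [set x : V | enorm x = 1].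
Proof.
apply: bounded_closed_compact.
- exists 1; split; first exact: num_real.
  move=> M M1 x /= x1; rewrite (le_trans _ (ltW M1)) //.
  rewrite -[`|x|]/(mx_norm x) mx_normrE; apply: bigmax_le => // -[a j] _ /=.
  by rewrite (ord1 a) -x1; exact: coord_le_enorm.
- have -> : [set x : V | enorm x = 1] = sqnorm @^-1` [set r | r = 1].
    apply/seteqP; split=> x /= h.
      by rewrite -(sqr_sqrtr (sqnorm_ge0 x)) -/(enorm x) h expr1n.
    by rewrite /enorm -/(sqnorm x) h sqrtr1.
  apply: preimage_closed; last exact: closed_eq.
  by move=> x _; exact: continuous_sqnorm.
Qed.

Definition homogeneous d f := forall r x, 0 < r -> x != 0 -> f (r *: x) = r `^ d * f x.

Lemma homogeneous_partial d f i : homogeneous d f -> (forall x, x != 0 -> derivable f x (basis i)) ->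
  homogeneous (d - 1) (partial i f).
Proof.
move=> hf df r x r0 x0.
have y0 : r *: x != 0 by rewrite scaler_eq0 negb_or gt_eqF //= x0.
have h1 : is_derive (r *: x) (basis i) f (partial i f (r *: x)) by apply: DeriveDef; [exact: df|].
have h2 : is_derive x (basis i) f (partial i f x) by apply: DeriveDef; [exact: df|].
have h3 : is_derive x (basis i) (fun x => f (r *: x)) (partial i f (r *: x) * r).
  move/is_derive_line: h1 => h1; apply/is_derive_line.
  have -> : (fun t : R => f (r *: (t *: basis i + x))) = (fun t => f (t *: basis i + r *: x)) \o (fun t => r * t).
    by apply/funext => t /=; rewrite scalerDr scalerA.
  have l : is_derive (0 : R) 1 (fun t : R => r * t) r.
    by apply: is_derive_eq; rewrite /GRing.scale /= mulr1.
  by apply: is_derive1_comp => //; rewrite mulr0.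
have h4 : is_derive x (basis i) (fun x => f (r *: x)) (r `^ d * partial i f x).
  apply: (@eq_is_derive (fun x => r `^ d * f x)) => //.
    by move=> y y0'; rewrite hf.
have e : partial i f (r *: x) * r = r `^ d * partial i f x.
  by have e3 := @derive_val _ _ _ _ _ _ _ h3; have e4 := @derive_val _ _ _ _ _ _ _ h4; rewrite -e3 -e4.
rewrite powRD; last by rewrite (gt_eqF r0) implybT.
rewrite powR_inv1 ?ltW // mulrAC -e mulfK // gt_eqF //.
Qed.

End Space.

(** * Homogeneous symbols *)

Section Symbols.
Variable R : realType.
Variable N : nat.
Notation V := 'rV[R]_N.
Implicit Types (x v : V) (f g : V -> R) (d r : R) (i j : 'I_N).
Variable k0 : R.
Variable sigma0 : V -> R.
Hypothesis smooth0 : smooth_off0 sigma0.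
Hypothesis pos0 : forall x, x != 0 -> 0 < sigma0 x.
Hypothesis hom0 : homogeneous_off0 k0 sigma0.

(** The factors that differentiation brings out and that depend neither on [k] nor on [delta], with
    their degree of homogeneity. The list is chosen so as to be closed under partial derivatives up
    to equality away from the origin. *)
Inductive symbol : R -> (V -> R) -> Prop :=
| symbol_cst c : symbol 0 (fun=> c)
| symbol_coord j : symbol 1 (fun x => x ord0 j)
| symbol_inv_sqnorm : symbol (-2) (fun x => (sqnorm x)^-1)
| symbol_partials s : symbol (k0 - (size s)%:R) (foldr (@partial R N) sigma0 s)
| symbol_inv_sigma : symbol (- k0) (fun x => (sigma0 x)^-1)
| symbol_mul d e f g : symbol d f -> symbol e g -> symbol (d + e) (fun x => f x * g x)
| symbol_add d f g : symbol d f -> symbol d g -> symbol d (fun x => f x + g x).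

Lemma symbol_degree d e f : symbol d f -> d = e -> symbol e f.
Proof. by move=> h <-. Qed.

Lemma symbol_scale d c f : symbol d f -> symbol d (fun x => c * f x).
Proof. by move=> h; apply: symbol_degree (symbol_mul (symbol_cst c) h) _; rewrite add0r. Qed.

Lemma symbol_continuous d f : symbol d f -> forall x, x != 0 -> {for x, continuous f}.
Proof.
elim=> {d f}.
- by move=> c x _; apply: cst_continuous.
- by move=> j x _; exact: coord_continuous.
- move=> x x0; apply: (@continuous_comp _ _ _ (@sqnorm R N) GRing.inv); first exact: continuous_sqnorm.
  by apply: inv_continuous; rewrite gt_eqF ?sqnorm_gt0.
- by move=> s x x0; case: (smooth0 s x0).
- move=> x x0; apply: (@continuous_comp _ _ _ sigma0 GRing.inv); first by case: (smooth0 [::] x0).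
  by apply: inv_continuous; rewrite gt_eqF ?pos0.
- by move=> d e f g _ hf _ hg x x0; apply: continuousM; [exact: hf|exact: hg].
- by move=> d f g _ hf _ hg x x0; apply: continuousD; [exact: hf|exact: hg].
Qed.

Lemma partials_derive s x i : x != 0 ->
  is_derive x (basis R i) (foldr (@partial R N) sigma0 s) (foldr (@partial R N) sigma0 (i :: s) x).
Proof. by move=> x0; apply: DeriveDef; [case: (smooth0 s x0) => _; exact|]. Qed.

Lemma homogeneous_partials s : homogeneous (k0 - (size s)%:R) (foldr (@partial R N) sigma0 s).
Proof.
elim: s => [|i s IH] /=.
  by rewrite subr0 => r x; exact: hom0.
have -> : k0 - (size s).+1%:R = k0 - (size s)%:R - 1 by rewrite -natr1; ring.
by apply: homogeneous_partial IH _ => x x0; have [_ h] := smooth0 s x0; exact: h.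
Qed.

Lemma symbol_homogeneous d f : symbol d f -> homogeneous d f.
Proof.
elim=> {d f}.
- by move=> c r x r0 _; rewrite powRr0 mul1r.
- by move=> j r x r0 _; rewrite mxE powRr1 // ltW.
- move=> r x r0 x0.
  have -> : sqnorm (r *: x) = r ^+ 2 * sqnorm x.
    by rewrite /sqnorm mulr_sumr; apply: eq_bigr => j _; rewrite mxE exprMn.
  by rewrite invfM powRN powR_mulrn // ltW.
- exact: homogeneous_partials.
- by move=> r x r0 x0; rewrite hom0 // invfM powRN.
- move=> d e f g _ hf _ hg r x r0 x0.
  by rewrite hf // hg // powRD; [ring|rewrite (gt_eqF r0) implybT].
- by move=> d f g _ hf _ hg r x r0 x0; rewrite hf // hg // mulrDr.
Qed.

Lemma symbol_derive d f : symbol d f -> forall i, exists2 f', symbol (d - 1) f' &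
  forall x, x != 0 -> is_derive x (basis R i) f (f' x).
Proof.
elim=> {d f}.
- move=> c i; exists (fun x => 0 * (x ord0 i * (sqnorm x)^-1)).
    apply: symbol_degree (symbol_scale 0 (symbol_mul (symbol_coord i) symbol_inv_sqnorm)) _; ring.
  by move=> x _; rewrite mul0r; exact: is_derive_cst.
- move=> j i; exists (fun=> (i == j)%:R); first by rewrite subrr; exact: symbol_cst.
  by move=> x _; exact: is_derive_coord.
- move=> i; exists (fun x => - 2 * (x ord0 i * ((sqnorm x)^-1 * (sqnorm x)^-1))).
    apply: symbol_degree (symbol_scale _ (symbol_mul (symbol_coord i) (symbol_mul symbol_inv_sqnorm symbol_inv_sqnorm))) _; ring.
  move=> x x0; have S0 : sqnorm x != 0 by rewrite gt_eqF ?sqnorm_gt0.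
  have := is_derive_comp_R (is_derive_sqnorm x i) (is_deriveV (f := id) S0 (is_derive_id (sqnorm x) 1)).
  by move=> h; apply: (is_derive_eq h); rewrite /GRing.scale /=; field.
- move=> s i; exists (foldr (@partial R N) sigma0 (i :: s)).
    by apply: symbol_degree (symbol_partials (i :: s)) _; rewrite /= -natr1; ring.
  by move=> x x0; exact: partials_derive.
- move=> i; exists (fun x => - 1 * (foldr (@partial R N) sigma0 [:: i] x * ((sigma0 x)^-1 * (sigma0 x)^-1))).
    apply: symbol_degree (symbol_scale _ (symbol_mul (symbol_partials [:: i]) (symbol_mul symbol_inv_sigma symbol_inv_sigma))) _.
    by rewrite /=; ring.
  move=> x x0; have S0 : sigma0 x != 0 by rewrite gt_eqF ?pos0.
  have := is_derive_comp_R (partials_derive [::] i x0) (is_deriveV (f := id) S0 (is_derive_id (sigma0 x) 1)).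
  by move=> h; apply: (is_derive_eq h); rewrite /GRing.scale /=; field.
- move=> d e f g sf hf sg hg i; have [f' sf' df] := hf i; have [g' sg' dg] := hg i.
  exists (fun x => f x * g' x + g x * f' x).
    apply: symbol_add; first by apply: symbol_degree (symbol_mul sf sg') _; ring.
    by apply: symbol_degree (symbol_mul sg sf') _; ring.
  by move=> x x0; exact: (is_deriveM (df x x0) (dg x x0)).
- move=> d f g sf hf sg hg i; have [f' sf' df] := hf i; have [g' sg' dg] := hg i.
  exists (fun x => f' x + g' x); first exact: symbol_add.
  by move=> x x0; exact: (is_deriveD (df x x0) (dg x x0)).
Qed.

(** By homogeneity it is enough to bound [f] on the unit sphere, which is compact. *)
Lemma symbol_bound d f : symbol d f -> exists K, forall x, x != 0 -> `|f x| <= K * enorm x `^ d.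
Proof.
move=> sf.
have [K hK] : exists K, forall x, enorm x = 1 -> `|f x| <= K.
  have [[e e1]|ns] := pselect (exists x : V, enorm x = 1); last first.
    by exists 0 => x x1; exfalso; apply: ns; exists x.
  have cf : {within [set x : V | enorm x = 1], continuous (fun x => `|f x|)}.
    apply: continuous_in_subspaceT => x /set_mem /= /enorm_neq0 x0.
    apply: (@continuous_comp _ _ _ f (fun r : R => `|r|)); last exact: norm_continuous.
    exact: symbol_continuous sf x x0.
  have [c _ hc] := compact_EVT_max (ex_intro _ e e1 : [set x : V | enorm x = 1] !=set0) (@compact_sphere R N) cf.
  by exists (`|f c|) => x x1; apply: hc; exact/mem_set.
exists K => x x0; have n0 := enorm_gt0 x0.
have -> : x = enorm x *: ((enorm x)^-1 *: x) by rewrite scalerA mulfV ?scale1r // gt_eqF.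
have u1 := enorm_normalize x0.
rewrite (symbol_homogeneous sf n0 (enorm_neq0 u1)) normrM (ger0_norm (powR_ge0 _ _)).
rewrite enormZ u1 mulr1 (ger0_norm (ltW n0)) mulrC ler_wpM2r ?powR_ge0 //.
exact: hK.
Qed.

End Symbols.

(** * Derivatives of the multiplier *)

Section Amplitudes.
Variable R : realType.
Variable N : nat.
Notation V := 'rV[R]_N.
Implicit Types (x v : V) (f g sigma : V -> R) (d r k delta z : R) (i j : 'I_N).
Variable alpha : R.
Hypothesis alpha12 : 1 < alpha < 2.
Variable k0 : R.
Variable sigma0 : V -> R.
Hypothesis smooth0 : smooth_off0 sigma0.
Hypothesis pos0 : forall x, x != 0 -> 0 < sigma0 x.
Hypothesis hom0 : homogeneous_off0 k0 sigma0.

Let sym := symbol k0 sigma0.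

(** The logarithmic derivative of the Euclidean norm. *)
Definition radial i x : R := x ord0 i * (sqnorm x)^-1.
(** The logarithmic derivative of [sigma0 |x|^(- k0)], a function of degree 0. *)
Definition log_slope i x : R := partial i sigma0 x * (sigma0 x)^-1 + - k0 * radial i x.

Lemma symbol_radial i : sym (-1) (radial i).
Proof. by apply: symbol_degree (symbol_mul (symbol_coord _ _ i) (symbol_inv_sqnorm _ _)) _; ring. Qed.

Lemma symbol_log_slope i : sym (-1) (log_slope i).
Proof.
apply: symbol_add; last by apply: symbol_scale; exact: symbol_radial.
by apply: symbol_degree (symbol_mul (symbol_partials k0 sigma0 [:: i]) (symbol_inv_sigma _ _)) _; rewrite /=; ring.
Qed.

Lemma is_derive_enorm_powR r x i : x != 0 ->
  is_derive x (basis R i) (fun x => enorm x `^ r) (r * radial i x * enorm x `^ r).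
Proof.
move=> x0; have S0 := sqnorm_gt0 x0.
have := is_derive_comp_R (is_derive_sqnorm x i) (is_derive1_powR (r / 2) S0) => h.
apply: (@eq_is_derive _ _ (fun x => sqnorm x `^ (r / 2))) => //.
  by move=> y y0; rewrite enorm_powR.
apply: (is_derive_eq h).
rewrite enorm_powR // powRB; last by rewrite (gt_eqF S0) implybT.
by rewrite powRr1 ?ltW // /radial; field; rewrite gt_eqF.
Qed.

(** Two homogeneous functions that agree on the unit sphere differ by a power of the norm, so that a
    single reference [sigma0] describes all the [sigma] at hand. *)
Definition compatible k delta sigma := [/\ 0 < k, 0 <= delta <= k &
  forall x, x != 0 -> sigma x = enorm x `^ (k - k0) * sigma0 x].

Lemma is_derive_compatible k delta sigma x i : compatible k delta sigma -> x != 0 ->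
  is_derive x (basis R i) sigma (sigma x * (k * radial i x + log_slope i x)).
Proof.
move=> [_ _ sE] x0.
apply: (@eq_is_derive _ _ (fun x => enorm x `^ (k - k0) * sigma0 x)) => //.
  by move=> y y0; rewrite sE.
have h := is_deriveM (is_derive_enorm_powR (k - k0) i x0) (partials_derive smooth0 [::] i x0).
apply: (is_derive_eq h); rewrite sE // /log_slope /GRing.scale /=.
by field; rewrite gt_eqF ?pos0.
Qed.

(** What [n] derivatives of the multiplier look like. The parameters [k] and [delta] are separated
    from the symbol [phi], which makes the growth [(1 + k)^n] of the coefficients visible. *)
Inductive amplitude (n : nat) : (R -> R -> (V -> R) -> V -> R) -> Prop :=
| amplitude_term c C phi z :
    (forall k delta, 0 < k -> 0 <= delta <= k -> `|c k delta| <= C * (1 + k) ^+ n) ->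
    sym (- n%:R) phi ->
    amplitude n (fun k delta sigma x => c k delta * phi x * (enorm x `^ delta * mlf alpha (sigma x) z))
| amplitude_add F G : amplitude n F -> amplitude n G ->
    amplitude n (fun k delta sigma x => F k delta sigma x + G k delta sigma x).

(** The derivative of the Mittag-Leffler factor comes out as
    [(E_(z - 1) - (z - 1) E_z) / alpha] times the logarithmic derivative
    [k radial + log_slope] of [sigma]. Each derivative thus costs at most one factor [1 + k] and
    lowers the degree of the symbol by 1. *)
Lemma amplitude_derive n F : amplitude n F -> forall i, exists2 F', amplitude n.+1 F' &
  forall k delta sigma, compatible k delta sigma -> forall x, x != 0 ->
    is_derive x (basis R i) (F k delta sigma) (F' k delta sigma x).
Proof.
have a0 : 0 < alpha by case/andP: alpha12 => h _; lra.
elim=> {F} [c C phi z cC sphi i|F G _ hF _ hG i]; last first.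
  have [F' aF dF] := hF i; have [G' aG dG] := hG i.
  exists (fun k delta sigma x => F' k delta sigma x + G' k delta sigma x); first exact: amplitude_add.
  move=> k delta sigma hc x x0; exact: (is_deriveD (dF k delta sigma hc x x0) (dG k delta sigma hc x x0)).
have [phi' sphi' dphi] := symbol_derive smooth0 pos0 sphi i.
have coef (m : R -> R -> R) D : 0 <= D -> (forall k delta, 0 < k -> 0 <= delta <= k -> `|m k delta| <= D * (1 + k)) ->
    forall k delta, 0 < k -> 0 <= delta <= k -> `|c k delta * m k delta| <= (C * D) * (1 + k) ^+ n.+1.
  move=> D0 hm k delta k1 dk; rewrite normrM exprS.
  have -> : C * D * ((1 + k) * (1 + k) ^+ n) = (C * (1 + k) ^+ n) * (D * (1 + k)) by ring.
  by apply: ler_pM => //; [exact: cC|exact: hm].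
have const (m D : R) : `|m| <= D -> forall k delta : R, 0 < k -> 0 <= delta <= k -> `|m| <= D * (1 + k).
  move=> mD k delta k1 _; apply: (le_trans mD).
  by rewrite ler_peMr ?lerDl ?(ltW k1) // (le_trans _ mD).
have s1 : sym (- n.+1%:R) phi' by apply: symbol_degree sphi' _; rewrite -natr1; ring.
have s2 : sym (- n.+1%:R) (fun x => phi x * radial i x).
  by apply: symbol_degree (symbol_mul sphi (symbol_radial i)) _; rewrite -natr1; ring.
have s3 : sym (- n.+1%:R) (fun x => phi x * log_slope i x).
  by apply: symbol_degree (symbol_mul sphi (symbol_log_slope i)) _; rewrite -natr1; ring.
pose A := `|z - 1| / alpha.
have A0 : 0 <= A by rewrite divr_ge0 // ltW.
have c1 := coef (fun _ _ => 1) 1 ler01 (const 1 1 (eq_ind_r (fun t => t <= 1) (lexx 1) (normr1 R))).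
have c2 : forall k delta, 0 < k -> 0 <= delta <= k ->
    `|c k delta * (delta - (z - 1) * k / alpha)| <= (C * (1 + A)) * (1 + k) ^+ n.+1.
  apply: coef; first by rewrite addr_ge0.
  move=> k delta k1 /andP[d0 dk]; apply: le_trans (ler_normB _ _) _.
  have -> : `|(z - 1) * k / alpha| = A * k.
    by rewrite !normrM normfV (gtr0_norm a0) (gtr0_norm k1) /A mulrAC.
  rewrite (ger0_norm d0); have : 0 <= A * k by rewrite mulr_ge0 // ltW.
  nra.
have c3 : forall k delta, 0 < k -> 0 <= delta <= k ->
    `|c k delta * (k / alpha)| <= (C * alpha^-1) * (1 + k) ^+ n.+1.
  apply: coef; first by rewrite invr_ge0 ltW.
  move=> k delta k1 _; rewrite ger0_norm; last by rewrite divr_ge0 // ltW.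
  by rewrite mulrC ler_pM2l ?invr_gt0 // lerDr.
have c4 := coef (fun _ _ => alpha^-1) alpha^-1 (ltW (etrans (invr_gt0 _) a0))
  (const alpha^-1 alpha^-1 (eq_ind_r (fun t => t <= alpha^-1) (lexx _) (ger0_norm (ltW (etrans (invr_gt0 _) a0))))).
have c5 := coef (fun _ _ => - ((z - 1) / alpha)) `|- ((z - 1) / alpha)| (normr_ge0 _) (const _ _ (lexx _)).
exists (fun k delta sigma x => c k delta * 1 * phi' x * (enorm x `^ delta * mlf alpha (sigma x) z)
  + (c k delta * (delta - (z - 1) * k / alpha) * (phi x * radial i x) * (enorm x `^ delta * mlf alpha (sigma x) z)
  + (c k delta * (k / alpha) * (phi x * radial i x) * (enorm x `^ delta * mlf alpha (sigma x) (z - 1))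
  + (c k delta * alpha^-1 * (phi x * log_slope i x) * (enorm x `^ delta * mlf alpha (sigma x) (z - 1))
  + c k delta * (- ((z - 1) / alpha)) * (phi x * log_slope i x) * (enorm x `^ delta * mlf alpha (sigma x) z))))).
  apply: amplitude_add; first exact: (amplitude_term (c := fun k delta => c k delta * 1) z c1 s1).
  apply: amplitude_add; first exact: (amplitude_term (c := fun k delta => c k delta * (delta - (z - 1) * k / alpha)) z c2 s2).
  apply: amplitude_add; first exact: (amplitude_term (c := fun k delta => c k delta * (k / alpha)) (z - 1) c3 s2).
  apply: amplitude_add; first exact: (amplitude_term (c := fun k delta => c k delta * alpha^-1) (z - 1) c4 s3).
  exact: (amplitude_term (c := fun k delta => c k delta * (- ((z - 1) / alpha))) z c5 s3).
move=> k delta sigma hc x x0; have [k1 dk sE] := hc.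
have sx : 0 < sigma x by rewrite sE // mulr_gt0 ?powR_gt0 ?enorm_gt0 ?pos0.
have h1 := is_derive_comp_R (is_derive_compatible i hc x0) (is_derive_mlf alpha12 z sx).
have h2 := is_deriveM (is_derive_enorm_powR delta i x0) h1.
have h3 := is_deriveM (is_deriveZ (c k delta) (dphi x x0)) h2.
apply: (is_derive_eq h3); rewrite /GRing.scale /=.
rewrite -[((fun y => enorm y `^ delta) * _) x]/(enorm x `^ delta * mlf alpha (sigma x) z).
rewrite -[c k delta *: phi x]/(c k delta * phi x).
by field; rewrite !gt_eqF.
Qed.

(** Where [|x| <= 1] the factor [|x|^delta] is at most 1; where [|x| >= 1] it is at most [|x|^k], which
    the decay of the Mittag-Leffler function in [sigma] absorbs. *)
Lemma amplitude_bound n F : amplitude n F -> exists C, forall k delta sigma, compatible k delta sigma ->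
  forall x, x != 0 -> `|F k delta sigma x| <= C * (1 + k) ^+ n * enorm x `^ (- n%:R).
Proof.
elim=> {F} [c C phi z cC sphi|F G _ [C1 h1] _ [C2 h2]]; last first.
  exists (C1 + C2) => k delta sigma hc x x0; apply: le_trans (ler_normD _ _) _.
  by rewrite !mulrDl lerD ?h1 ?h2.
have [K1 hK1] := symbol_bound smooth0 pos0 hom0 sphi.
have [K2 hK2] := symbol_bound smooth0 pos0 hom0 (symbol_inv_sigma k0 sigma0).
have [D hD] := mlf_bound alpha12 z.
pose K : R := `|K2|.
exists (C * K1 * (`|D| * (1 + K))) => k delta sigma hc x x0; have [k1 dk sE] := hc.
have n0 := enorm_gt0 x0; have /andP[d0 dk1] := dk.
have sx : 0 < sigma x by rewrite sE // mulr_gt0 ?powR_gt0 ?pos0.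
have decay : enorm x `^ delta <= (1 + K) * (1 + sigma x).
  have [x1|x1] := leP (enorm x) 1.
    have h : enorm x `^ delta <= 1.
      have one : 1 `^ delta = 1 :> R by rewrite powR1.
      by rewrite -[leRHS]one ge0_ler_powR // nnegrE ltW.
    apply: (le_trans h); have : 0 <= K by exact: normr_ge0.
    nra.
  have h1 : enorm x `^ delta <= enorm x `^ k by apply: ler_powR => //; exact: ltW.
  have h2 : enorm x `^ k <= K * sigma x.
    have p0 : 0 < enorm x `^ (- k0) by exact: powR_gt0.
    have -> : enorm x `^ k = enorm x `^ (k - k0) / enorm x `^ (- k0).
      rewrite powRN invrK -powRD ?subrK //; by rewrite (gt_eqF n0) implybT.
    rewrite sE // mulrCA ler_pM2l ?powR_gt0 // -ler_pdivrMr ?pos0 // mulrC.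
    rewrite ler_pdivrMr // -[leLHS](ger0_norm (ltW (etrans (invr_gt0 _) (pos0 x0)))).
    apply: le_trans (hK2 x x0) _; rewrite ler_pM2r //; exact: ler_norm.
  apply: (le_trans h1); apply: (le_trans h2).
  have : 0 <= K by exact: normr_ge0.
  nra.
have tail : enorm x `^ delta * `|mlf alpha (sigma x) z| <= `|D| * (1 + K).
  have s1 : 0 < 1 + sigma x by rewrite addr_gt0.
  have hDx : `|mlf alpha (sigma x) z| <= `|D| / (1 + sigma x).
    by apply: le_trans (hD _ (ltW sx)) _; rewrite ler_pM2r ?invr_gt0 // ler_norm.
  apply: (@le_trans _ _ ((1 + K) * (1 + sigma x) * (`|D| / (1 + sigma x)))).
    by apply: ler_pM; rewrite ?powR_ge0 ?normr_ge0.
  by rewrite le_eqVlt; apply/orP; left; apply/eqP; field; rewrite gt_eqF.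
rewrite normrM (normrM (c k delta)) (normrM (enorm x `^ delta)) (ger0_norm (powR_ge0 (enorm x) _)).
have -> : C * K1 * (`|D| * (1 + K)) * (1 + k) ^+ n * enorm x `^ (- n%:R) =
  (C * (1 + k) ^+ n) * (K1 * enorm x `^ (- n%:R)) * (`|D| * (1 + K)) by ring.
apply: ler_pM; rewrite ?mulr_ge0 ?powR_ge0 ?normr_ge0 //.
  by apply: ler_pM; rewrite ?normr_ge0 //; [exact: cC|exact: hK1].
Qed.

Lemma amplitude_partials z s : exists2 F, amplitude (size s) F &
  forall k delta sigma, compatible k delta sigma -> forall x, x != 0 ->
    foldr (@partial R N) (fun x => enorm x `^ delta * mlf alpha (sigma x) z) s x = F k delta sigma x.
Proof.
elim: s => [|i s [F aF hF]].
  exists (fun k delta sigma x => 1 * 1 * (enorm x `^ delta * mlf alpha (sigma x) z)).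
    apply: (@amplitude_term 0 (fun _ _ => 1) 1 (fun=> 1)).
      by move=> k delta _ _; rewrite normr1 expr0 mulr1.
    by rewrite oppr0; exact: symbol_cst.
  by move=> k delta sigma _ x _ /=; rewrite !mul1r.
have [F' aF' dF] := amplitude_derive aF i.
exists F' => // k delta sigma hc x x0 /=.
rewrite (@eq_partial _ _ _ (F k delta sigma)) //; last exact: hF hc.
apply: partial_is_derive; exact: dF.
Qed.

Lemma partials_bound z s : exists C, forall k delta sigma, compatible k delta sigma -> forall x, x != 0 ->
  `|foldr (@partial R N) (fun x => enorm x `^ delta * mlf alpha (sigma x) z) s x|
    <= C * (1 + k) ^+ size s * enorm x `^ (- (size s)%:R).
Proof.
have [F aF hF] := amplitude_partials z s.
have [C hC] := amplitude_bound aF.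
by exists C => k delta sigma hc x x0; rewrite (hF _ _ _ hc) //; exact: hC.
Qed.

End Amplitudes.

(** * The constant [A] controls the degree *)

Section LowerBound.
Variable R : realType.
Variable N : nat.
Notation V := 'rV[R]_N.
Implicit Types (x v : V) (f g sigma : V -> R) (d r k delta z : R) (i j : 'I_N).

Definition multiplicity_list (g : 'I_N -> nat) (s : seq 'I_N) : seq 'I_N :=
  flatten [seq nseq (g i) i | i <- s].

Lemma foldr_nseq (f : V -> R) m i : foldr (@partial R N) f (nseq m i) = iter m (partial i) f.
Proof. by elim: m => //= m ->. Qed.

Lemma mpartial_foldr (g : 'I_N -> nat) (f : V -> R) :
  mpartial g f = foldr (@partial R N) f (multiplicity_list g (enum 'I_N)).
Proof.
rewrite /mpartial /multiplicity_list; elim: (enum 'I_N) => //= i s ->.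
by rewrite foldr_cat foldr_nseq.
Qed.

Lemma size_multiplicity_list (g : 'I_N -> nat) : size (multiplicity_list g (enum 'I_N)) = mlen g.
Proof.
rewrite /multiplicity_list /mlen size_flatten /shape -map_comp sumnE big_map -big_enum /=.
by apply: eq_bigr => i _; rewrite /= size_nseq.
Qed.

Lemma multiplicity_list_single i0 m :
  multiplicity_list (fun i => if i == i0 then m else 0%N) (enum 'I_N) = nseq m i0.
Proof.
rewrite /multiplicity_list.
have none (s : seq 'I_N) : i0 \notin s -> flatten [seq nseq (if i == i0 then m else 0%N) i | i <- s] = [::].
  elim: s => //= i s IH; rewrite inE negb_or => /andP[ii /IH ->].
  by rewrite eq_sym (negbTE ii).
have : uniq (enum 'I_N) := enum_uniq _.
have : i0 \in enum 'I_N by rewrite mem_enum.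
elim: (enum 'I_N) => //= i s IH; rewrite inE => /orP[/eqP <-|i0s] /andP[us u].
  by rewrite eqxx none // cats0.
case: eqP => [e|_]; last exact: IH.
by move: us; rewrite e i0s.
Qed.

Lemma mlen_single i0 m : mlen (fun i => if i == i0 then m else 0%N) = m.
Proof. by rewrite -size_multiplicity_list multiplicity_list_single size_nseq. Qed.

Lemma mpartial_single i0 m (f : V -> R) :
  mpartial (fun i => if i == i0 then m else 0%N) f = iter m (partial i0) f.
Proof. by rewrite mpartial_foldr multiplicity_list_single foldr_nseq. Qed.

Lemma basis_neq0 i : basis R i != 0.
Proof. by apply/eqP => /rowP /(_ i); rewrite !mxE !eqxx => /eqP; rewrite oner_eq0. Qed.

Lemma enorm_basis i : enorm (basis R i) = 1.
Proof.
rewrite /enorm (bigD1 i) //= !mxE !eqxx expr1n big1 ?addr0 ?sqrtr1 // => j ji.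
by rewrite mxE eqxx /= (negbTE ji) expr0n.
Qed.

Definition falling_factorial k m : R := \prod_(j < m) (k - j%:R).

(** Along the ray through a basis vector a homogeneous function is a pure power. *)
Lemma iter_partial_ray k sigma i m t : homogeneous_off0 k sigma -> 0 < t ->
  iter m (partial i) sigma (t *: basis R i) = falling_factorial k m * t `^ (k - m%:R) * sigma (basis R i).
Proof.
move=> hs; elim: m t => [|m IH] t t0.
  by rewrite /= /falling_factorial big_ord0 mul1r subr0 hs // basis_neq0.
rewrite iterS; apply: partial_is_derive; apply/is_derive_line.
pose c := falling_factorial k m; pose b := sigma (basis R i).
have h1 : is_derive t 1 (fun u : R => c * u `^ (k - m%:R) * b) (falling_factorial k m.+1 * t `^ (k - m.+1%:R) * b).
  have h := is_deriveM (is_deriveZ c (is_derive1_powR (k - m%:R) t0)) (is_derive_cst b t 1).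
  apply: (is_derive_eq h); rewrite /GRing.scale /= mulr0 add0r /falling_factorial big_ord_recr /= -/(falling_factorial k m) -/c.
  by rewrite -natr1 opprD addrA; ring.
have h2 : is_derive (0 : R) 1 (fun u : R => c * (u + t) `^ (k - m%:R) * b) (falling_factorial k m.+1 * t `^ (k - m.+1%:R) * b).
  have l : is_derive (0 : R) 1 (fun u : R => u + t) 1.
    by apply: is_derive_eq; rewrite addr0.
  apply: (is_derive_eq (is_derive1_comp (f := fun u : R => c * u `^ (k - m%:R) * b) (g := fun u : R => u + t) _ l)).
    by rewrite add0r; exact: h1.
  by rewrite mulr1.
apply: near_eq_is_derive h2; near=> u.
rewrite -scalerDl IH //; rewrite -ltrBlDr sub0r; near: u.
by apply: lt_nbhsr; rewrite oppr_lt0.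
Unshelve. all: by end_near. Qed.

Lemma falling_factorial_ge k m : (2 * m)%:R <= k -> 1 <= k -> ((1 + k) / 4) ^+ m <= falling_factorial k m.
Proof.
move=> mk k1; rewrite -[m in leLHS]card_ord -prodr_const; apply: ler_prod => j _.
apply/andP; split; first by rewrite divr_ge0 // addr_ge0 // (le_trans ler01).
have : (j%:R : R) <= m%:R by rewrite ler_nat ltnW.
rewrite natrM in mk; lra.
Qed.

(** At a basis vector the pure derivative of order [m] is [k (k - 1) ... (k - m + 1) sigma], of order
    [k^m] for [k >= 2 m]; for smaller [k] the bound on [sigma] itself is enough. *)
Lemma derivative_bound_lower sigma k A m i : homogeneous_off0 k sigma -> 0 < k -> (0 < m)%N ->
  0 < sigma (basis R i) ->
  (forall g : 'I_N -> nat, (mlen g <= m)%N -> forall x, x != 0 ->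
     `|mpartial g sigma x| <= A * enorm x `^ (k - (mlen g)%:R)) ->
  (1 + k) ^+ m <= ((4 ^+ m + (1 + (2 * m)%:R) ^+ m) / sigma (basis R i)) * A.
Proof.
move=> hs k0 m0 b0 hA.
have h n : (n <= m)%N -> `|falling_factorial k n| * sigma (basis R i) <= A.
  move=> nm; have := hA (fun j => if j == i then n else 0%N); rewrite mlen_single => /(_ nm _ (basis_neq0 i)).
  rewrite mpartial_single -[X in iter _ _ _ X]scale1r (iter_partial_ray i n hs ltr01) powR1 mulr1 enorm_basis powR1 mulr1.
  by rewrite normrM (gtr0_norm b0).
have hA0 : sigma (basis R i) <= A.
  by have := h 0%N (leq0n _); rewrite /falling_factorial big_ord0 normr1 mul1r.
have A0 : 0 <= A by apply: le_trans (ltW b0) hA0.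
rewrite mulrAC ler_pdivlMr //.
have [k1|k1] := leP (2 * m)%:R k.
  have k2 : 1 <= k by apply: le_trans k1; rewrite ler1n muln_gt0.
  have := falling_factorial_ge k1 k2; rewrite exprMn exprVn ler_pdivrMr ?exprn_gt0 // => f1.
  have f2 : falling_factorial k m * sigma (basis R i) <= A.
    by apply: le_trans (h m (leqnn _)); rewrite ler_pM2r // ler_norm.
  have f3 : (1 + k) ^+ m * sigma (basis R i) <= falling_factorial k m * 4 ^+ m * sigma (basis R i).
    by rewrite ler_pM2r.
  have f4 : falling_factorial k m * sigma (basis R i) * 4 ^+ m <= A * 4 ^+ m.
    by rewrite ler_pM2r // exprn_gt0.
  have f5 : 0 <= (1 + (2 * m)%:R) ^+ m * A.
    by rewrite mulr_ge0 // exprn_ge0 // addr_ge0.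
  lra.
have f1 : (1 + k) ^+ m <= (1 + (2 * m)%:R) ^+ m.
  by rewrite lerXn2r ?nnegrE ?addr_ge0 ?(ltW k0) // lerD2l ltW.
have f2 : (1 + k) ^+ m * sigma (basis R i) <= (1 + (2 * m)%:R) ^+ m * A.
  by apply: ler_pM => //; [rewrite exprn_ge0 // addr_ge0 // ltW|exact: ltW].
have f3 : 0 <= 4 ^+ m * A by rewrite mulr_ge0 // exprn_ge0.
lra.
Qed.

End LowerBound.

Theorem proposition4p3 (R : realType) (N : nat) (hN : (0 < N)%N)
  (alpha beta : R) (halpha : 1 < alpha < 2) (hbeta : 0 < beta)
  (omega : 'rV[R]_N -> R) :
  exists C : R, 0 < C /\
    forall (k delta A : R) (sigma : 'rV[R]_N -> R),
      0 < k ->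
      (forall xi, enorm xi = 1 -> sigma xi = omega xi) ->
      smooth_off0 sigma ->
      (forall xi, xi != 0 -> 0 < sigma xi) ->
      homogeneous_off0 k sigma ->
      (forall g : 'I_N -> nat, (mlen g <= N./2 + 1)%N ->
        forall xi, xi != 0 ->
          `|mpartial g sigma xi| <= A * enorm xi `^ (k - (mlen g)%:R)) ->
      0 <= delta ->
      k * (beta / alpha - 1 / alpha) <= delta < k ->
      forall g : 'I_N -> nat, (mlen g <= N./2 + 1)%N ->
        forall xi, xi != 0 ->
          `|mpartial g (fun x => enorm x `^ delta *
                mittag_leffler alpha beta (- sigma x)) xi|
            <= C * A * enorm xi `^ (- (mlen g)%:R).
Proof.
pose m := (N./2 + 1)%N; pose i0 : 'I_N := Ordinal hN.
(* Any admissible function with the given values on the sphere can serve as the reference; if there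
   is none, there is nothing to bound. *)
have [[k0 [sigma0 [S1 S2 S3 S4]]]|none] := pselect (exists k0 (sigma0 : 'rV[R]_N -> R),
    [/\ forall xi, enorm xi = 1 -> sigma0 xi = omega xi, smooth_off0 sigma0,
        forall xi, xi != 0 -> 0 < sigma0 xi & homogeneous_off0 k0 sigma0]); last first.
  exists 1; split=> // k delta A sigma _ H1 H2 H3 H4.
  by exfalso; apply: none; exists k, sigma.
(* One constant for each list of indices; only finitely many lists are short enough to occur. *)
have /choice[B hB] := fun s => @partials_bound R N alpha halpha k0 sigma0 S2 S3 S4 beta s.
pose total := \sum_(n < m.+1) \sum_(t : n.-tuple 'I_N) `|B t|.
have B_total (s : seq 'I_N) : (size s <= m)%N -> B s <= total.
  move=> sm; apply: (@le_trans _ _ `|B s|); first exact: ler_norm.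
  rewrite /total (bigD1 (Ordinal (sm : (size s < m.+1)%N))) //= (bigD1 (in_tuple s)) //= -addrA lerDl.
  by rewrite addr_ge0 ?sumr_ge0 // => n _; rewrite sumr_ge0.
pose b := omega (basis R i0).
have b0 : 0 < b by rewrite /b -S1 ?enorm_basis // S3 // basis_neq0.
pose L := (4 ^+ m + (1 + (2 * m)%:R) ^+ m) / b.
have L0 : 0 < L.
  by rewrite divr_gt0 // addr_gt0 // exprn_gt0 // addr_gt0 // ltr0n muln_gt0 addn1.
have T0 : 0 <= total by rewrite sumr_ge0 // => n _; rewrite sumr_ge0.
exists ((total + 1) * L); split; first by rewrite mulr_gt0 // ltr_wpDl.
move=> k delta A sigma k1 H1 H2 H3 H4 hA d0 /andP[_ dk] g gm xi xi0.
have n0 := enorm_gt0 xi0.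
have hc : compatible k0 sigma0 k delta sigma.
  split => //; first by rewrite d0 ltW.
  move=> x x0; have u1 := enorm_normalize x0; have u0 := enorm_neq0 u1; have nx := enorm_gt0 x0.
  have {1 3}-> : x = enorm x *: ((enorm x)^-1 *: x) by rewrite scalerA mulfV ?scale1r // gt_eqF.
  rewrite H4 // S4 // H1 // S1 // mulrA -powRD ?subrK //.
  by rewrite (gt_eqF nx) implybT.
rewrite mpartial_foldr; set s := multiplicity_list _ _.
have ss : size s = mlen g by exact: size_multiplicity_list.
have -> : foldr (@partial R N) (fun x => enorm x `^ delta * mittag_leffler alpha beta (- sigma x)) s xi =
    foldr (@partial R N) (fun x => enorm x `^ delta * mlf alpha (sigma x) beta) s xi.
  elim: s {ss} xi xi0 n0 => [|i s IH] xi xi0 n0 /=.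
    by rewrite (mittag_leffler_mlf halpha (ltW (H3 xi xi0)) hbeta).
  by apply: eq_partial => // y y0; apply: IH => //; exact: enorm_gt0.
apply: le_trans (hB s k delta sigma hc xi xi0) _; rewrite ss ler_wpM2r ?powR_ge0 //.
have low : (1 + k) ^+ m <= L * A.
  have mpos : (0 < m)%N by rewrite /m addn1.
  have s0 : 0 < sigma (basis R i0) by apply: H3; exact: basis_neq0.
  have := @derivative_bound_lower R N sigma k A m i0 H4 k1 mpos s0 hA.
  by rewrite (H1 _ (enorm_basis R i0)).
have pow : (1 + k) ^+ mlen g <= (1 + k) ^+ m by apply: ler_weXn2l => //; rewrite lerDl ltW.
have p0 : 0 <= (1 + k) ^+ mlen g by rewrite exprn_ge0 // addr_ge0 // ltW.
apply: (@le_trans _ _ ((total + 1) * (1 + k) ^+ mlen g)).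
  by rewrite ler_wpM2r // (le_trans (B_total s _)) ?ss // lerDl.
by rewrite -mulrA ler_wpM2l ?addr_ge0 // (le_trans pow).
Qed.
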